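(* Let $d\ge 1$, $p>0$, $\alpha\in(0,2)$ and $T>0$. Let $\sigma$, $Q(\cdot\mid u)$, $q$, $M$ and the measure $Q$ on $\mathbb{R}^d$ be as in the context. Let $\{E_j\}_{j\ge1}$ and $\{E'_j\}_{j\ge1}$ be i.i.d. sequences of standard exponential random variables, $\Gamma_j:=E'_1+\cdots+E'_j$, $\{T_j\}$ an i.i.d. sequence of uniform random variables on $(0,T)$, $\{U_j\}$ an i.i.d. sequence of uniform random variables on $(0,1)$, and $\{V_j\}$ an i.i.d. sequence of random vectors in $\mathbb{R}^d$ with distribution $Q/\|\sigma\|$; all these sequences are mutually independent. Assume that either $\alpha\in(0,1)$, or $\alpha\in[1,2)$ and $Q$ is symmetric (i.e. $Q(-A)=Q(A)$ for all Borel $A$). Define $$L_t:=\sum_{j=1}^{\infty}\mathbf{1}_{(0,t]}(T_j)\left(\left(\frac{\alpha\Gamma_j}{\|\sigma\|T}\right)^{-1/\alpha}\wedge\frac{E_j^{1/p}U_j^{1/\alpha}}{\|V_j\|^{1/p}}\right)\frac{V_j}{\|V_j\|},\qquad t\in[0,T].$$ Then this series converges almost surely, uniformly in $t\in[0,T]$, to a Lévy process $L=\{L_t\}_{t\in[0,T]}$ such that $L_1$ has a proper $p$-tempered $\alpha$-stable distribution, i.e. an infinitely divisible distribution with no Gaussian part and Lévy measure $M$.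
   Context: Let $\mathbb{S}^{d-1}$ be the unit sphere in $\mathbb{R}^d$ and $\sigma$ a finite nonzero Borel measure on $\mathbb{S}^{d-1}$ with total mass $\|\sigma\|:=\sigma(\mathbb{S}^{d-1})$. Let $\{Q(\cdot\mid u)\}_{u\in\mathbb{S}^{d-1}}$ be a measurable family of Borel probability measures on $(0,\infty)$ and define the tempering function $q(r,u):=\int_{(0,\infty)}e^{-rs}\,Q(ds\mid u)$ for $r>0$ (so $q(\cdot,u)$ is completely monotone with $\lim_{r\downarrow0}q(r,u)=1$). The Lévy measure is $$M(A):=\int_{\mathbb{S}^{d-1}}\int_0^\infty \mathbf{1}_A(ru)\,q(r^p,u)\,r^{-\alpha-1}\,dr\,\sigma(du),\qquad A\in\mathcal{B}(\mathbb{R}^d).$$ An infinitely divisible distribution with no Gaussian part and Lévy measure of this form is called a proper $p$-tempered $\alpha$-stable distribution. The Borel measure $Q$ on $\mathbb{R}^d$ is $Q(A):=\int_{\mathbb{S}^{d-1}}\int_{(0,\infty)}\mathbf{1}_A(su)\,Q(ds\mid u)\,\sigma(du)$; it has total mass $\|\sigma\|$, so $Q/\|\sigma\|$ is a probability measure. *)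

(* Defs.v *)
From HB Require Import structures.
From mathcomp Require Import all_boot all_order all_algebra finmap.
From mathcomp Require Import all_classical all_reals all_analysis.
Set Implicit Arguments. Unset Strict Implicit. Unset Printing Implicit Defensive.
Import Order.TTheory GRing.Theory Num.Theory.
Import numFieldNormedType.Exports.
Local Open Scope classical_set_scope.
Local Open Scope ring_scope.

(** R^d is represented by [d.-tuple R], which carries the product (= Borel)
    sigma-algebra [g_sigma_preimage] of the coordinate maps. *)
Section vectors.
Context {R : realType} {d : nat}.
Definition vzero : d.-tuple R := [tuple (0:R) | i < d].
Definition vadd (x y : d.-tuple R) : d.-tuple R := [tuple tnth x i + tnth y i | i < d].
Definition vsub (x y : d.-tuple R) : d.-tuple R := [tuple tnth x i - tnth y i | i < d].
Definition vopp (x : d.-tuple R) : d.-tuple R := [tuple - tnth x i | i < d].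
Definition vscale (a : R) (x : d.-tuple R) : d.-tuple R := [tuple a * tnth x i | i < d].
Definition vdot (x y : d.-tuple R) : R := \sum_(i < d) tnth x i * tnth y i.
Definition vnorm (x : d.-tuple R) : R := Num.sqrt (vdot x x).
Definition sphere : set (d.-tuple R) := [set x | vnorm x = 1].
End vectors.

Definition Rpos {R : realType} : set R := `]0, +oo[%classic.

Local Open Scope ereal_scope.

Section tempered_stable.
Context {R : realType} {d : nat}.
Variables (sigma : {finite_measure set (d.-tuple R) -> \bar R})
          (Qk : R.-pker (d.-tuple R) ~> R).

Definition temp_q (r : R) (u : d.-tuple R) : \bar R :=
  \int[Qk u]_(s in Rpos) (expR (- (r * s)))%:E.

Definition levy_M (alpha p : R) (A : set (d.-tuple R)) : \bar R :=
  \int[sigma]_(u in sphere)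
    \int[lebesgue_measure]_(r in Rpos)
      ((\1_A (vscale r u))%:E * temp_q (r `^ p) u * (r `^ (- alpha - 1))%:E).

Definition measQ (A : set (d.-tuple R)) : \bar R :=
  \int[sigma]_(u in sphere)
    \int[Qk u]_(s in Rpos) (\1_A (vscale s u))%:E.
End tempered_stable.

Section probability_defs.
Context {R : realType} {dO : measure_display} {Omega : measurableType dO}.
Variable P : probability Omega R.

Definition rv_events {d'} {T' : measurableType d'} (X : Omega -> T') : set (set Omega) :=
  [set X @^-1` B | B in measurable].

Definition mutually_independent (I : choiceType) (F : I -> set (set Omega)) :=
  forall (J : {fset I}) (A : I -> set Omega),
    (forall i, i \in J -> F i (A i)) ->
    P (\bigcap_(i in [set i | i \in J]) A i) = \prod_(i <- J) P (A i).

Definition levy_process {d : nat} (T : R) (L : R -> Omega -> d.-tuple R) :=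
  ( (forall t, 0 <= t <= T -> measurable_fun setT (L t))%R) /\
      {ae P, forall w, L 0%R w = vzero} /\
      (forall (n : nat) (t : nat -> R),
         (0 <= t 0%N)%R -> (forall k, (k < n)%N -> (t k < t k.+1)%R) -> (t n <= T)%R ->
         mutually_independent
           (fun k : 'I_n => rv_events (fun w => vsub (L (t k.+1) w) (L (t k) w)))) /\
      (forall s s' h : R, (0 <= s)%R -> (0 <= s')%R -> (0 <= h)%R ->
         (s + h <= T)%R -> (s' + h <= T)%R ->
         forall B : set (d.-tuple R), measurable B ->
           P [set w | B (vsub (L (s + h)%R w) (L s w))] =
           P [set w | B (vsub (L (s' + h)%R w) (L s' w))]) /\
      (forall t : R, (0 <= t <= T)%R -> forall eps eta : R, (0 < eps)%R -> (0 < eta)%R ->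
         exists2 delta : R, (0 < delta)%R & forall s : R, (0 <= s <= T)%R ->
           (`|s - t| < delta)%R ->
           P [set w | (eps < vnorm (vsub (L s w) (L t w)))%R] < eta%:E) /\
      {ae P, forall w,
         (forall t : R, (0 <= t < T)%R -> forall eps : R, (0 < eps)%R ->
            exists2 delta : R, (0 < delta)%R & forall s : R,
              (t <= s < t + delta)%R -> (s <= T)%R ->
              (vnorm (vsub (L s w) (L t w)) < eps)%R) /\
         (forall t : R, (0 < t <= T)%R -> exists l : d.-tuple R,
            forall eps : R, (0 < eps)%R ->
            exists2 delta : R, (0 < delta)%R & forall s : R,
              (t - delta < s < t)%R -> (0 <= s)%R ->
              (vnorm (vsub (L s w) l) < eps)%R)}.

Definition chf_re {d : nat} (X : Omega -> d.-tuple R) (z : d.-tuple R) : \bar R :=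
  \int[P]_(w in setT) (cos (vdot z (X w)))%:E.
Definition chf_im {d : nat} (X : Omega -> d.-tuple R) (z : d.-tuple R) : \bar R :=
  \int[P]_(w in setT) (sin (vdot z (X w)))%:E.
End probability_defs.

Section levy_khintchine.
Context {R : realType} {d : nat}.
Definition is_levy_measure (M : set (d.-tuple R) -> \bar R) :=
  M [set vzero] = 0 /\
  \int[M]_(x in setT) (Num.min 1 (vnorm x ^+ 2))%:E < +oo.

(** Re psi(z) and Im psi(z) of the Levy-Khintchine exponent
    psi(z) = i<b,z> + int (e^{i<z,x>} - 1 - i<z,x> 1_{|x|<=1}) M(dx)
    (no Gaussian part) *)
Definition lk_re (M : set (d.-tuple R) -> \bar R) (z : d.-tuple R) : R :=
  fine (\int[M]_(x in setT) (cos (vdot z x) - 1)%:E).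
Definition lk_im (M : set (d.-tuple R) -> \bar R) (b z : d.-tuple R) : R :=
  vdot b z +
  fine (\int[M]_(x in setT)
          (sin (vdot z x) - vdot z x * (\1_[set y | (vnorm y <= 1)%R] x))%:E).
End levy_khintchine.

Section series.
Context {R : realType} {d : nat} {Omega : Type}.
Variables (alpha p T sig : R) (E E' Tt U : nat -> Omega -> R)
          (V : nat -> Omega -> d.-tuple R).
(** Gamma_{j+1} = E'_1 + ... + E'_{j+1}  (0-based indices) *)
Definition Gam (j : nat) (w : Omega) : R := (\sum_(i < j.+1) E' i w)%R.
Definition ts_term (j : nat) (t : R) (w : Omega) : d.-tuple R :=
  vscale (((\1_[set x | (0 < x <= t)%R] (Tt j w)) *
           Num.min ((alpha * Gam j w / (sig * T)) `^ (- alpha^-1))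
                   (E j w `^ p^-1 * U j w `^ alpha^-1 / vnorm (V j w) `^ p^-1)) /
          vnorm (V j w))%R (V j w).
Definition ts_partial (n : nat) (t : R) (w : Omega) : d.-tuple R :=
  \big[vadd/vzero]_(j < n) ts_term j t w.
End series.

(* Main.v *)
(** The pairs (arrival time, mark) form a marked Poisson process on (0,oo), and
    each jump is a function of its pair.  For alpha < 1 the series converges
    absolutely; in the symmetric case one freezes the arrival times and flips the
    signs of the V_j, and Levy's maximal inequality over dyadic blocks together
    with Borel-Cantelli gives uniform convergence.

    For the law, let g x be the mean of exp(i theta(x, mark)), where theta collects
    the phases of finitely many increments, and F s = exp(int_s^oo (g - 1)).  Then
    F s = int_0^oo e^{-x} g(s+x) F(s+x) dx, so exp(i sum_{j<=n} theta(Gamma_j, m_j)) F(Gamma_n)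
    has constant mean F 0, and n -> oo gives the joint characteristic function of
    the increments.  Fourier uniqueness then yields independence and stationarity.

    The image of dx (x) law(mark) under the jump map is T times the Levy measure:
    along a fixed direction both measures have the same tails, by the substitution
    u = (r/a)^(-alpha). *)
Require Import Defs.
From HB Require Import structures.
From mathcomp Require Import all_boot all_order all_algebra finmap.
From mathcomp Require Import all_classical all_reals all_analysis.
From mathcomp Require Import measurable_realfun.
From mathcomp Require Import ring lra zify.
Set Implicit Arguments. Unset Strict Implicit. Unset Printing Implicit Defensive.
Import Order.TTheory GRing.Theory Num.Theory.
Import numFieldNormedType.Exports.
Local Open Scope classical_set_scope.
Local Open Scope ring_scope.

(** Complex exponentials are carried as pairs of a cosine and a sine with bounded real weights, so
    identities come in pairs. Fubini over a coarser sigma-algebra does the work of conditional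
    expectation.

    The second-moment bound for random signs needs jumps with a deterministic bound, whereas
    [Gamma_j] may be small. A Chernoff estimate gives [Gamma_j >= j / 4] eventually, so jumps are
    cut off on this event, which does not involve the [V_j]. A block of [2^k] cut jumps has sum of
    squares of order [r^k], with [r = 2^(1 - 2/alpha) < 1]; levels [r^(k/4)] are summable and leave
    probabilities of order [r^(k/2)]. Uniformity in [t] asks for a maximum over both the number of
    terms and the time, hence a doubled maximal inequality.

    The integral of [g - 1] converges because a jump at arrival [x] has size at most of order
    [x^(-1/alpha)]: its square is integrable at infinity, and the first-order part either is so too
    ([alpha < 1]) or averages to 0 (symmetry). Increments separate because a jump time lies in at
    most one interval of a partition.

    [levy_M] is only a set function; it is replaced by a true measure that agrees with it on sets
    avoiding the origin. *)

Section bounded_measurable.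
Context d (T : measurableType d) (R : realType).
Implicit Types f g : T -> R.

(** Boundedness is part of the class so that membership alone yields integrability under a finite
    measure; sums, products and compositions stay in it. *)
Definition bmf f := measurable_fun setT f /\ exists C, forall x, `|f x| <= C.

Lemma bmf_measurable f : bmf f -> measurable_fun setT f. Proof. by case. Qed.

Lemma bmf_cst (c : R) : bmf (fun=> c).
Proof. by split=> //; exists `|c| => x. Qed.

Lemma bmfD f g : bmf f -> bmf g -> bmf (fun x => f x + g x).
Proof.
move=> [mf [C fC]] [mg [D gD]]; split; first exact: measurable_funD.
by exists (C + D) => x; rewrite (le_trans (ler_normD _ _))// lerD.
Qed.

Lemma bmfN f : bmf f -> bmf (fun x => - f x).
Proof.
move=> [mf [C fC]]; split; first exact: measurableT_comp.
by exists C => x; rewrite normrN.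
Qed.

Lemma bmfB f g : bmf f -> bmf g -> bmf (fun x => f x - g x).
Proof. by move=> bf bg; apply: bmfD => //; exact: bmfN. Qed.

Lemma bmfM f g : bmf f -> bmf g -> bmf (fun x => f x * g x).
Proof.
move=> [mf [C fC]] [mg [D gD]]; split; first exact: measurable_funM.
by exists (C * D) => x; rewrite normrM ler_pM.
Qed.

Lemma bmf_cos f : measurable_fun setT f -> bmf (fun x => cos (f x)).
Proof.
move=> mf; split.
  apply: (@measurableT_comp _ _ _ _ _ _ (@cos R)) => //.
  by apply: continuous_measurable_fun; exact: continuous_cos.
by exists 1 => x; rewrite ler_norml cos_geN1 cos_le1.
Qed.

Lemma bmf_sin f : measurable_fun setT f -> bmf (fun x => sin (f x)).
Proof.
move=> mf; split.
  apply: (@measurableT_comp _ _ _ _ _ _ (@sin R)) => //.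
  by apply: continuous_measurable_fun; exact: continuous_sin.
by exists 1 => x; rewrite ler_norml sin_geN1 sin_le1.
Qed.

Lemma bmf_indic (A : set T) : measurable A -> bmf (\1_A : T -> R).
Proof.
move=> mA; split; first exact: measurable_indic.
by exists 1 => x; rewrite indicE; case: (x \in A); rewrite ?normr1 ?normr0.
Qed.

Lemma bmf_prod (I : Type) (s : seq I) (F : I -> T -> R) :
  (forall i, bmf (F i)) -> bmf (fun x => \prod_(i <- s) F i x).
Proof.
move=> bF; elim: s => [|i s ih].
  have -> : (fun x : T => \prod_(i <- [::]) F i x) = fun=> 1.
    by apply/funext => x; rewrite big_nil.
  exact: bmf_cst.
have -> : (fun x : T => \prod_(j <- i :: s) F j x) =
          fun x => F i x * \prod_(j <- s) F j x.
  by apply/funext => x; rewrite big_cons.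
exact: bmfM.
Qed.

Lemma bmf_integrable (mu : {finite_measure set T -> \bar R}) f :
  bmf f -> mu.-integrable setT (EFin \o f).
Proof.
move=> [mf [C fC]]; apply: (@le_integrable _ _ _ mu _ measurableT _ (cst C%:E)).
- exact/measurable_EFinP.
- by move=> x _ /=; rewrite lee_fin (le_trans (fC x))// ler_norm.
- exact: finite_measure_integrable_cst.
Qed.

End bounded_measurable.

Lemma bmf_comp d1 d2 (T1 : measurableType d1) (T2 : measurableType d2)
    (R : realType) (h : T1 -> T2) (f : T2 -> R) :
  measurable_fun setT h -> bmf f -> bmf (f \o h).
Proof.
move=> mh [mf [C fC]]; split; first exact: measurableT_comp.
by exists C => x; exact: fC.
Qed.

(** * Expectations of bounded random variables *)

Section expectation.
Context d (T : measurableType d) (R : realType) (P : probability T R).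
Implicit Types f g : T -> R.

Lemma RE_EFin f : bmf f -> (\int[P]_x (f x)%:E)%E = (\int[P]_x f x)%:E.
Proof.
move=> /(bmf_integrable P)/(integrable_fin_num measurableT) h.
by rewrite /Rintegral fineK.
Qed.

Lemma RE_cst (c : R) : \int[P]_x c = c.
Proof. by rewrite Rintegral_cst//= [X in fine X](@probability_setT _ _ _ P) mulr1. Qed.

Lemma RED f g : bmf f -> bmf g ->
  \int[P]_x (f x + g x) = \int[P]_x f x + \int[P]_x g x.
Proof. by move=> bf bg; rewrite RintegralD//; exact: bmf_integrable. Qed.

Lemma REB f g : bmf f -> bmf g ->
  \int[P]_x (f x - g x) = \int[P]_x f x - \int[P]_x g x.
Proof. by move=> bf bg; rewrite RintegralB//; exact: bmf_integrable. Qed.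

Lemma REZ (c : R) f : bmf f -> \int[P]_x (c * f x) = c * \int[P]_x f x.
Proof. by move=> bf; rewrite RintegralZl//; exact: bmf_integrable. Qed.

Lemma RE_indic (A : set T) : measurable A -> \int[P]_x (\1_A x : R) = fine (P A).
Proof. by move=> mA; rewrite /Rintegral integral_indic// setIT. Qed.

Lemma le_RE f g : bmf f -> bmf g -> (forall x, f x <= g x) ->
  \int[P]_x f x <= \int[P]_x g x.
Proof. by move=> bf bg fg; apply: le_Rintegral => //; exact: bmf_integrable. Qed.

Lemma RE_norm_le f C : bmf f -> (forall x, `|f x| <= C) ->
  `|\int[P]_x f x| <= C.
Proof.
move=> bf fC; rewrite -[leRHS]RE_cst.
apply: (le_trans (le_normr_Rintegral _ _)) => //; first exact: bmf_integrable.
apply: le_RE => //; last exact: bmf_cst.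
split; last by exists C => x; rewrite normr_id.
by apply: measurableT_comp => //; exact: bmf_measurable.
Qed.

Lemma RE_sum (I : Type) (s : seq I) (F : I -> T -> R) :
  (forall i, bmf (F i)) ->
  \int[P]_x (\sum_(i <- s) F i x) = \sum_(i <- s) \int[P]_x F i x.
Proof.
move=> bF; suff [] : bmf (fun x => \sum_(i <- s) F i x) /\
  \int[P]_x (\sum_(i <- s) F i x) = \sum_(i <- s) \int[P]_x F i x by [].
elim: s => [|i s [bs ih]].
  have -> : (fun x : T => \sum_(i <- [::]) F i x) = fun=> 0.
    by apply/funext => x; rewrite big_nil.
  by split; [exact: bmf_cst|rewrite RE_cst big_nil].
have -> : (fun x : T => \sum_(j <- i :: s) F j x) =
          fun x => F i x + \sum_(j <- s) F j x.
  by apply/funext => x; rewrite big_cons.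
by split; [exact: bmfD|rewrite RED// ih big_cons].
Qed.

Lemma RE_ae_eq f g : bmf f -> bmf g -> {ae P, forall x, f x = g x} ->
  \int[P]_x f x = \int[P]_x g x.
Proof.
move=> [mf _] [mg _] fg; congr fine; apply: ae_eq_integral => //.
- exact/measurable_EFinP.
- exact/measurable_EFinP.
- by case: fg => A [mA A0 sub]; exists A; split=> // x /= h; apply: sub => /= e;
    apply: h => _; rewrite e.
Qed.

Lemma RE_dominated_cvg (f_ : nat -> T -> R) f (C : R) :
  (forall n, measurable_fun setT (f_ n)) -> measurable_fun setT f ->
  (forall n x, `|f_ n x| <= C) ->
  {ae P, forall x, f_ n x @[n --> \oo] --> f x} ->
  (\int[P]_x f_ n x) @[n --> \oo] --> \int[P]_x f x.
Proof.
move=> mf_ mf fC cvf.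
have [] := @dominated_convergence _ _ _ P setT measurableT
  (fun n x => (f_ n x)%:E) (EFin \o f) (cst C%:E).
- by move=> n; exact/measurable_EFinP.
- exact/measurable_EFinP.
- case: cvf => A [mA A0 sub]; exists A; split=> // x /= h; apply: sub => /= e.
  by apply: h => _; apply/cvg_EFin => //; exact: nearW.
- exact: finite_measure_integrable_cst.
- by apply: aeW => x n _ /=; rewrite lee_fin.
- move=> if_ _ cv; apply: fine_cvg; rewrite fineK//.
  exact: (integrable_fin_num measurableT).
Qed.

End expectation.

(** * Freezing and independence of generated sigma-algebras *)

Section freezing.
Context {R : realType} d (Om : measurableType d) (P : probability Om R).
Variable G : set (set Om).
Hypothesis mG : G `<=` measurable.
Local Notation Om' := (g_sigma_algebraType G).

Lemma g_sigma_sub A : <<s G >> A -> measurable A.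
Proof. by apply: smallest_sub => //; exact: sigma_algebra_measurable. Qed.

(** [Om'] has the points of [Om] but only the events generated by [G]. A function of the information
    in [G] is a measurable map on [Om'], and becomes a random variable on [Om] by this passage. *)
Lemma measurable_fun_coarse d' (S : measurableType d') (f : Om' -> S) :
  measurable_fun setT f -> measurable_fun setT (f : Om -> S).
Proof.
move=> mf _ B mB; rewrite setTI; apply: g_sigma_sub.
by have := mf measurableT B mB; rewrite setTI.
Qed.

Lemma bmf_coarse (f : Om' -> R) : bmf f -> bmf (f : Om -> R).
Proof. by move=> [mf Cf]; split=> //; exact: measurable_fun_coarse. Qed.

Context d' (S : measurableType d') (nu : probability S R).
Variable Y : Om -> S.
Hypothesis mY : measurable_fun setT Y.
Hypothesis indep : forall A B, <<s G >> A -> measurable B ->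
  P (A `&` Y @^-1` B) = (P A * nu B)%E.

Let idm : Om -> Om' := id.
Let midm : measurable_fun setT idm.
Proof. by move=> _ B mB; rewrite setTI; exact: g_sigma_sub. Qed.
Let idm_mf : {mfun Om >-> Om'} := HB.pack idm (isMeasurableFun.Build _ _ _ _ idm midm).
Let P' : probability Om' R := distribution P idm_mf.

Let pr (w : Om) : (Om' * S)%type := (idm w, Y w).
Let mpr : measurable_fun setT pr.
Proof. exact: measurable_fun_pair. Qed.
Let pr_mf : {mfun Om >-> (Om' * S)%type} := HB.pack pr (isMeasurableFun.Build _ _ _ _ pr mpr).

Let PY : probability (Om' * S)%type R := (P' \x nu)%E.

(** Independence says that the joint law of the identity into [Om'] and of [Y] agrees with a product
    measure on rectangles, hence everywhere. *)
Let law X : measurable X -> (P' \x nu)%E X = distribution P pr_mf X.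
Proof.
move=> mX; apply: product_measure_unique => // A B mA mB.
Qed.

Lemma bmf_frozen (f : Om' * S -> R) : bmf f ->
  bmf (fun w : Om' => \int[nu]_y f (w, y)).
Proof.
move=> bf; have intf := bmf_integrable PY bf.
split.
  by apply: (@measurableT_comp _ _ _ _ _ _ (@fine R)) => //; exact: measurable_fubini_F intf.
case: (bf) => _ [C fC]; exists C => w; apply: RE_norm_le => //.
by apply: (@bmf_comp _ _ _ _ _ (fun y => (w, y))) => //; exact: pair1_measurable.
Qed.

(** Fubini for the product law above: the information in [G] is held fixed while [Y] is averaged. *)
Lemma freezing (f : Om' * S -> R) : bmf f ->
  \int[P]_w f (w, Y w) = \int[P]_w \int[nu]_y f (w, y).
Proof.
move=> bf.
have intf := bmf_integrable PY bf.
have bF := bmf_frozen bf.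
have bf2 w : bmf (fun y => f (w, y)).
  by apply: (@bmf_comp _ _ _ _ _ (fun y => (w, y))) => //; exact: pair1_measurable.
apply: EFin_inj.
rewrite -RE_EFin; last exact: (bmf_comp mpr bf).
rewrite -RE_EFin; last exact: bmf_coarse.
transitivity (\int[distribution P pr_mf]_z (f z)%:E)%E.
  rewrite integral_pushforward//; last exact: (bmf_integrable P (bmf_comp mpr bf)).
  by apply/measurable_EFinP; case: bf.
rewrite -(@eq_measure_integral _ _ _ _ _ (P' \x nu)%E); last first.
  by move=> A mA _; exact: law.
rewrite -integral12_prod_meas1//.
rewrite /fubini_F/=.
under eq_integral do rewrite RE_EFin//.
rewrite integral_pushforward//; first by apply/measurable_EFinP; case: bF.
exact: (bmf_integrable P (bmf_coarse bF)).
Qed.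

End freezing.

Section independence.
Context {R : realType} d (Om : measurableType d) (P : probability Om R).

(** For fixed [B] both sides are finite measures in [A]; they agree on a pi-system containing the
    whole space, hence on the sigma-algebra it generates. *)
Lemma indep_event_ext (G : set (set Om)) (B : set Om) :
  G `<=` measurable -> setI_closed G -> G setT -> measurable B ->
  (forall A, G A -> P (A `&` B) = (P A * P B)%E) ->
  forall A, <<s G >> A -> P (A `&` B) = (P A * P B)%E.
Proof.
move=> mG GI GT mB h A sA.
have PB0 : 0 <= fine (P B) by exact: fine_ge0.
have PBE : (fine (P B))%:E = P B by rewrite fineK ?fin_num_measure.
have := @g_sigma_algebra_measure_unique _ _ _ G mG (fun=> setT) _ _
  (mrestr P mB) (mscale (NngNum PB0) P) GI _ _ A sA.
rewrite /mrestr/= /mscale/= PBE muleC; apply => //.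
- by rewrite bigcup_const//; exists 0%N.
- by move=> X GX; rewrite /mrestr h// muleC -PBE.
- by move=> _; rewrite /mrestr setTI ltey_eq fin_num_measure.
Qed.

Lemma indep_gen_ext (G H : set (set Om)) :
  G `<=` measurable -> setI_closed G -> G setT ->
  H `<=` measurable -> setI_closed H -> H setT ->
  (forall A B, G A -> H B -> P (A `&` B) = (P A * P B)%E) ->
  forall A B, <<s G >> A -> <<s H >> B -> P (A `&` B) = (P A * P B)%E.
Proof.
move=> mG GI GT mH HI HT h A B sA sB.
apply: (@indep_event_ext G) => //; first exact: (g_sigma_sub mH).
move=> A' GA; rewrite setIC muleC.
apply: (@indep_event_ext H) => //; first exact: mG.
by move=> C HC; rewrite setIC muleC; exact: h.
Qed.

Context (I : choiceType) (F : I -> set (set Om)).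
Hypothesis mF : forall i, F i `<=` measurable.
Hypothesis FI : forall i, setI_closed (F i).
Hypothesis FT : forall i, F i setT.
Hypothesis indepF : mutually_independent P F.

(** The union of the [F i] over [i] in [J] is not stable under intersection; its finite
    intersections are, and they generate the same sigma-algebra, that of everything indexed by
    [J]. *)
Definition pisys (J : set I) : set (set Om) :=
  [set A | exists (K : {fset I}) (B : I -> set Om),
    [/\ (forall i, i \in K -> J i), (forall i, i \in K -> F i (B i)) &
        A = \bigcap_(i in [set i | i \in K]) B i]].

Lemma pisysT J : pisys J setT.
Proof. by exists fset0, (fun=> setT); split=> //; rewrite bigcapT. Qed.

Lemma pisys1 J i A : J i -> F i A -> pisys J A.
Proof.
move=> Ji FA; exists [fset i]%fset, (fun=> A); split.
- by move=> j /[!inE] /eqP ->.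
- by move=> j /[!inE] /eqP ->.
- rewrite bigcap_const//; first by exists i => /=; rewrite inE.
Qed.

Lemma pisys_measurable J : pisys J `<=` measurable.
Proof.
move=> A [K [B [_ FB ->]]]; apply: fin_bigcap_measurable; first exact: finite_fset.
by move=> i iK; apply: mF; exact: FB.
Qed.

Lemma pisysI J : setI_closed (pisys J).
Proof.
move=> A A' [K [B [KJ FB ->]]] [K' [B' [KJ' FB' ->]]].
exists (K `|` K')%fset, (fun i => (if i \in K then B i else setT) `&`
  (if i \in K' then B' i else setT)); split.
- by move=> i /[!inE] /orP[/KJ|/KJ'].
- move=> i _; apply: FI.
    by case: ifPn => [/FB|_].
  by case: ifPn => [/FB'|_].
- apply/seteqP; split => w /=.
    move=> [h h'] i /= /[!inE] _; split.
      by case: ifPn => [/h|].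
    by case: ifPn => [/h'|].
  move=> h; split => i iK.
    by have [] := h i; rewrite /= ?inE ?iK.
  by have [] := h i; rewrite /= ?inE ?iK ?orbT.
Qed.

(** For generators, the two finite families glue into one indexed by the union, since no index
    occurs in both; mutual independence then factors all three probabilities. *)
Lemma pisys_indep (J J' : set I) : J `&` J' = set0 ->
  forall A B, <<s pisys J >> A -> <<s pisys J' >> B ->
  P (A `&` B) = (P A * P B)%E.
Proof.
move=> JJ'; apply: indep_gen_ext; try exact: pisysI; try exact: pisysT;
  try exact: pisys_measurable.
move=> _ _ [K [B [KJ FB ->]]] [K' [B' [KJ' FB' ->]]].
have KK' i : i \in K -> i \in K' -> False.
  by move=> /KJ Ji /KJ' J'i; have : (J `&` J') i by []; rewrite JJ'.
pose C i := if i \in K then B i else B' i.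
have CK : \bigcap_(i in [set i | i \in K]) B i =
          \bigcap_(i in [set i | i \in K]) C i.
  by apply: eq_bigcapr => i /= iK; rewrite /C iK.
have CK' : \bigcap_(i in [set i | i \in K']) B' i =
          \bigcap_(i in [set i | i \in K']) C i.
  apply: eq_bigcapr => i /= iK; rewrite /C ifN//; apply/negP => iK'.
  exact: (KK' i).
rewrite CK CK' -bigcap_setU.
have -> : [set i | i \in K] `|` [set i | i \in K'] =
          [set i | i \in (K `|` K')%fset].
  apply/seteqP; split => i /=; rewrite inE; first by case=> ->; rewrite ?orbT.
  by move=> /orP.
rewrite !indepF.
- rewrite -big_cat/=; apply: perm_big; apply: uniq_perm.
  + exact: fset_uniq.
  + rewrite cat_uniq !fset_uniq/= andbT; apply/hasPn => i iK'.
    by apply/negP => iK; exact: (KK' i).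
  + by move=> i; rewrite mem_cat inE.
- by move=> i iK; rewrite /C ifN; [exact: FB'|apply/negP => /KK'; exact].
- by move=> i iK; rewrite /C iK; exact: FB.
- move=> i; rewrite inE /C; case: ifPn => [/FB//|_ /=]; exact: FB'.
Qed.

End independence.

(** Left transparent by [Defined]: later steps identify it with [exponential_prob 1], and its values
    with integrals of the density, by conversion. *)
Definition expo (R : realType) : probability (measurableTypeR R) R.
Proof. refine (exponential_prob 1 : probability (measurableTypeR R) _); exact: ltr01. Defined.

(** * Measures with a density and the exponential law *)

Section density.
Context d (T : measurableType d) (R : realType).
Variables (mu nu : {measure set T -> \bar R}) (g : T -> R).
Hypotheses (g0 : forall x, 0 <= g x) (mg : measurable_fun setT g).
Hypothesis nuE : forall A, measurable A -> nu A = (\int[mu]_(x in A) (g x)%:E)%E.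

Import HBNNSimple.

Let integral_density_indic A : measurable A ->
  (\int[nu]_x (\1_A x)%:E = \int[mu]_x ((\1_A x)%:E * (g x)%:E))%E.
Proof.
move=> mA; rewrite integral_indic// setIT nuE// integral_mkcond.
apply: eq_integral => x _; rewrite patchE indicE.
by case: ifPn => _; rewrite ?mul1e ?mul0e.
Qed.

Let integral_density_nnsfun (f : {nnsfun T >-> R}) :
  (\int[nu]_x (f x)%:E = \int[mu]_x ((f x)%:E * (g x)%:E))%E.
Proof.
under [LHS]eq_integral do rewrite fimfunE -fsumEFin//.
rewrite [LHS]ge0_integral_fsum//; last 2 first.
  - by move=> r; exact/measurable_EFinP/measurableT_comp.
  - by move=> n x _; rewrite EFinM nnfun_muleindic_ge0.
under [RHS]eq_integral.
  move=> x xD; rewrite fimfunE -fsumEFin// ge0_mule_fsuml; last first.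
    by move=> r; rewrite EFinM nnfun_muleindic_ge0.
  over.
rewrite [RHS]ge0_integral_fsum//; last 2 first.
  - move=> r; apply: emeasurable_funM.
      by apply/measurable_EFinP; apply/measurableT_comp => //.
    exact/measurable_EFinP.
  - move=> n x _; rewrite mule_ge0//; last by rewrite lee_fin.
    by rewrite EFinM nnfun_muleindic_ge0.
apply: eq_fsbigr => r; rewrite inE/= => -[y _ ry].
have r0 : 0 <= r by rewrite -ry.
under eq_integral do rewrite EFinM.
rewrite ge0_integralZl//.
- rewrite integral_density_indic//.
  rewrite -ge0_integralZl//.
  + by apply: eq_integral => x _; rewrite EFinM muleA.
  + apply: emeasurable_funM; apply/measurable_EFinP => //; exact: measurable_indic.
  + by move=> x _; rewrite mule_ge0// lee_fin.
- exact/measurable_EFinP/measurable_indic.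
Qed.

Lemma ge0_integral_density (f : T -> \bar R) :
  measurable_fun setT f -> (forall x, 0 <= f x)%E ->
  (\int[nu]_x f x = \int[mu]_x (f x * (g x)%:E))%E.
Proof.
move=> mf f0.
pose f_ := nnsfun_approx measurableT mf.
transitivity (lim (\int[nu]_x (f_ n x)%:E @[n --> \oo])%E).
  rewrite -monotone_convergence//=.
  - apply: eq_integral => ? /[!inE] xD; apply/esym/cvg_lim => //=.
    exact: cvg_nnsfun_approx.
  - by move=> n; exact/measurable_EFinP/measurable_funTS.
  - by move=> n ? _; rewrite lee_fin.
  - by move=> ? _ ? ? mn; rewrite lee_fin; exact/lefP/nd_nnsfun_approx.
rewrite [RHS](_ : _ = lim (\int[mu]_x ((f_ n x)%:E * (g x)%:E) @[n --> \oo])%E).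
  by apply: congr_lim; apply/funext => n /=; exact: integral_density_nnsfun.
rewrite -monotone_convergence//=.
- apply: eq_integral => x /[!inE] xD; apply/esym/cvg_lim => //.
  apply: cvgeZr => //.
  exact: cvg_nnsfun_approx.
- move=> n; apply: emeasurable_funM; apply/measurable_EFinP => //.
- by move=> n ? _; rewrite mule_ge0// lee_fin.
- move=> x _ m n mn; apply: lee_wpmul2r; rewrite lee_fin//.
  by exact/lefP/nd_nnsfun_approx.
Qed.

End density.

Section density_probability.
Context d (T : measurableType d) (R : realType).
Variables (mu : {measure set T -> \bar R}) (nu : probability T R) (g : T -> R).
Hypotheses (g0 : forall x, 0 <= g x) (mg : measurable_fun setT g).
Hypothesis nuE : forall A, measurable A -> nu A = (\int[mu]_(x in A) (g x)%:E)%E.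

Lemma integrable_density (f : T -> R) : bmf f ->
  mu.-integrable setT (fun x => (f x * g x)%:E).
Proof.
move=> [mf [C fC]].
have ig : mu.-integrable setT (EFin \o g).
  apply/integrableP; split; first exact/measurable_EFinP.
  under eq_integral do rewrite /= ger0_norm//.
  by rewrite -nuE// (@probability_setT _ _ _ nu) ltry.
have iCg : mu.-integrable setT (fun x => (C * g x)%:E).
  by under eq_fun do rewrite EFinM; exact: integrableZl.
apply: (le_integrable measurableT _ _ iCg).
  by apply/measurable_EFinP; exact: measurable_funM.
move=> x _ /=; rewrite lee_fin !normrM ler_wpM2r// (le_trans (fC x))//.
exact: ler_norm.
Qed.

Lemma RE_density (f : T -> R) : bmf f ->
  \int[nu]_x f x = \int[mu]_x (f x * g x).
Proof.
move=> bf; have [mf [C fC]] := bf.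
(* The density formula concerns nonnegative functions; adding the bound [C] makes the integrand
   nonnegative, and the constant is removed at the end. *)
have bC : bmf (fun x => f x + C) by apply: bmfD => //; exact: bmf_cst.
have pos x : 0 <= f x + C by rewrite -lerBlDr sub0r lerNl (le_trans _ (fC x))// -normrN ler_norm.
have : \int[nu]_x (f x + C) = \int[mu]_x ((f x + C) * g x).
  congr fine; rewrite (@ge0_integral_density _ _ _ mu nu g)//.
  by apply/measurable_EFinP; case: bC.
have cC : bmf (fun _ : T => C) by exact: bmf_cst.
rewrite RED//.
under [RHS]eq_Rintegral do rewrite mulrDl.
rewrite RintegralD//; [|exact: integrable_density|exact: integrable_density].
suff -> : \int[mu]_x (C * g x) = \int[nu]_x C by move=> /addIr.
rewrite RE_cst RintegralZl//; last first.
  have := integrable_density (bmf_cst _ (1 : R)).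
  by under eq_fun do rewrite mul1r.
by rewrite /Rintegral -nuE// (@probability_setT _ _ _ nu) mulr1.
Qed.

End density_probability.

Section exponential_law.
Context {R : realType}.
Local Notation mu := (@lebesgue_measure R).
Local Notation mR := (measurableTypeR R).

Lemma expo_density (A : set mR) : measurable A ->
  expo R A = (\int[mu]_(x in A) (exponential_pdf 1 x)%:E)%E.
Proof. by []. Qed.

Lemma expo_ge0 : expo R `]-oo, 0]%classic = 0%E.
Proof.
(* The density vanishes only on the open half line, so the endpoint 0 is first discarded as a null
   set. *)
rewrite expo_density// -integral_itv_bndo_bndc//; last first.
  by apply/measurable_EFinP/measurable_funTS; exact: measurable_exponential_pdf.
by apply: integral0_eq => x /=; rewrite in_itv/= => x0; rewrite lt0_exponential_pdf.
Qed.

Lemma expo_ae_gt0 : {ae expo R, forall x : mR, 0 < x}.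
Proof.
exists `]-oo, 0]%classic; split=> //; first exact: expo_ge0.
by move=> x /= /negP; rewrite -leNgt in_itv.
Qed.

(* The truncation to [1/(n+2), n+2] avoids any assumption on f at 0. *)
Lemma expo_FTC (f G : R -> R) : bmf (f : mR -> R) ->
  (forall x : R, 0 < x -> {for x, continuous f}) ->
  (forall x : R, 0 < x -> is_derive x 1 G (f x * expR (- x))) ->
  G x @[x --> 0^'+] --> G 0 -> G x @[x --> +oo] --> (0 : R) ->
  \int[expo R]_x f x = - G 0.
Proof.
move=> bf cf dG G0 Goo.
(* [n.+2] rather than [n.+1]: the interval must be nondegenerate already for [n = 0]. *)
pose a n : R := n.+2%:R^-1.
pose b n : R := n.+2%:R.
have a0 n : 0 < a n by rewrite /a invr_gt0.
have ab n : a n < b n.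
  rewrite /a /b (@lt_le_trans _ _ 1)// ?invf_lt1// ?ltr1n// ler1n//.
pose f_ n x := f x * \1_(`[a n, b n]%classic : set mR) x.
have bf_ n : bmf (f_ n : mR -> R).
  by apply: bmfM => //; apply: bmf_indic; exact: measurable_itv.
have [mf [C fC]] := bf.
have cva : a @ \oo --> (0 : R).
  by rewrite /a; have := @cvg_harmonic R; rewrite -(cvg_shiftS (@harmonic R)).
have cvb : b @ \oo --> +oo.
  apply/cvgryPge => M; near=> n; rewrite /b (@le_trans _ _ n%:R)// ?ler_nat//; last by lia.
  by near: n; exact: nbhs_infty_ger.
have cv1 : (\int[expo R]_x f_ n x) @[n --> \oo] --> \int[expo R]_x f x.
  apply: (@RE_dominated_cvg _ _ _ _ _ _ C) => //.
  - by move=> n; case: (bf_ n).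
  - move=> n x; rewrite /f_ normrM (le_trans _ (fC x))// ler_piMr//.
    by rewrite indicE; case: (x \in _); rewrite ?normr1 ?normr0.
  - have [A [mA A0 sub]] := expo_ae_gt0; exists A; split=> //.
    move=> x /= h; apply: sub => /= x0; apply: h.
    apply: (@cvg_trans _ (nbhs (f x))); last by [].
    apply: cvg_near_cst; near=> n; rewrite /f_ indicE mem_set ?mulr1//=.
    rewrite in_itv/=; apply/andP; split.
      by near: n; apply: (cvgr_le 0).
    by near: n; apply: (cvgry_ge cvb).
have e n : \int[expo R]_x f_ n x = G (b n) - G (a n).
  rewrite (@RE_density _ _ _ mu (expo R) (exponential_pdf 1))//; last 2 first.
    by move=> x; exact: exponential_pdf_ge0.
    exact: measurable_exponential_pdf.
  rewrite /Rintegral.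
  have -> : (\int[mu]_x (f_ n x * exponential_pdf 1 x)%:E)%E =
            (\int[mu]_(x in `[a n, b n]) (f x * expR (- x))%:E)%E.
    rewrite [RHS]integral_mkcond; apply: eq_integral => x _.
    rewrite patchE /f_ indicE; case: ifPn => [|_]; last by rewrite mulr0 mul0r.
    rewrite inE/= in_itv/= => /andP[ax _].
    rewrite mulr1 exponential_pdfE; last exact: (le_trans (ltW (a0 n))).
    by rewrite mul1r mulN1r.
  rewrite (@continuous_FTC2 _ (fun x => f x * expR (- x)) G)//.
  - apply: continuous_in_subspaceT => x /[!inE]/= /[!in_itv]/= /andP[ax _].
    have x0 : 0 < x by exact: lt_le_trans ax.
    apply: cvgM; first exact: cf.
    apply: continuous_comp; last exact: continuous_expR.
    exact: opp_continuous.
  - have dG' x : 0 < x -> derivable G x 1 by move=> /dG [].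
    have cG x : 0 < x -> {for x, continuous G}.
      by move=> /dG' /derivable1_diffP/differentiable_continuous.
    split.
    + move=> x /[!in_itv]/= /andP[ax _]; apply: dG'; exact: lt_trans ax.
    + by apply: cvg_at_right_filter; exact: cG.
    + by apply: cvg_at_left_filter; apply: cG; exact: lt_trans (ab n).
  - move=> x /[!in_itv]/= /andP[ax _]; rewrite derive1E.
    have x0 : 0 < x by exact: lt_trans ax.
    by have [_ ->] := dG _ x0.
have cv2 : (\int[expo R]_x f_ n x) @[n --> \oo] --> 0 - G 0.
  under eq_fun do rewrite e.
  apply: cvgB.
    exact: (cvg_comp _ _ cvb Goo).
  by move/cvg_at_rightP : G0; apply.
rewrite -sub0r; exact: (cvg_unique _ cv1 cv2).
Unshelve. all: end_near. Qed.

End exponential_law.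

Lemma cvg0M_bounded {R : realType} {T : Type} (F : set_system T) {FF : Filter F}
    (f g : T -> R) (C : R) : f @ F --> (0 : R) -> (forall x, `|g x| <= C) ->
  (f x * g x) @[x --> F] --> (0 : R).
Proof.
move=> f0 gC; apply/cvgr0Pnorm_lt => e e0.
have C0 : 0 < `|C| + 1 by rewrite ltr_wpDl.
near=> x.
have fx : `|f x| < e / (`|C| + 1).
  by near: x; apply: (cvgr0_norm_lt _ f0); exact: divr_gt0.
rewrite normrM (@le_lt_trans _ _ (`|f x| * (`|C| + 1)))//; last first.
  by rewrite -ltr_pdivlMr.
rewrite ler_wpM2l// (le_trans (gC x))// (le_trans (ler_norm _))// lerDl//.
Unshelve. all: end_near. Qed.

Lemma RE_Fubini d1 d2 (T1 : measurableType d1) (T2 : measurableType d2)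
    (R : realType) (P1 : probability T1 R) (P2 : probability T2 R)
    (f : T1 * T2 -> R) : bmf f ->
  \int[P1]_x \int[P2]_y f (x, y) = \int[P2]_y \int[P1]_x f (x, y).
Proof.
move=> bf.
pose P12 : probability (T1 * T2)%type R := (P1 \x P2)%E.
have intf := bmf_integrable P12 bf.
have b1 x : bmf (fun y => f (x, y)).
  by apply: (bmf_comp _ bf); exact: pair1_measurable.
have b2 y : bmf (fun x => f (x, y)).
  by apply: (bmf_comp _ bf); exact: pair2_measurable.
have := Fubini intf; rewrite /fubini_F /fubini_G /=.
under eq_integral do rewrite RE_EFin//.
under [RHS]eq_integral do rewrite RE_EFin//.
by move=> /(congr1 fine).
Qed.

Lemma bmf_RE d1 d2 (T1 : measurableType d1) (T2 : measurableType d2)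
    (R : realType) (P2 : probability T2 R) (f : T1 * T2 -> R) : bmf f ->
  bmf (fun x => \int[P2]_y f (x, y)).
Proof.
move=> bf; have [mf [C fC]] := bf; split.
  apply: (@measurableT_comp _ _ _ _ _ _ (@fine R)) => //.
  (* Tonelli's measurability statement concerns nonnegative integrands, hence the shift by [C],
     subtracted again below. *)
  have mp : measurable_fun setT (fun z => (f z + C)%:E).
    by apply/measurable_EFinP; apply: measurable_funD.
  have := @measurable_fun_fubini_tonelli_F _ _ T1 T2 R P2 _ mp.
  have b1 x : bmf (fun y => f (x, y)).
    by apply: (bmf_comp _ bf); exact: pair1_measurable.
  rewrite (_ : fubini_F _ _ = (fun x => \int[P2]_y (f (x, y))%:E + C%:E)%E); last first.
    apply/funext => x; rewrite /fubini_F/= RE_EFin; last first.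
      by apply: bmfD => //; exact: bmf_cst.
    by rewrite RED//; [rewrite RE_cst RE_EFin|exact: bmf_cst].
  move=> H.
  have -> : (fun x => \int[P2]_y (f (x, y))%:E)%E =
            (fun x => (\int[P2]_y (f (x, y))%:E + C%:E) - C%:E)%E.
    by apply/funext => x; rewrite addeK.
  apply: emeasurable_funB => //; apply: H => z.
  by rewrite lee_fin -lerBlDr sub0r lerNl (le_trans _ (fC z))// -normrN ler_norm.
exists C => x; apply: RE_norm_le => //.
by apply: (bmf_comp _ bf); exact: pair1_measurable.
Qed.

Section weighted_laws.
Context {R : realType} d (Om : measurableType d) (P : probability Om R).
Variables (w1 w2 : Om -> R).
Hypotheses (bw1 : bmf w1) (bw2 : bmf w2).

(** The weights may change sign, so uniqueness of measures does not apply directly. The sets on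
    which the two sides agree form a Dynkin system: complements use equality of the total weights,
    disjoint unions use dominated convergence. *)
Lemma weighted_law_ext d' (T : measurableType d') (G : set (set T))
    (X1 X2 : Om -> T) :
  measurable_fun setT X1 -> measurable_fun setT X2 ->
  @measurable _ T = <<s G >> -> setI_closed G ->
  \int[P]_w w1 w = \int[P]_w w2 w ->
  (forall B, G B -> \int[P]_w (w1 w * \1_B (X1 w)) = \int[P]_w (w2 w * \1_B (X2 w))) ->
  forall B, measurable B ->
    \int[P]_w (w1 w * \1_B (X1 w)) = \int[P]_w (w2 w * \1_B (X2 w)).
Proof.
move=> mX1 mX2 mG GI w12 h B mB.
have bX (wt : Om -> R) (X : Om -> T) (C : set T) : bmf wt -> measurable_fun setT X -> measurable C ->
    bmf (fun w => wt w * (\1_C (X w) : R)).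
  move=> bwt mX mC; apply: bmfM => //.
  exact: (bmf_comp mX (bmf_indic R mC)).
apply: (@dynkin_induction _ T G (fun B =>
  \int[P]_w (w1 w * \1_B (X1 w)) = \int[P]_w (w2 w * \1_B (X2 w)))) => //.
- by under eq_Rintegral do rewrite indicT mulr1;
    under [RHS]eq_Rintegral do rewrite indicT mulr1.
- move=> C mC hC.
  have H (wt : Om -> R) X : bmf wt -> measurable_fun setT X ->
    \int[P]_w (wt w * \1_(~` C) (X w)) = \int[P]_w wt w - \int[P]_w (wt w * \1_C (X w)).
    move=> bwt mX; rewrite -REB//; last exact: bX.
    apply: eq_Rintegral => w _; rewrite !indicE in_setC.
    by case: (X w \in C); rewrite /= ?mulr0 ?mulr1 ?subrr ?subr0.
  by rewrite !H// hC w12.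
- move=> F mF tF hF.
  pose V n := \big[setU/set0]_(i < n) F i.
  have mV n : measurable (V n) by apply: bigsetU_measurable => i _; exact: mF.
  have hV n : \int[P]_w (w1 w * \1_(V n) (X1 w)) = \int[P]_w (w2 w * \1_(V n) (X2 w)).
    elim: n => [|n ih].
      by rewrite /V big_ord0; under eq_Rintegral do rewrite indic0 mulr0;
        under [RHS]eq_Rintegral do rewrite indic0 mulr0.
    have H (wt : Om -> R) X : bmf wt -> measurable_fun setT X ->
      \int[P]_w (wt w * \1_(V n.+1) (X w)) =
      \int[P]_w (wt w * \1_(V n) (X w)) + \int[P]_w (wt w * \1_(F n) (X w)).
      move=> bwt mX; rewrite -RED; [|exact: bX|exact: bX].
      apply: eq_Rintegral => w _; rewrite -mulrDr; congr (_ * _).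
      rewrite /V big_ord_recr/= !indicE in_setU.
      have [xV|] := boolP (X w \in _) => /=; last by rewrite add0r.
      rewrite memNset ?addr0// => xF.
      move: xV; rewrite inE -bigcup_mkord => -[i /= ni Fi].
      move/trivIsetP : tF => /(_ i n I I); rewrite neq_ltn ni => /(_ isT).
      by move/seteqP => -[/(_ (X w))] /(_ (conj Fi xF)).
    by rewrite !H// ih hF.
  have mU : measurable (\bigcup_k F k) by exact: bigcupT_measurable.
  have H (wt : Om -> R) X : bmf wt -> measurable_fun setT X ->
    (\int[P]_w (wt w * \1_(V n) (X w))) @[n --> \oo] -->
    \int[P]_w (wt w * \1_(\bigcup_k F k) (X w)).
    move=> bwt mX; have [_ [C wC]] := bwt.
    apply: (@RE_dominated_cvg _ _ _ _ _ _ C).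
    + by move=> n; case: (bX wt X _ bwt mX (mV n)).
    + by case: (bX wt X _ bwt mX mU).
    + move=> n w; rewrite normrM (le_trans _ (wC w))// ler_piMr//.
      by rewrite indicE; case: (_ \in _); rewrite ?normr1 ?normr0.
    + apply: aeW => w; apply: cvgM; first exact: cvg_cst.
      have [[k _ Fk]|nF] := pselect ((\bigcup_k F k) (X w)).
        apply: cvg_near_cst; exists k.+1 => // n /= kn.
        rewrite !indicE !mem_set//; first by exists k.
        by rewrite /V -bigcup_mkord; exists k.
      apply: cvg_near_cst; apply: nearW => n; rewrite !indicE !memNset//.
      by rewrite /V -bigcup_mkord => -[k _ Fk]; apply: nF; exists k.
  have c1 := H _ _ bw1 mX1; have c2 := H _ _ bw2 mX2.
  have E : (fun n => \int[P]_w (w1 w * \1_(V n) (X1 w))) =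
           (fun n => \int[P]_w (w2 w * \1_(V n) (X2 w))) by apply/funext.
  by move: c1; rewrite E => c1; exact: (cvg_unique _ c1 c2).
- by rewrite -mG.
Qed.

End weighted_laws.

(** * Fourier uniqueness for weighted laws through the Cauchy kernel *)

Section cauchy_kernel.
Context {R : realType}.
Local Notation mu := (@lebesgue_measure R).
Local Notation mR := (measurableTypeR R).

(** The real part of [1 / (1 - i y)], the characteristic function of the exponential law. It
    displays the Cauchy kernel as a mixture of cosines, through which equality of Fourier data
    passes to other test functions. *)
Lemma expo_cos (y : R) : \int[expo R]_x cos (y * x) = (1 + y ^+ 2)^-1.
Proof.
have y0 : 1 + y ^+ 2 != 0 by rewrite gt_eqF// ltr_pwDl// sqr_ge0.
pose G x := expR (- x) * (y * sin (y * x) - cos (y * x)) * (1 + y ^+ 2)^-1.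
have dG (x : R) : is_derive x 1 G (cos (y * x) * expR (- x)).
  apply: is_derive_eq; rewrite /GRing.scale/=; field.
  exact: y0.
rewrite (@expo_FTC _ _ G).
- by rewrite /G oppr0 expR0 mulr0 sin0 cos0 mulr0 sub0r mul1r mulN1r opprK.
- by apply: bmf_cos; exact: measurable_funM.
- move=> x _; apply: continuous_comp; last exact: continuous_cos.
  by apply: cvgM; [exact: cvg_cst|exact: cvg_id].
- apply: cvg_at_right_filter.
  have [dG0 _] := dG 0.
  by have /derivable1_diffP/differentiable_continuous := dG0.
- have b x : `|y * sin (y * x) - cos (y * x)| <= `|y| + 1.
    rewrite (le_trans (ler_normB _ _))// lerD//; last by rewrite ler_norml cos_geN1 cos_le1.
    by rewrite normrM ler_piMr// ler_norml sin_geN1 sin_le1.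
  rewrite -[X in _ --> X](mul0r ((1 + y ^+ 2)^-1)).
  apply: cvgM; last exact: cvg_cst.
  by apply: (cvg0M_bounded _ b); exact: cvgr_expR.
Qed.

(** Averaging the kernel over its centre gives a difference of arctangents, for large [c] a smoothed
    indicator of an interval. *)
Lemma uniform_prob_cauchy (s t c x : R) (st : s < t) : 0 < c ->
  \int[uniform_prob st]_a (1 + (c * (x - a)) ^+ 2)^-1 =
  (c * (t - s))^-1 * (atan (c * (t - x)) - atan (c * (s - x))).
Proof.
move=> c0.
have pos a : 0 < 1 + (c * (x - a)) ^+ 2 by rewrite ltr_pwDl// sqr_ge0.
have cK : continuous (fun a : R => (1 + (c * (x - a)) ^+ 2)^-1).
  move=> a; apply: cvgV; first by rewrite gt_eqF.
  apply: cvgD; first exact: cvg_cst.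
  apply: (@continuous_comp _ _ _ (fun a : R => c * (x - a)) (fun u : R => u ^+ 2)).
    apply: cvgM; first exact: cvg_cst.
    by apply: cvgB; [exact: cvg_cst|exact: cvg_id].
  exact: exprn_continuous.
rewrite /Rintegral integral_uniform; last 2 first.
  by apply/measurable_EFinP; exact: continuous_measurable_fun.
  by move=> a; rewrite lee_fin invr_ge0 ltW.
rewrite (@continuous_FTC2 _ _ (fun a => c^-1 * atan (c * (a - x))))//.
- rewrite -EFinB -EFinM/= -mulrBr; field.
  by rewrite subr_eq0 !gt_eqF.
- exact: continuous_subspaceT.
- have cA : continuous (fun a : R => c^-1 * atan (c * (a - x))).
    move=> a; apply: cvgM; first exact: cvg_cst.
    apply: continuous_comp; last exact: continuous_atan.
    apply: cvgM; first exact: cvg_cst.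
    by apply: cvgB; [exact: cvg_id|exact: cvg_cst].
  split.
  + by move=> a _; exact: ex_derive.
  + by apply: cvg_at_right_filter; exact: cA.
  + by apply: cvg_at_left_filter; exact: cA.
- move=> a _; rewrite derive1E.
  have /@derive_val -> : is_derive a 1 (fun a => c^-1 * atan (c * (a - x)))
      (1 + (c * (x - a)) ^+ 2)^-1; last by [].
  apply: is_derive_eq; rewrite /GRing.scale/=.
  have -> : c * (a - x) = - (c * (x - a)) by ring.
  rewrite sqrrN; have := lt0r_neq0 (pos a) => pa; field.
  by rewrite pa gt_eqF.
Qed.

End cauchy_kernel.

Section fourier_uniqueness.
Context {R : realType} d (Om : measurableType d) (P : probability Om R).
Local Notation mR := (measurableTypeR R).

(** [X1 z] is the whole phase at frequency [z], not only a multiple of a fixed variable, because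
    affine phases [h + z X] occur below. *)
Definition same_fourier (w1 w2 : Om -> R) (X1 X2 : R -> Om -> R) :=
  forall z : R, \int[P]_w (w1 w * cos (X1 z w)) = \int[P]_w (w2 w * cos (X2 z w)) /\
                \int[P]_w (w1 w * sin (X1 z w)) = \int[P]_w (w2 w * sin (X2 z w)).

Section one_dim.
Variables (w1 w2 : Om -> R) (X1 X2 : Om -> R).
Hypotheses (bw1 : bmf w1) (bw2 : bmf w2).
Hypotheses (mX1 : measurable_fun setT X1) (mX2 : measurable_fun setT X2).
Hypothesis hF : same_fourier w1 w2 (fun z w => z * X1 w) (fun z w => z * X2 w).

(** With the exponential variable fixed, the weight enters the right side only through its Fourier
    data at frequency [c * x]; the centre [a] is split off by the addition formula. *)
Let cauchy_side (wt : Om -> R) (X : Om -> R) (a c : R) : bmf wt -> measurable_fun setT X ->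
  \int[P]_w (wt w * (1 + (c * (X w - a)) ^+ 2)^-1) =
  \int[expo R]_x (cos (c * x * a) * \int[P]_w (wt w * cos (c * x * X w)) +
                  sin (c * x * a) * \int[P]_w (wt w * sin (c * x * X w))).
Proof.
move=> bwt mX.
have bf : bmf (fun z : Om * mR => wt z.1 * cos (c * (X z.1 - a) * z.2)).
  apply: bmfM; first exact: (bmf_comp (@measurable_fst _ _ Om mR)).
  apply: bmf_cos; apply: measurable_funM => //.
  apply: measurable_funM => //; apply: measurable_funB => //.
  exact: (measurableT_comp mX).
transitivity (\int[P]_w \int[expo R]_x (wt w * cos (c * (X w - a) * x))).
  apply: eq_Rintegral => w _; rewrite REZ ?expo_cos//.
  by apply: bmf_cos; exact: measurable_funM.
rewrite (RE_Fubini _ _ bf)/=; apply: eq_Rintegral => x _.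
have bc : bmf (fun w => wt w * cos (c * x * X w)).
  by apply: bmfM => //; apply: bmf_cos; exact: measurable_funM.
have bs : bmf (fun w => wt w * sin (c * x * X w)).
  by apply: bmfM => //; apply: bmf_sin; exact: measurable_funM.
rewrite -!REZ// -RED; [|apply: bmfM => //; exact: bmf_cst|apply: bmfM => //; exact: bmf_cst].
apply: eq_Rintegral => w _.
have -> : c * (X w - a) * x = c * x * X w - c * x * a by ring.
by rewrite cosB; ring.
Qed.

Let cauchy_eq (a c : R) :
  \int[P]_w (w1 w * (1 + (c * (X1 w - a)) ^+ 2)^-1) =
  \int[P]_w (w2 w * (1 + (c * (X2 w - a)) ^+ 2)^-1).
Proof.
rewrite !cauchy_side//; apply: eq_Rintegral => x _.
by have [-> ->] := hF (c * x).
Qed.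

Let pos (x : R) : 0 < 1 + x ^+ 2.
Proof. by rewrite ltr_pwDl// sqr_ge0. Qed.

Let atan_side (wt : Om -> R) (X : Om -> R) (s t c : R) (st : s < t) : 0 < c ->
  bmf wt -> measurable_fun setT X ->
  \int[P]_w (wt w * (atan (c * (t - X w)) - atan (c * (s - X w)))) =
  c * (t - s) * \int[uniform_prob st]_a \int[P]_w (wt w * (1 + (c * (X w - a)) ^+ 2)^-1).
Proof.
move=> c0 bwt mX.
have mV (T' : measurableType _) (h : T' -> R) : measurable_fun setT h ->
    bmf (fun z => (1 + (h z) ^+ 2)^-1).
  move=> mh; split; last first.
    exists 1 => z; rewrite ger0_norm ?invr_ge0 ?(ltW (pos _))//.
    by rewrite invf_le1// lerDl sqr_ge0.
  apply: (@measurableT_comp _ _ _ _ _ _ (fun u : R => (1 + u ^+ 2)^-1)) => //.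
  apply: continuous_measurable_fun => u; apply: cvgV; first by rewrite gt_eqF.
  by apply: cvgD; [exact: cvg_cst|exact: exprn_continuous].
have bf : bmf (fun z : Om * mR => wt z.1 * (1 + (c * (X z.1 - z.2)) ^+ 2)^-1).
  apply: bmfM; first exact: (bmf_comp (@measurable_fst _ _ Om mR)).
  apply: mV; apply: measurable_funM => //; apply: measurable_funB => //.
  exact: (measurableT_comp mX).
have := RE_Fubini P (uniform_prob st) bf; rewrite /= => <-.
have bA r : bmf (fun w => atan (c * (r - X w))).
  split; last first.
    exists (pi / 2) => w; rewrite ler_norml.
    by rewrite (ltW (atan_gtNpi2 _)) (ltW (atan_ltpi2 _)).
  apply: (@measurableT_comp _ _ _ _ _ _ (@atan R)).
    by apply: continuous_measurable_fun => u; exact: continuous_atan.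
  by apply: measurable_funM => //; exact: measurable_funB.
rewrite -REZ//; last first.
  exact: (bmf_RE (uniform_prob st) bf).
apply: eq_Rintegral => w _.
rewrite REZ; last by apply: mV; apply: measurable_funM => //; exact: measurable_funB.
rewrite uniform_prob_cauchy//; field.
by rewrite subr_eq0 !gt_eqF.
Qed.

(** The shift [1 / (n + 1)] against the scale [(n + 1)^2] decides the endpoint: at [x = t] the
    argument equals [n + 1] and still tends to infinity. Differences of such limits give the
    half-open []s, t]] exactly, with no half weights at the ends. *)
Let atan_step (t x : R) :
  atan (n.+1%:R ^+ 2 * (t + n.+1%:R^-1 - x)) @[n --> \oo] -->
  (if x <= t then pi / 2 else - (pi / 2)).
Proof.
have E n : n.+1%:R ^+ 2 * (t + n.+1%:R^-1 - x) =
    n.+1%:R * (n.+1%:R * (t - x) + 1) :> R.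
  by field.
under eq_fun do rewrite E.
have yS : (n.+1%:R : R) @[n --> \oo] --> +oo.
  by rewrite (cvg_shiftS (fun n => n%:R : R)); exact: cvgr_idn.
case: leP => xt.
  have h : (n.+1%:R * (n.+1%:R * (t - x) + 1) : R) @[n --> \oo] --> +oo.
    apply: ger_cvgy yS; apply: nearW => n.
    by rewrite -[leLHS]mulr1 ler_wpM2l// lerDr mulr_ge0// subr_ge0.
  exact: (cvg_comp _ _ h (@cvgy_atan R)).
have -> : (fun n => atan (n.+1%:R * (n.+1%:R * (t - x) + 1))) =
    (fun n => - atan (n.+1%:R * (n.+1%:R * (x - t) - 1)) : R).
  by apply/funext => n; rewrite -atanN; congr atan; ring.
apply: cvgN.
suff h : (n.+1%:R * (n.+1%:R * (x - t) - 1) : R) @[n --> \oo] --> +oo.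
  exact: (cvg_comp _ _ h (@cvgy_atan R)).
apply: ger_cvgy yS; near=> n.
rewrite -[leLHS]mulr1 ler_wpM2l// lerBrDr.
rewrite -ler_pdivrMr ?subr_gt0//.
apply: (@le_trans _ _ n%:R); last by rewrite ler_nat.
by near: n; exact: nbhs_infty_ger.
Unshelve. all: end_near. Qed.

(** The arctangent differences are bounded by [pi] and converge to [pi] times the indicator of []s,
    t]]; these intervals form a generating pi-system. *)
Lemma fourier_unique1 (B : set R) : measurable B ->
  \int[P]_w (w1 w * \1_B (X1 w)) = \int[P]_w (w2 w * \1_B (X2 w)).
Proof.
move=> mB.
apply: (@weighted_law_ext _ _ _ P w1 w2 bw1 bw2 _ mR _ X1 X2 mX1 mX2 erefl) => //.
- move=> A A' GA GA'; exact: (@measurableI _ (ocitv_type R)).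
- have [+ _] := hF 0.
  by under eq_Rintegral do rewrite mul0r cos0 mulr1;
    under [RHS]eq_Rintegral do rewrite mul0r cos0 mulr1.
move=> _ [[s t] _ <-] /=.
have [st|ts] := ltP s t; last first.
  rewrite set_itv_ge ?bnd_simp -?leNgt//.
  by under eq_Rintegral do rewrite indic0 mulr0;
    under [RHS]eq_Rintegral do rewrite indic0 mulr0.
pose K n x : R := atan (n.+1%:R ^+ 2 * (t + n.+1%:R^-1 - x)) -
                  atan (n.+1%:R ^+ 2 * (s + n.+1%:R^-1 - x)).
have KE n : \int[P]_w (w1 w * K n (X1 w)) = \int[P]_w (w2 w * K n (X2 w)).
  have st' : s + n.+1%:R^-1 < t + n.+1%:R^-1 by rewrite ltrD2r.
  have c0 : 0 < n.+1%:R ^+ 2 :> R by rewrite exprn_gt0.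
  rewrite /K !(atan_side st' c0)//; congr (_ * _).
  by apply: eq_Rintegral => a _; exact: cauchy_eq.
have Kcv x : K n x @[n --> \oo] --> pi * \1_(`]s, t]%classic : set R) x.
  have -> : pi * \1_(`]s, t]%classic : set R) x =
      (if x <= t then pi / 2 else - (pi / 2)) -
      (if x <= s then pi / 2 else - (pi / 2)) :> R.
    rewrite indicE; have [xt|xt] := leP x t.
      have [xs|xs] := leP x s.
        by rewrite memNset ?mulr0 ?subrr//= in_itv/= ltNge xs.
      by rewrite mem_set ?mulr1 ?opprK -?splitr//= in_itv/= xs.
    rewrite leNgt (lt_trans st xt)/= memNset ?mulr0 ?subrr//= in_itv/= => /andP[_].
    by rewrite leNgt xt.
  by apply: cvgB; exact: atan_step.
have mK n : measurable_fun setT (K n).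
  apply: continuous_measurable_fun => x; apply: cvgB;
    (apply: continuous_comp; last exact: continuous_atan);
    by apply: cvgM; [exact: cvg_cst|apply: cvgB; [exact: cvg_cst|exact: cvg_id]].
have Kb n x : `|K n x| <= pi.
  rewrite /K (le_trans (ler_normB _ _))// [leRHS]splitr.
  by apply: lerD; rewrite ler_norml (ltW (atan_gtNpi2 _)) (ltW (atan_ltpi2 _)).
have lim (wt X : Om -> R) : bmf wt -> measurable_fun setT X ->
    (\int[P]_w (wt w * K n (X w))) @[n --> \oo] -->
    pi * \int[P]_w (wt w * \1_(`]s, t]%classic : set R) (X w)).
  move=> bwt mX; have [mwt [C wC]] := bwt.
  have bI : bmf (fun w => wt w * (\1_(`]s, t]%classic : set R) (X w) : R)).
    apply: bmfM => //.
    exact: (bmf_comp mX (bmf_indic R (measurable_itv `]s, t]))).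
  rewrite -REZ//.
  apply: (@RE_dominated_cvg _ _ _ _ _ _ (C * pi)).
  + by move=> n; apply: measurable_funM => //; exact: measurableT_comp.
  + by case: bI => mI _; exact: measurable_funM.
  + by move=> n w; rewrite normrM ler_pM.
  + apply: aeW => w; rewrite mulrCA; apply: cvgM; first exact: cvg_cst.
    exact: Kcv.
have c1 := lim _ _ bw1 mX1; have c2 := lim _ _ bw2 mX2.
have E : (fun n => \int[P]_w (w1 w * K n (X1 w))) =
         (fun n => \int[P]_w (w2 w * K n (X2 w))) by apply/funext.
move: c1; rewrite E => c1; apply: (mulfI (lt0r_neq0 (pi_gt0 R))).
exact: (cvg_unique _ c1 c2).
Qed.

End one_dim.

(** Product-to-sum formulas at [z] and [- z] turn data for the phase [h + z X] into Fourier data of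
    [X] alone under the weights [w cos h] and [w sin h]. One variable is exchanged for an indicator
    while the phase [h] survives. *)
Lemma fourier_step (w1 w2 h1 h2 X1 X2 : Om -> R) :
  bmf w1 -> bmf w2 -> measurable_fun setT h1 -> measurable_fun setT h2 ->
  measurable_fun setT X1 -> measurable_fun setT X2 ->
  same_fourier w1 w2 (fun z w => h1 w + z * X1 w) (fun z w => h2 w + z * X2 w) ->
  forall B : set R, measurable B ->
  \int[P]_w (w1 w * \1_B (X1 w) * cos (h1 w)) = \int[P]_w (w2 w * \1_B (X2 w) * cos (h2 w)) /\
  \int[P]_w (w1 w * \1_B (X1 w) * sin (h1 w)) = \int[P]_w (w2 w * \1_B (X2 w) * sin (h2 w)).
Proof.
move=> b1 b2 mh1 mh2 mX1 mX2 hF B mB.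
have mph (h X : Om -> R) z : measurable_fun setT h -> measurable_fun setT X ->
    measurable_fun setT (fun w => h w + z * X w).
  by move=> mh mX; apply: measurable_funD => //; exact: measurable_funM.
have bc (wt h X : Om -> R) z : bmf wt -> measurable_fun setT h -> measurable_fun setT X ->
    bmf (fun w => wt w * cos (h w + z * X w)).
  by move=> bw mh mX; apply: bmfM => //; apply: bmf_cos; exact: mph.
have bs (wt h X : Om -> R) z : bmf wt -> measurable_fun setT h -> measurable_fun setT X ->
    bmf (fun w => wt w * sin (h w + z * X w)).
  by move=> bw mh mX; apply: bmfM => //; apply: bmf_sin; exact: mph.
have half (f g : Om -> R) : bmf f -> bmf g ->
    \int[P]_w (2^-1 * (f w + g w)) = 2^-1 * (\int[P]_w f w + \int[P]_w g w).
  by move=> bf bg; rewrite REZ ?RED//; exact: bmfD.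
have halfB (f g : Om -> R) : bmf f -> bmf g ->
    \int[P]_w (2^-1 * (f w - g w)) = 2^-1 * (\int[P]_w f w - \int[P]_w g w).
  by move=> bf bg; rewrite REZ ?REB//; exact: bmfB.
have cc (wt h X : Om -> R) z : bmf wt -> measurable_fun setT h -> measurable_fun setT X ->
  \int[P]_w (wt w * cos (h w) * cos (z * X w)) =
  2^-1 * (\int[P]_w (wt w * cos (h w + z * X w)) + \int[P]_w (wt w * cos (h w + - z * X w))).
  move=> bw mh mX; rewrite -half; [|exact: bc|exact: bc].
  by apply: eq_Rintegral => w _; rewrite mulNr cosD cosB; field.
have cs (wt h X : Om -> R) z : bmf wt -> measurable_fun setT h -> measurable_fun setT X ->
  \int[P]_w (wt w * cos (h w) * sin (z * X w)) =
  2^-1 * (\int[P]_w (wt w * sin (h w + z * X w)) - \int[P]_w (wt w * sin (h w + - z * X w))).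
  move=> bw mh mX; rewrite -halfB; [|exact: bs|exact: bs].
  by apply: eq_Rintegral => w _; rewrite mulNr sinD sinB; field.
have sc (wt h X : Om -> R) z : bmf wt -> measurable_fun setT h -> measurable_fun setT X ->
  \int[P]_w (wt w * sin (h w) * cos (z * X w)) =
  2^-1 * (\int[P]_w (wt w * sin (h w + z * X w)) + \int[P]_w (wt w * sin (h w + - z * X w))).
  move=> bw mh mX; rewrite -half; [|exact: bs|exact: bs].
  by apply: eq_Rintegral => w _; rewrite mulNr sinD sinB; field.
have ss (wt h X : Om -> R) z : bmf wt -> measurable_fun setT h -> measurable_fun setT X ->
  \int[P]_w (wt w * sin (h w) * sin (z * X w)) =
  2^-1 * (\int[P]_w (wt w * cos (h w + - z * X w)) - \int[P]_w (wt w * cos (h w + z * X w))).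
  move=> bw mh mX; rewrite -halfB; [|exact: bc|exact: bc].
  by apply: eq_Rintegral => w _; rewrite mulNr cosB cosD; field.
split; under eq_Rintegral do rewrite mulrAC;
  under [RHS]eq_Rintegral do rewrite mulrAC;
  (apply: fourier_unique1 => //; [by apply: bmfM => //; (exact: bmf_cos || exact: bmf_sin)
    |by apply: bmfM => //; (exact: bmf_cos || exact: bmf_sin)|]).
- by move=> z; have [c1 s1] := hF z; have [c2 s2] := hF (- z);
    rewrite !cc// !cs// c1 c2 s1 s2.
- by move=> z; have [c1 s1] := hF z; have [c2 s2] := hF (- z);
    rewrite !sc// !ss// c1 c2 s1 s2.
Qed.

End fourier_uniqueness.

Section fourier_uniqueness_tuple.
Context {R : realType} d (Om : measurableType d) (P : probability Om R) (n : nat).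
Variables (w1 w2 h1 h2 : Om -> R) (X1 X2 : Om -> n.-tuple R).
Hypotheses (bw1 : bmf w1) (bw2 : bmf w2).
Hypotheses (mh1 : measurable_fun setT h1) (mh2 : measurable_fun setT h2).
Hypotheses (mX1 : measurable_fun setT X1) (mX2 : measurable_fun setT X2).
Hypothesis hF : forall z : n.-tuple R,
  \int[P]_w (w1 w * cos (h1 w + vdot z (X1 w))) = \int[P]_w (w2 w * cos (h2 w + vdot z (X2 w))) /\
  \int[P]_w (w1 w * sin (h1 w + vdot z (X1 w))) = \int[P]_w (w2 w * sin (h2 w + vdot z (X2 w))).

Let mcoord (X : Om -> n.-tuple R) i : measurable_fun setT X ->
  measurable_fun setT (fun w => tnth (X w) i).
Proof. by move=> mX; exact: (measurableT_comp (measurable_tnth i) mX). Qed.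

(** Interpolation between Fourier data and laws: coordinates below [k] carry indicators in [wt], the
    others still carry exponentials in [ph]. *)
Let wt k (B : 'I_n -> set R) (w0 : Om -> R) (X : Om -> n.-tuple R) w :=
  w0 w * \prod_(i < n | (i < k)%N) \1_(B i) (tnth (X w) i).
Let ph k (z : 'I_n -> R) (h : Om -> R) (X : Om -> n.-tuple R) w :=
  h w + \sum_(i < n | (k <= i)%N) z i * tnth (X w) i.

Let bwt k B (w0 : Om -> R) X : (forall i, measurable (B i)) -> bmf w0 ->
  measurable_fun setT X -> bmf (wt k B w0 X).
Proof.
move=> mB b0 mX; apply: bmfM => //.
rewrite (_ : (fun w => _) = (fun w => \prod_(i <- index_enum 'I_n)
  if (i < k)%N then \1_(B i) (tnth (X w) i) else 1)); last first.
  by apply/funext => w; exact: big_mkcond.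
apply: bmf_prod => i; case: (i < k)%N; last exact: bmf_cst.
exact: (bmf_comp (mcoord i mX) (bmf_indic R (mB i))).
Qed.

Let mph k z (h : Om -> R) X : measurable_fun setT h -> measurable_fun setT X ->
  measurable_fun setT (ph k z h X).
Proof.
move=> mh mX; apply: measurable_funD => //.
rewrite (_ : (fun w => _) = (fun w => \sum_(i <- index_enum 'I_n)
  if (k <= i)%N then z i * tnth (X w) i else 0)); last first.
  by apply/funext => w; exact: big_mkcond.
apply: measurable_sum => i; case: (k <= i)%N => //.
by apply: measurable_funM => //; exact: mcoord.
Qed.

Let phS k (kn : (k < n)%N) z h X w :
  ph k z h X w = ph k.+1 z h X w + z (Ordinal kn) * tnth (X w) (Ordinal kn).
Proof.
rewrite /ph (bigD1 (Ordinal kn))//= [X in _ + X]addrC addrA; congr (_ + _ + _).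
by apply: eq_bigl => i; rewrite ltn_neqAle andbC eq_sym.
Qed.

Let wtS k (kn : (k < n)%N) B w0 X w :
  wt k.+1 B w0 X w = wt k B w0 X w * \1_(B (Ordinal kn)) (tnth (X w) (Ordinal kn)).
Proof.
rewrite /wt (bigD1 (Ordinal kn))//= [X in _ * X]mulrC mulrA; congr (_ * _ * _).
by apply: eq_bigl => i; rewrite ltnS [RHS]ltn_neqAle andbC.
Qed.

Let boxes k : (k <= n)%N -> forall B z, (forall i, measurable (B i)) ->
  \int[P]_w (wt k B w1 X1 w * cos (ph k z h1 X1 w)) =
  \int[P]_w (wt k B w2 X2 w * cos (ph k z h2 X2 w)) /\
  \int[P]_w (wt k B w1 X1 w * sin (ph k z h1 X1 w)) =
  \int[P]_w (wt k B w2 X2 w * sin (ph k z h2 X2 w)).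
Proof.
elim: k => [_ B z mB|k ih kn B z mB].
  have := hF [tuple z i | i < n].
  have wE w0 X : wt 0 B w0 X = w0 by apply/funext => w; rewrite /wt big_pred0 ?mulr1.
  have pE h X : ph 0 z h X = fun w => h w + vdot [tuple z i | i < n] (X w).
    by apply/funext => w; congr (_ + _); apply: eq_bigr => i _; rewrite tnth_mktuple.
  by rewrite !wE !pE.
pose i0 := Ordinal kn.
have eW w0 X : wt k.+1 B w0 X = fun w => wt k B w0 X w * \1_(B i0) (tnth (X w) i0).
  by apply/funext => w; exact: wtS.
rewrite !eW.
apply: (@fourier_step _ _ _ P (wt k B w1 X1) (wt k B w2 X2)
  (ph k.+1 z h1 X1) (ph k.+1 z h2 X2) (fun w => tnth (X1 w) i0)
  (fun w => tnth (X2 w) i0) (bwt k mB bw1 mX1) (bwt k mB bw2 mX2)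
  (mph _ _ mh1 mX1) (mph _ _ mh2 mX2) (mcoord _ mX1) (mcoord _ mX2) _
  (B i0) (mB i0)) => y.
have E h X : (fun w => ph k.+1 z h X w + y * tnth (X w) i0) =
               ph k (fun i => if i == i0 then y else z i) h X.
  apply/funext => w; rewrite (phS kn) eqxx; congr (_ + _ + _); apply: eq_bigr => i ki.
  by rewrite ifN// -val_eqE/= gtn_eqF.
have [c s] := ih (ltnW kn) B (fun i => if i == i0 then y else z i) mB.
by move: c s; rewrite -!E.
Qed.

(** Boxes come from the interpolation at [k = n], general sets from boxes. The phase [h] is kept in
    the conclusion because the independence argument extracts one vector while later ones remain in
    the phase. *)
Lemma fourier_unique (A : set (n.-tuple R)) : measurable A ->
  \int[P]_w (w1 w * \1_A (X1 w) * cos (h1 w)) = \int[P]_w (w2 w * \1_A (X2 w) * cos (h2 w)) /\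
  \int[P]_w (w1 w * \1_A (X1 w) * sin (h1 w)) = \int[P]_w (w2 w * \1_A (X2 w) * sin (h2 w)).
Proof.
move=> mA.
pose G : set (set (n.-tuple R)) := [set C | exists2 B : 'I_n -> set R,
  (forall i, measurable (B i)) & C = [set x | forall i, B i (tnth x i)]].
have GI : setI_closed G.
  move=> _ _ [B mB ->] [B' mB' ->]; exists (fun i => B i `&` B' i).
    by move=> i; exact: measurableI.
  by apply/seteqP; split => [x [h h'] i|x h]; [split|split=> i; have [] := h i].
have GE C B : C = [set x | forall i, B i (tnth x i)] ->
    C = \bigcap_i [set x : n.-tuple R | B i (tnth x i)].
  move=> ->; apply/seteqP; split=> [x h i _|x h i]; first exact: h.
  exact: (h i).
have mG : @measurable _ (n.-tuple R) = <<s G >>.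
  apply/seteqP; split.
    apply: smallest_sub; first exact: smallest_sigma_algebra.
    move=> C bC.
    have [k [B mB <-]] : exists k : 'I_n,
        preimage_set_system setT (fun x : n.-tuple R => tnth x k) measurable C.
      move: bC; apply: (big_ind (fun S : set (set (n.-tuple R)) => S C -> _)) => //.
        by move=> S S' hS hS' [/hS|/hS'].
      by move=> k _ h; exists k.
    apply: sub_gen_smallest.
    exists (fun i => if i == k then B else setT).
      by move=> i; case: ifP.
    rewrite setTI; apply/seteqP; split => x /=.
      by move=> Bx i; case: ifPn => // /eqP ->.
    by move=> /(_ k); rewrite /= eqxx.
  apply: smallest_sub; first exact: sigma_algebra_measurable.
  move=> C [B mB /GE ->]; apply: fin_bigcap_measurable => // i _.
  rewrite -[X in measurable X]setTI; apply: measurable_tnth => //.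
have key (tr : R -> R) : (tr = cos \/ tr = sin) ->
  \int[P]_w (w1 w * tr (h1 w) * \1_A (X1 w)) = \int[P]_w (w2 w * tr (h2 w) * \1_A (X2 w)).
  move=> trE.
  have btr h : measurable_fun setT h -> bmf (fun w : Om => tr (h w)).
    by move=> mh; case: trE => ->; [exact: bmf_cos|exact: bmf_sin].
  have box B : (forall i, measurable (B i)) ->
    let C := [set x | forall i, B i (tnth x i)] in
    \int[P]_w (w1 w * tr (h1 w) * \1_C (X1 w)) = \int[P]_w (w2 w * tr (h2 w) * \1_C (X2 w)).
    move=> mB C.
    have [c s] := boxes (leqnn n) (fun=> 0) mB.
    have E w0 h X w : wt n B w0 X w * tr (ph n (fun=> 0) h X w) =
        w0 w * tr (h w) * \1_C (X w).
      rewrite /wt /ph [X in tr (_ + X)]big_pred0; last by move=> i; rewrite leqNgt ltn_ord.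
      rewrite addr0 mulrAC; congr (_ * _).
      rewrite [RHS]indicE; have [xC|xC] := boolP (X w \in C).
        by rewrite big1// => i _; rewrite indicE mem_set//; move: xC; rewrite inE; exact.
      have /existsNP[i Bi] : ~ (forall i, B i (tnth (X w) i)).
        by move=> h'; move: xC; rewrite notin_setE; apply.
      by rewrite (bigD1 i)//= indicE memNset// mul0r.
    under eq_Rintegral do rewrite -E; under [RHS]eq_Rintegral do rewrite -E.
    by case: trE => ->.
  apply: (weighted_law_ext _ _ mX1 mX2 mG GI _ _ mA).
  - by apply: bmfM => //; exact: btr.
  - by apply: bmfM => //; exact: btr.
  - have := box (fun=> setT) (fun=> measurableT).
    rewrite /= (_ : [set x | forall i, setT (tnth x i)] = setT); last by apply/seteqP; split.
    by under eq_Rintegral do rewrite indicT mulr1;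
      under [X in _ = X -> _]eq_Rintegral do rewrite indicT mulr1.
  - by move=> _ [B mB ->]; exact: box.
by split; under eq_Rintegral do rewrite mulrAC;
  under [RHS]eq_Rintegral do rewrite mulrAC; apply: key; [left|right].
Qed.

End fourier_uniqueness_tuple.

(** * Tail integrals and the renewal equation *)

Section tail_integral.
Context {R : realType}.
Local Notation mu := (@lebesgue_measure R).
Local Notation mR := (measurableTypeR R).
Variable f : mR -> R.
Hypothesis intf : mu.-integrable setT (EFin \o f).

(** An indicator on the whole line, instead of a moving domain, makes continuity in [s] and the
    limit at infinity instances of dominated convergence. *)
Definition tail_int (s : R) : R := \int[mu]_x (f x * \1_(`]s, +oo[%classic : set mR) x).

Let mfm : measurable_fun setT f.
Proof. by have /measurable_int/measurable_EFinP := intf. Qed.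

Let int_tail (D : set mR) : measurable D ->
  mu.-integrable setT (fun x => (f x * \1_D x)%:E).
Proof.
move=> mD; apply: (le_integrable measurableT _ _ intf).
  by apply/measurable_EFinP; apply: measurable_funM => //; exact: measurable_indic.
move=> x _ /=; rewrite lee_fin normrM ler_piMr// indicE.
by case: (x \in D); rewrite ?normr1 ?normr0.
Qed.

Lemma tail_int_bound s : `|tail_int s| <= \int[mu]_x `|f x|.
Proof.
apply: (le_trans (le_normr_Rintegral _ _)) => //; first exact: int_tail.
apply: le_Rintegral => //.
- by apply: (integrable_abse (int_tail _)).
- by have := integrable_abse intf.
- move=> x _; rewrite normrM ler_piMr// indicE.
  by case: (x \in _); rewrite ?normr1 ?normr0.
Qed.

Let tail_dct (u : nat -> R) (D : set mR) : measurable D ->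
  {ae mu, forall x, \1_(`]u n, +oo[%classic : set mR) x @[n --> \oo] --> (\1_D x : R)} ->
  tail_int (u n) @[n --> \oo] --> \int[mu]_x (f x * \1_D x).
Proof.
move=> mD cv.
have [] := @dominated_convergence _ _ _ mu setT measurableT
  (fun n x => (f x * \1_(`]u n, +oo[%classic : set mR) x)%:E)
  (fun x => (f x * \1_D x)%:E) (fun x => `|(f x)%:E|%E).
- move=> n; apply/measurable_EFinP; apply: measurable_funM => //.
- apply/measurable_EFinP; apply: measurable_funM => //; exact: measurable_indic.
- case: cv => A [mA A0 sub]; exists A; split=> // x /= h; apply: sub => /= e.
  apply: h => _; apply/cvg_EFin; first exact: nearW.
  by apply: cvgM => //; exact: cvg_cst.
- exact: integrable_abse.
- apply: aeW => x n _ /=; rewrite lee_fin normrM ler_piMr// indicE.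
  by case: (x \in _); rewrite ?normr1 ?normr0.
- move=> if_ _ cv'; apply: fine_cvg; rewrite fineK//.
  exact: (integrable_fin_num measurableT).
Qed.

Lemma tail_int_continuous : continuous tail_int.
Proof.
move=> s; apply/(@cvg_nbhsP _ R^o) => u us; apply: tail_dct => //.
(* The indicators of []u n, +oo[] may fail to converge at [s] itself, a null set. *)
exists [set s]; split => //; first exact: lebesgue_measure_set1.
move=> x /= h; apply: contrapT => /eqP xs; apply: h.
have [sx|xs'] := ltP s x.
  apply: cvg_near_cst; near=> n; rewrite !indicE !mem_set//=.
    by rewrite in_itv/= andbT.
  rewrite in_itv/= andbT; near: n; exact: (cvgr_lt s us).
have xs2 : x < s by rewrite lt_neqAle xs.
apply: cvg_near_cst; near=> n; rewrite !indicE !memNset//=.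
  by rewrite in_itv/= andbT; apply/negP; rewrite -leNgt.
rewrite in_itv/= andbT; apply/negP; rewrite -leNgt; near: n; exact: (cvgr_ge s us).
Unshelve. all: end_near. Qed.

Lemma tail_int_cvg0 : tail_int s @[s --> +oo] --> (0 : R).
Proof.
apply/cvg_pinftyP => u uoo.
have -> : 0 = \int[mu]_x (f x * \1_(set0 : set mR) x).
  by under eq_Rintegral do rewrite indic0 mulr0; rewrite Rintegral_cst// mul0r.
apply: tail_dct => //; apply: aeW => x.
apply: cvg_near_cst; near=> n; rewrite !indicE !memNset//=.
rewrite in_itv/= andbT; apply/negP; rewrite -leNgt; near: n.
by apply: (cvgry_ge uoo).
Unshelve. all: end_near. Qed.

Lemma is_derive_tail_int (s : R) : {for s, continuous f} ->
  is_derive s 1 tail_int (- f s).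
Proof.
move=> cf.
have su : s < s + 1 by rewrite ltrDl.
have iu : mu.-integrable [set` Interval -oo%O (BRight (s + 1))] (EFin \o f).
  by apply: (integrableS measurableT) => //; exact: measurable_itv.
have [dF F'] := continuous_FTC1 su iu (ltNyr _) cf.
pose F x := \int[mu]_(t in [set` Interval -oo%O (BRight x)]) f t.
have E : tail_int = fun s => \int[mu]_x f x - F s.
  apply/funext => x; rewrite /tail_int /F [X in _ - X]Rintegral_mkcond -RintegralB//.
    apply: eq_Rintegral => y _; rewrite patchE indicE.
    have [yx|xy] := leP y x.
      by rewrite memNset ?mem_set ?mulr0 ?subrr//= in_itv/= ?yx// andbT ltNge yx.
    by rewrite mem_set ?memNset ?mulr1 ?subr0//= in_itv/= ?xy// leNgt xy.
  have := int_tail (measurable_itv `]-oo, x]); apply: eq_integrable => // y _ /=.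
  by rewrite patchE indicE; case: ifPn => _; rewrite ?mulr1 ?mulr0.
rewrite E.
have dF' : is_derive s 1 F (f s) by split=> //; rewrite -derive1E.
by apply: is_derive_eq; rewrite add0r mul1r.
Qed.

End tail_integral.

Section renewal.
Context {R : realType}.
Local Notation mu := (@lebesgue_measure R).
Local Notation mR := (measurableTypeR R).
Variables g1 g2 : R -> R.
Hypotheses (bg1 : bmf (g1 : mR -> R)) (bg2 : bmf (g2 : mR -> R)).
Hypothesis cg1 : forall x : R, 0 < x -> {for x, continuous g1}.
Hypothesis cg2 : forall x : R, 0 < x -> {for x, continuous g2}.

(** With [renewal_im], the real and imaginary parts of [g - 1] on the half line, extended by 0
    because [tail_int] integrates over all of [R]. *)
Definition renewal_re (x : mR) : R := (g1 x - 1) * \1_(Rpos : set mR) x.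
Definition renewal_im (x : mR) : R := g2 x * \1_(Rpos : set mR) x.

Hypothesis int1 : mu.-integrable setT (EFin \o renewal_re).
Hypothesis int2 : mu.-integrable setT (EFin \o renewal_im).

Local Notation a := (tail_int renewal_re).
Local Notation c := (tail_int renewal_im).
(** With [renewal_sin], the real and imaginary parts of the function [F] of the overview, of modulus
    [expR (a s)] and argument [c s]. *)
Definition renewal_cos (s : R) := expR (a s) * cos (c s).
Definition renewal_sin (s : R) := expR (a s) * sin (c s).
Local Notation F1 := renewal_cos.
Local Notation F2 := renewal_sin.

Let at_pos (h : R -> R) (x : R) : 0 < x -> {for x, continuous h} ->
  {for x, continuous (fun y => h y * \1_(Rpos : set mR) y)}.
Proof.
move=> x0 ch; rewrite /prop_for /continuous_at.
have -> : h x * \1_(Rpos : set mR) x = h x.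
  by rewrite indicE mem_set ?mulr1//= /Rpos/= in_itv/= x0.
apply: cvg_trans ch; apply: near_eq_cvg; near=> y.
rewrite indicE mem_set ?mulr1//= /Rpos/= in_itv/= andbT.
near: y; exact: lt_nbhsr.
Unshelve. all: end_near. Qed.

Let da (s : R) : 0 < s -> is_derive s 1 a (- (g1 s - 1)).
Proof.
move=> s0.
have E : renewal_re s = g1 s - 1.
  by rewrite /renewal_re indicE mem_set ?mulr1//= /Rpos/= in_itv/= s0.
rewrite -E; apply: is_derive_tail_int => //; apply: at_pos => //.
by apply: cvgB; [exact: cg1|exact: cvg_cst].
Qed.

Let dc (s : R) : 0 < s -> is_derive s 1 c (- g2 s).
Proof.
move=> s0.
have E : renewal_im s = g2 s.
  by rewrite /renewal_im indicE mem_set ?mulr1//= /Rpos/= in_itv/= s0.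
by rewrite -E; apply: is_derive_tail_int => //; apply: at_pos => //; exact: cg2.
Qed.

Let cF1 : continuous F1.
Proof.
move=> s; apply: cvgM.
  by apply: continuous_comp; [exact: tail_int_continuous|exact: continuous_expR].
by apply: continuous_comp; [exact: tail_int_continuous|exact: continuous_cos].
Qed.

Let cF2 : continuous F2.
Proof.
move=> s; apply: cvgM.
  by apply: continuous_comp; [exact: tail_int_continuous|exact: continuous_expR].
by apply: continuous_comp; [exact: tail_int_continuous|exact: continuous_sin].
Qed.

Lemma bmf_renewal_cos : bmf (F1 : mR -> R).
Proof.
split; first exact: continuous_measurable_fun.
exists (expR (\int[mu]_x `|renewal_re x|)) => s; rewrite normrM ger0_norm ?expR_ge0//.
rewrite -[leRHS]mulr1 ler_pM ?expR_ge0//; last by rewrite ler_norml cos_geN1 cos_le1.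
by rewrite ler_expR (le_trans (ler_norm _))//; exact: tail_int_bound.
Qed.

Lemma bmf_renewal_sin : bmf (F2 : mR -> R).
Proof.
split; first exact: continuous_measurable_fun.
exists (expR (\int[mu]_x `|renewal_re x|)) => s; rewrite normrM ger0_norm ?expR_ge0//.
rewrite -[leRHS]mulr1 ler_pM ?expR_ge0//; last by rewrite ler_norml sin_geN1 sin_le1.
by rewrite ler_expR (le_trans (ler_norm _))//; exact: tail_int_bound.
Qed.

Lemma renewal_cos_cvg1 : F1 s @[s --> +oo] --> (1 : R).
Proof.
have -> : 1 = expR 0 * cos 0 :> R by rewrite expR0 cos0 mulr1.
apply: cvgM.
  by apply: (cvg_comp _ _ (tail_int_cvg0 int1)); exact: continuous_expR.
by apply: (cvg_comp _ _ (tail_int_cvg0 int2)); exact: continuous_cos.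
Qed.

Lemma renewal_sin_cvg0 : F2 s @[s --> +oo] --> (0 : R).
Proof.
have -> : 0 = expR 0 * sin 0 :> R by rewrite sin0 mulr0.
apply: cvgM.
  by apply: (cvg_comp _ _ (tail_int_cvg0 int1)); exact: continuous_expR.
by apply: (cvg_comp _ _ (tail_int_cvg0 int2)); exact: continuous_sin.
Qed.

Let shift_cvg (F : R -> R) (s : R) : continuous F ->
  (- expR (- x) * F (s + x)) @[x --> 0^'+] --> - expR (- 0) * F (s + 0).
Proof.
move=> cF; apply: cvg_at_right_filter; apply: cvgM.
  apply: cvgN; apply: continuous_comp; last exact: continuous_expR.
  exact: opp_continuous.
apply: continuous_comp; last exact: cF.
by apply: cvgD; [exact: cvg_cst|exact: cvg_id].
Qed.

Let shift_cvg0 (F : R -> R) (s : R) : bmf (F : mR -> R) ->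
  (- expR (- x) * F (s + x)) @[x --> +oo] --> (0 : R).
Proof.
move=> [_ [C FC]]; apply: (@cvg0M_bounded _ _ _ _ (fun x => - expR (- x)) (fun x => F (s + x)) C) => //.
by rewrite -oppr0; apply: cvgN; exact: cvgr_expR.
Qed.

Let bshift (h : R -> R) (s : R) : bmf (h : mR -> R) -> bmf ((fun x => h (s + x)) : mR -> R).
Proof.
by move=> bh; apply: (@bmf_comp _ _ mR mR R (fun x => s + x)) => //; exact: measurable_funD.
Qed.

Let cshift (h : R -> R) (s x : R) : {for (s + x), continuous h} ->
  {for x, continuous (fun y => h (s + y))}.
Proof.
move=> ch; apply: continuous_comp => //.
by apply: cvgD; [exact: cvg_cst|exact: cvg_id].
Qed.

(* (F1, F2) is the solution of F' = (1 - g) F with F(+oo) = 1, which is the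
   differential form of the renewal equation. *)
Lemma renewal_eq (s : R) : 0 <= s ->
  \int[expo R]_x (g1 (s + x) * F1 (s + x) - g2 (s + x) * F2 (s + x)) = F1 s /\
  \int[expo R]_x (g1 (s + x) * F2 (s + x) + g2 (s + x) * F1 (s + x)) = F2 s.
Proof.
move=> s0.
have ds (x : R) : is_derive x 1 (fun y => s + y) 1.
  by apply: is_derive_eq; rewrite add0r mulr1.
have da' (x : R) : 0 < x -> is_derive x 1 (fun y => a (s + y)) (- (g1 (s + x) - 1)).
  move=> x0; have d1 : is_derive (s + x) 1 a (- (g1 (s + x) - 1)).
    by apply: da; rewrite ltr_wpDl.
  by have := @is_derive1_comp R a (fun y => s + y) x _ _ d1 (ds x); rewrite mulr1.
have dc' (x : R) : 0 < x -> is_derive x 1 (fun y => c (s + y)) (- g2 (s + x)).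
  move=> x0; have d1 : is_derive (s + x) 1 c (- g2 (s + x)).
    by apply: dc; rewrite ltr_wpDl.
  by have := @is_derive1_comp R c (fun y => s + y) x _ _ d1 (ds x); rewrite mulr1.
have px (x : R) : 0 < x -> 0 < s + x by move=> x0; rewrite ltr_wpDl.
split.
- transitivity (- (- expR (- 0) * F1 (s + 0))); last first.
    by rewrite oppr0 expR0 addr0 mulN1r opprK.
  (* Real part of the fact that [- exp (- x) F (s + x)] is a primitive of
     [exp (- x) g (s + x) F (s + x)], by [F' = (1 - g) F]. *)
  apply: (@expo_FTC _ _ (fun x => - expR (- x) * F1 (s + x))).
  + by apply: bmfB; apply: bmfM; apply: bshift => //; [exact: bmf_renewal_cos|exact: bmf_renewal_sin].
  + move=> x x0; apply: cvgB; (apply: cvgM; apply: cshift);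
      [exact: (cg1 (px x x0))|exact: cF1|exact: (cg2 (px x x0))|exact: cF2].
  + move=> x x0; have := da' x x0; have := dc' x x0 => H1 H2.
    rewrite /renewal_cos; apply: is_derive_eq; rewrite /GRing.scale/= /renewal_sin; ring.
  + exact: shift_cvg.
  + by apply: shift_cvg0; exact: bmf_renewal_cos.
- transitivity (- (- expR (- 0) * F2 (s + 0))); last first.
    by rewrite oppr0 expR0 addr0 mulN1r opprK.
  apply: (@expo_FTC _ _ (fun x => - expR (- x) * F2 (s + x))).
  + by apply: bmfD; apply: bmfM; apply: bshift => //; [exact: bmf_renewal_sin|exact: bmf_renewal_cos].
  + move=> x x0; apply: cvgD; (apply: cvgM; apply: cshift);
      [exact: (cg1 (px x x0))|exact: cF2|exact: (cg2 (px x x0))|exact: cF1].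
  + move=> x x0; have := da' x x0; have := dc' x x0 => H1 H2.
    rewrite /renewal_sin; apply: is_derive_eq; rewrite /GRing.scale/= /renewal_cos; ring.
  + exact: shift_cvg.
  + by apply: shift_cvg0; exact: bmf_renewal_sin.
Qed.

End renewal.

(** * Characteristic function of a sum over a marked renewal process *)

Section marked_renewal_process.
Context {R : realType} d (Om : measurableType d) (P : probability Om R).
Context d' (S : measurableType d') (kappa : probability S R).
Local Notation mu := (@lebesgue_measure R).
Local Notation mR := (measurableTypeR R).
Variables (E' : nat -> Om -> R) (M : nat -> Om -> S).
Variables (GM GE : nat -> set (set Om)).
Local Notation OmM n := (g_sigma_algebraType (GM n)).
Local Notation OmE n := (g_sigma_algebraType (GE n)).
Hypotheses (sGM : forall n, GM n `<=` measurable) (sGE : forall n, GE n `<=` measurable).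
Hypotheses (mE' : forall n, measurable_fun setT (E' n)) (mM : forall n, measurable_fun setT (M n)).
Hypothesis mEM : forall n j, (j <= n)%N -> measurable_fun setT (E' j : OmM n -> R).
Hypothesis mMM : forall n j, (j < n)%N -> measurable_fun setT (M j : OmM n -> S).
Hypothesis mEE : forall n j, (j < n)%N -> measurable_fun setT (E' j : OmE n -> R).
Hypothesis mME : forall n j, (j < n)%N -> measurable_fun setT (M j : OmE n -> S).
Hypothesis indM : forall n A B, <<s GM n >> A -> measurable B ->
  P (A `&` M n @^-1` B) = (P A * kappa B)%E.
Hypothesis indE : forall n A (B : set R), <<s GE n >> A -> measurable B ->
  P (A `&` E' n @^-1` B) = (P A * expo R B)%E.

Variable theta : R -> S -> R.
Hypothesis mtheta : measurable_fun setT (fun z : mR * S => theta z.1 z.2).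

(** Indices start at 0, so the mark [M j] sits at [arrival j.+1]. Passing from [n] to [n.+1] reveals
    first the gap [E' n], then the mark [M n]; accordingly [GE n] stands for the information before
    that gap, and [GM n] for the information after it but before the mark. *)
Definition arrival n w := \sum_(i < n) E' i w.
Definition mark_sum n w := \sum_(j < n) theta (arrival j.+1 w) (M j w).
Definition mark_cos (x : R) := \int[kappa]_m cos (theta x m).
Definition mark_sin (x : R) := \int[kappa]_m sin (theta x m).
Local Notation g1 := mark_cos.
Local Notation g2 := mark_sin.

Lemma bmf_mark_cos : bmf (g1 : mR -> R).
Proof. exact: (bmf_RE kappa (bmf_cos mtheta)). Qed.

Lemma bmf_mark_sin : bmf (g2 : mR -> R).
Proof. exact: (bmf_RE kappa (bmf_sin mtheta)). Qed.

Let marrival_coarse (G : set (set Om)) n :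
  (forall j, (j < n)%N -> measurable_fun setT (E' j : g_sigma_algebraType G -> R)) ->
  measurable_fun setT (arrival n : g_sigma_algebraType G -> mR).
Proof.
move=> h; rewrite /arrival.
exact: (@measurable_sum _ (g_sigma_algebraType G) R setT _ (index_enum 'I_n)
  (fun i => E' i) (fun i => h i (ltn_ord i))).
Qed.

Let mmark_sum_coarse (G : set (set Om)) n :
  (forall j, (j < n)%N -> measurable_fun setT (E' j : g_sigma_algebraType G -> R)) ->
  (forall j, (j < n)%N -> measurable_fun setT (M j : g_sigma_algebraType G -> S)) ->
  measurable_fun setT (mark_sum n : g_sigma_algebraType G -> R).
Proof.
move=> hE hM; rewrite /mark_sum.
apply: (@measurable_sum _ (g_sigma_algebraType G) R setT _ (index_enum 'I_n)
  (fun (i : 'I_n) w => theta (arrival i.+1 w) (M i w))) => i.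
have mp : measurable_fun setT
    ((fun w => (arrival i.+1 w, M i w)) : g_sigma_algebraType G -> (mR * S)%type).
  apply: measurable_fun_pair; last exact: hM.
  by apply: marrival_coarse => j ji; apply: hE; exact: leq_trans ji _.
exact: (measurableT_comp mtheta mp).
Qed.

Let marrival n : measurable_fun setT (arrival n : Om -> mR).
Proof. by apply: (@measurable_sum _ Om R setT _ (index_enum 'I_n) (fun i => E' i)). Qed.

Let mmark_sum n : measurable_fun setT (mark_sum n).
Proof.
apply: (@measurable_sum _ Om R setT _ (index_enum 'I_n)
  (fun (i : 'I_n) w => theta (arrival i.+1 w) (M i w))) => i.
have mp : measurable_fun setT
    ((fun w => (arrival i.+1 w, M i w)) : Om -> (mR * S)%type).
  by apply: measurable_fun_pair.
exact: (measurableT_comp mtheta mp).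
Qed.

Hypothesis arrival_ge0 : {ae P, forall w, forall n, 0 <= arrival n w}.

Let mart (A B : R -> R) n w :=
  cos (mark_sum n w) * A (arrival n w) - sin (mark_sum n w) * B (arrival n w).

Let bmart A B n : bmf (A : mR -> R) -> bmf (B : mR -> R) -> bmf (mart A B n).
Proof.
move=> bA bB; apply: bmfB; apply: bmfM.
- exact: bmf_cos.
- exact: (bmf_comp (marrival n) bA).
- exact: bmf_sin.
- exact: (bmf_comp (marrival n) bB).
Qed.

(* The real part of the martingale property of
   [exp (i mark_sum n) (A + i B) (arrival n)]. *)
Let martingale (A B : R -> R) : bmf (A : mR -> R) -> bmf (B : mR -> R) ->
  (forall s, 0 <= s ->
    \int[expo R]_x (g1 (s + x) * A (s + x) - g2 (s + x) * B (s + x)) = A s /\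
    \int[expo R]_x (g2 (s + x) * A (s + x) + g1 (s + x) * B (s + x)) = B s) ->
  forall n, \int[P]_w mart A B n w = A 0.
Proof.
move=> bA bB inv; elim=> [|n ih].
  have E w : mart A B 0 w = A 0.
    by rewrite /mart /mark_sum /arrival !big_ord0 cos0 sin0 mul1r mul0r subr0.
  by under eq_Rintegral do rewrite E; rewrite RE_cst.
have bc x : bmf (fun m => cos (theta x m)).
  by apply: bmf_cos; exact: (measurable_fun_pair2 _ mtheta).
have bs x : bmf (fun m => sin (theta x m)).
  by apply: bmf_sin; exact: (measurable_fun_pair2 _ mtheta).
(* [C + i D] is the product of [g] and [A + i B]. *)
pose C x := g1 x * A x - g2 x * B x.
pose D x := g2 x * A x + g1 x * B x.
have bC : bmf (C : mR -> R).
  by apply: bmfB; apply: bmfM => //; [exact: bmf_mark_cos|exact: bmf_mark_sin].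
have bD : bmf (D : mR -> R).
  by apply: bmfD; apply: bmfM => //; [exact: bmf_mark_sin|exact: bmf_mark_cos].
(* First half step: with the gap [E' n] known, averaging the mark [M n] multiplies by [g]. *)
transitivity (\int[P]_w (cos (mark_sum n w) * C (arrival n.+1 w) -
                         sin (mark_sum n w) * D (arrival n.+1 w))).
  pose f (z : OmM n * S) := 
    cos (mark_sum n z.1 + theta (arrival n.+1 z.1) z.2) * A (arrival n.+1 z.1) -
    sin (mark_sum n z.1 + theta (arrival n.+1 z.1) z.2) * B (arrival n.+1 z.1).
  have ma : measurable_fun setT (arrival n.+1 : OmM n -> mR).
    by apply: marrival_coarse => j jn; exact: (@mEM n j jn).
  have ms : measurable_fun setT (mark_sum n : OmM n -> R).
    by apply: mmark_sum_coarse => j jn; [exact: (@mEM n j (ltnW jn))|exact: (mMM jn)].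
  have ma' : measurable_fun setT (fun z : OmM n * S => arrival n.+1 z.1 : mR).
    exact: (measurableT_comp ma).
  have mph : measurable_fun setT
      (fun z : OmM n * S => mark_sum n z.1 + theta (arrival n.+1 z.1) z.2).
    apply: measurable_funD; first exact: (measurableT_comp ms).
    have mp : measurable_fun setT
        ((fun z : OmM n * S => (arrival n.+1 z.1, z.2)) : _ -> (mR * S)%type).
      by apply: measurable_fun_pair.
    exact: (measurableT_comp mtheta mp).
  have bf : bmf f.
    apply: bmfB; apply: bmfM.
    - exact: bmf_cos.
    - exact: (bmf_comp ma' bA).
    - exact: bmf_sin.
    - exact: (bmf_comp ma' bB).
  have := freezing (@sGM n) (@mM n) (@indM n) bf.
  rewrite /f/=.
  have -> : (fun w => cos (mark_sum n w + theta (arrival n.+1 w) (M n w)) * A (arrival n.+1 w) -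
      sin (mark_sum n w + theta (arrival n.+1 w) (M n w)) * B (arrival n.+1 w)) = mart A B n.+1.
    by apply/funext => w; rewrite /mart {3 4}/mark_sum big_ord_recr.
  move=> ->; apply: eq_Rintegral => w _.
  set s := mark_sum n w; set t := arrival n.+1 w.
  have b1 : bmf (fun m => (cos s * A t - sin s * B t) * cos (theta t m)).
    by apply: bmfM => //; exact: bmf_cst.
  have b2 : bmf (fun m => (sin s * A t + cos s * B t) * sin (theta t m)).
    by apply: bmfM => //; exact: bmf_cst.
  transitivity (\int[kappa]_m ((cos s * A t - sin s * B t) * cos (theta t m) -
                (sin s * A t + cos s * B t) * sin (theta t m))).
    by apply: eq_Rintegral => m _; rewrite cosD sinD; ring.
  by rewrite REB// !REZ// -/(g1 t) -/(g2 t) /C /D; ring.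
pose f (z : OmE n * mR) := 
  cos (mark_sum n z.1) * C (arrival n z.1 + z.2) -
  sin (mark_sum n z.1) * D (arrival n z.1 + z.2).
have ma : measurable_fun setT (arrival n : OmE n -> mR).
  by apply: marrival_coarse => j jn; exact: (mEE jn).
have ms : measurable_fun setT (mark_sum n : OmE n -> R).
  by apply: mmark_sum_coarse => j jn; [exact: (mEE jn)|exact: (mME jn)].
have ma' : measurable_fun setT (fun z : OmE n * mR => arrival n z.1 + z.2 : mR).
  by apply: measurable_funD => //; exact: (measurableT_comp ma).
have ms' : measurable_fun setT (fun z : OmE n * mR => mark_sum n z.1).
  exact: (measurableT_comp ms).
have bf : bmf f.
  apply: bmfB; apply: bmfM.
  - exact: bmf_cos.
  - exact: (bmf_comp ma' bC).
  - exact: bmf_sin.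
  - exact: (bmf_comp ma' bD).
(* Second half step: averaging the gap leads back to [A + i B] at [arrival n], by the invariance
   [inv]. *)
transitivity (\int[P]_w \int[expo R]_x (cos (mark_sum n w) * C (arrival n w + x) -
                         sin (mark_sum n w) * D (arrival n w + x))).
  have := @freezing _ _ Om P _ (@sGE n) _ mR (expo R) (E' n) (@mE' n) (@indE n) f bf.
  rewrite /f/= => <-; apply: eq_Rintegral => w _.
  by rewrite /arrival big_ord_recr.
rewrite -ih; apply: RE_ae_eq.
- exact: (bmf_coarse (@sGE n) (bmf_RE (expo R) bf)).
- exact: bmart.
(* The invariance concerns nonnegative starting points, so it applies at [arrival n] only almost
   surely. *)
case: arrival_ge0 => N [mN N0 sub]; exists N; split => // w /= h; apply: sub => /= ge0.
apply: h.
have bsh (h : R -> R) : bmf (h : mR -> R) -> bmf ((fun x => h (arrival n w + x)) : mR -> R).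
  by move=> bh; apply: (@bmf_comp _ _ mR mR R (fun x => arrival n w + x)) => //; exact: measurable_funD.
have [i1 i2] := inv _ (ge0 n).
rewrite REB; [|by apply: bmfM; [exact: bmf_cst|exact: bsh]|by apply: bmfM; [exact: bmf_cst|exact: bsh]].
by rewrite !REZ; [rewrite i1 i2|exact: bsh|exact: bsh].
Qed.

Hypothesis ctheta : forall (x : R) m, 0 < x -> {for x, continuous (theta ^~ m)}.

Let continuous_mark (tr : R -> R) (x : R) : continuous tr ->
  (forall x, `|tr x| <= 1) -> 0 < x ->
  {for x, continuous (fun y => \int[kappa]_m tr (theta y m))}.
Proof.
move=> ctr tr1 x0.
have bt y : bmf (fun m => tr (theta y m)).
  split; last by exists 1.
  apply: (@measurableT_comp _ _ _ _ _ _ tr).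
    exact: continuous_measurable_fun.
  exact: (measurable_fun_pair2 _ mtheta).
apply: (@continuity_under_integral _ _ S kappa _ setT measurableT 0 (x + 1) _ _ (fun=> 1)).
- by move=> y _; exact: bmf_integrable.
- apply: aeW => m _ y; rewrite inE/= in_itv/= => /andP[y0 _].
  by apply: continuous_comp; [exact: ctheta|exact: ctr].
- exact: (bmf_integrable kappa (bmf_cst _ (1 : R))).
- by move=> y _; apply: aeW => m _; exact: tr1.
- by rewrite inE/= in_itv/= x0 ltrDl ltr01.
Qed.

Let cvg_cst_eq (x y : R) : (fun=> x) @ \oo --> y -> y = x.
Proof. by move=> h; exact: (cvg_unique _ h (@cvg_cst _ x _ \oo _)). Qed.

Hypothesis int1 : mu.-integrable setT (EFin \o renewal_re g1).
Hypothesis int2 : mu.-integrable setT (EFin \o renewal_im g2).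
Hypothesis arrival_oo : {ae P, forall w, arrival n w @[n --> \oo] --> +oo}.

(** The mean of the martingale is constant, and along [n] its second factor tends to 1 because the
    arrivals tend to infinity. *)
Lemma marked_renewal_chf (Z : Om -> R) : measurable_fun setT Z ->
  {ae P, forall w, mark_sum n w @[n --> \oo] --> Z w} ->
  \int[P]_w cos (Z w) = renewal_cos g1 g2 0 /\
  \int[P]_w sin (Z w) = renewal_sin g1 g2 0.
Proof.
move=> mZ cvZ.
have cg1 (x : R) : 0 < x -> {for x, continuous g1}.
  move=> x0; apply: continuous_mark => //; first exact: continuous_cos.
  by move=> y; rewrite ler_norml cos_geN1 cos_le1.
have cg2 (x : R) : 0 < x -> {for x, continuous g2}.
  move=> x0; apply: continuous_mark => //; first exact: continuous_sin.
  by move=> y; rewrite ler_norml sin_geN1 sin_le1.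
have bF1 := bmf_renewal_cos int1 int2; have bF2 := bmf_renewal_sin int1 int2.
have ren := renewal_eq bmf_mark_cos bmf_mark_sin cg1 cg2 int1 int2.
have lim (A B : R -> R) (l1 l2 : R) : bmf (A : mR -> R) -> bmf (B : mR -> R) ->
    A s @[s --> +oo] --> l1 -> B s @[s --> +oo] --> l2 ->
    (\int[P]_w mart A B n w) @[n --> \oo] -->
    \int[P]_w (cos (Z w) * l1 - sin (Z w) * l2).
  move=> bA bB cA cB.
  have [_ [CA hA]] := bA; have [_ [CB hB]] := bB.
  apply: (@RE_dominated_cvg _ _ _ _ _ _ (CA + CB)).
  - by move=> n; case: (bmart n bA bB).
  - by apply: bmf_measurable; apply: bmfB; apply: bmfM; try exact: bmf_cst;
      [exact: bmf_cos|exact: bmf_sin].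
  - move=> n w; rewrite (le_trans (ler_normB _ _))// lerD// normrM.
      rewrite -[leRHS]mul1r ler_pM//; first by rewrite ler_norml cos_geN1 cos_le1.
    rewrite -[leRHS]mul1r ler_pM//; first by rewrite ler_norml sin_geN1 sin_le1.
  - have : {ae P, forall w, (mark_sum n w @[n --> \oo] --> Z w) /\
        (arrival n w @[n --> \oo] --> +oo)} by apply: filterS2 cvZ arrival_oo.
    apply: filterS => w [cz ca].
    apply: cvgB; apply: cvgM.
    + by apply: (cvg_comp _ _ cz); exact: continuous_cos.
    + exact: (cvg_comp _ _ ca cA).
    + by apply: (cvg_comp _ _ cz); exact: continuous_sin.
    + exact: (cvg_comp _ _ ca cB).
have c1 := renewal_cos_cvg1 int1 int2; have c2 := renewal_sin_cvg0 int1 int2.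
split.
- have m1 n : \int[P]_w mart (renewal_cos g1 g2) (renewal_sin g1 g2) n w = renewal_cos g1 g2 0.
    apply: martingale => // s s0; have [e1 e2] := ren s s0; split; first exact: e1.
    by rewrite -e2; apply: eq_Rintegral => x _; rewrite addrC.
  have := lim _ _ _ _ bF1 bF2 c1 c2; under eq_fun do rewrite m1.
  move=> /cvg_cst_eq <-.
  by apply: eq_Rintegral => w _; rewrite mulr1 mulr0 subr0.
(* The pair [(F2, - F1)] is [- i F]: the real part of its martingale is the imaginary part of the
   one built from [F]. *)
- have bNF1 : bmf ((fun s => - renewal_cos g1 g2 s) : mR -> R) by exact: bmfN.
  have m2 n : \int[P]_w mart (renewal_sin g1 g2) (fun s => - renewal_cos g1 g2 s) n w =
      renewal_sin g1 g2 0.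
    apply: martingale => // s s0; have [e1 e2] := ren s s0; split.
      by rewrite -e2; apply: eq_Rintegral => x _; rewrite mulrN opprK.
    rewrite -e1 -[RHS]mulN1r -REZ; last first.
      apply: (@bmf_comp _ _ mR mR R (fun x => s + x)
        (fun x => g1 x * renewal_cos g1 g2 x - g2 x * renewal_sin g1 g2 x)).
        exact: measurable_funD.
      by apply: bmfB; apply: bmfM => //; [exact: bmf_mark_cos|exact: bmf_mark_sin].
    by apply: eq_Rintegral => x _; ring.
  have cN : - renewal_cos g1 g2 s @[s --> +oo] --> - (1 : R) by apply: cvgN.
  have := lim _ _ _ _ bF2 bNF1 c2 cN; under eq_fun do rewrite m2.
  move=> /cvg_cst_eq <-.
  by apply: eq_Rintegral => w _; rewrite mulr0 mulrN1 opprK add0r.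
Qed.

End marked_renewal_process.

(** * Levy's maximal inequality by counting sign patterns *)

Section levy_maximal_inequality.
Local Close Scope classical_set_scope.
Context {R : realType} (J : finType).
Implicit Types e : {ffun J -> bool}.
Local Open Scope set_scope.

Section reflection.
Variables (W : zmodType) (x : J -> W) (tau : J -> R) (B : pred W).
Hypothesis B_mid : forall u v w : W, v + w = u + u -> B u -> B v || B w.

Let sg e j := if e j then x j else - x j.
Let S e t := \sum_(j | tau j <= t) sg e j.
Let tot e := \sum_j sg e j.
Let hit e i := B (S e (tau i)) && [forall k, B (S e (tau k)) ==> (tau i <= tau k)].
(** Reversal of all signs strictly after the first time at which the partial sum is bad. Ties in
    [tau] may give several first hits, but these share one time, so the choice made by [pick] does
    not matter. *)
Let refl e := if [pick i | hit e i] is Some i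
  then [ffun j => if tau j <= tau i then e j else ~~ e j] else e.

Let ex_hit e : [exists i, B (S e (tau i))] -> exists i, hit e i.
Proof.
move=> /existsP[i0 Bi0].
case: (@Order.TotalTheory.arg_minP _ _ _ i0 (fun i => B (S e (tau i))) tau Bi0) => i Bi mi.
by exists i; rewrite /hit Bi/=; apply/forallP => k; apply/implyP; exact: mi.
Qed.

Let S_refl e i t : hit e i -> t <= tau i ->
  S [ffun j => if tau j <= tau i then e j else ~~ e j] t = S e t.
Proof.
move=> hi ti; apply: eq_bigr => j jt.
by rewrite /sg ffunE (le_trans jt ti).
Qed.

Let hit_refl e i : hit e i -> hit [ffun j => if tau j <= tau i then e j else ~~ e j] i.
Proof.
move=> hi; have /andP[Bi /forallP mi] := hi.
rewrite /hit (S_refl hi)// Bi/=; apply/forallP => k; apply/implyP => Bk.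
rewrite leNgt; apply/negP => ki.
move: Bk; rewrite (S_refl hi (ltW ki)) => Bk.
by have := mi k; rewrite Bk/= leNgt ki.
Qed.

Let hit_tau e i k : hit e i -> hit e k -> tau i = tau k.
Proof.
move=> /andP[Bi /forallP mi] /andP[Bk /forallP mk].
by apply/eqP; rewrite eq_le; have := mi k; rewrite Bk/= => ->; have := mk i; rewrite Bi.
Qed.

Let reflE e i : hit e i -> refl e = [ffun j => if tau j <= tau i then e j else ~~ e j].
Proof.
move=> hi; rewrite /refl; case: pickP => [k hk|/(_ i)]; last by rewrite hi.
by rewrite (hit_tau hi hk).
Qed.

Let reflK e : [exists i, B (S e (tau i))] -> refl (refl e) = e.
Proof.
move=> /ex_hit[i hi]; rewrite (reflE hi) (reflE (hit_refl hi)).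
by apply/ffunP => j; rewrite !ffunE; case: (tau j <= tau i); rewrite ?negbK.
Qed.

(** The totals of [e] and of its reflection add up to twice the bad partial sum, so by [B_mid] one
    of them is bad. The reflection is injective on patterns with a hit, hence the factor 2. The
    group [W] is arbitrary because sums of functions come next. *)
Lemma levy_reflection :
  (#|[set e | [exists i, B (S e (tau i))]]| <= 2 * #|[set e | B (tot e)]|)%N.
Proof.
set A := [set e | _]; set T := [set e | _].
have sub : A \subset T :|: (A :&: refl @^-1: T).
  apply/fintype.subsetP => e eA; move: (eA); rewrite inE => /ex_hit[i hi].
  rewrite !inE in eA *; rewrite eA/= -[X in X || _]/(B (tot e)).
  have /andP[Bi _] := hi; rewrite (reflE hi).
  apply: (B_mid _ Bi); rewrite /S /tot.
  rewrite [X in X + _](bigID (fun j => tau j <= tau i))/=.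
  rewrite [X in _ + _ + X](bigID (fun j => tau j <= tau i))/=.
  rewrite addrACA -[RHS]addr0; congr (_ + _).
    by congr (_ + _); apply: eq_bigr => j jt; rewrite /sg ffunE jt.
  rewrite -big_split/= big1// => j jt; rewrite /sg ffunE (negbTE jt).
  by case: (e j); rewrite /= ?subrr ?addNr.
apply: (leq_trans (subset_leq_card sub)); apply: (leq_trans (leq_card_setU _ _)).
rewrite mul2n -addnn leq_add2l.
rewrite -(@card_in_imset _ _ refl).
  apply: subset_leq_card; apply/fintype.subsetP => _ /imsetP[e + ->].
  by rewrite !inE => /andP[_].
move=> e e' /setIP[eA _] /setIP[eA' _] h.
by rewrite !inE in eA eA'; rewrite -(reflK eA) -(reflK eA') h.
Qed.

End reflection.

Definition rsign e j : R := if e j then 1 else -1.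

(** Two reflections, each costing a factor 2. The first runs along [o] with values in functions of
    [i], whose coordinate [i] keeps the terms of time at most [T i]; bad means that some coordinate
    exceeds [a]. The second runs along [T] on the complete sum. *)
Lemma levy_maximal (o T x : J -> R) (a : R) :
  (#|[set e | [exists k, exists i,
      (a < `|\sum_(j | (o j <= o k) && (T j <= T i)) rsign e j * x j|)%R]]| <=
   4 * #|[set e | (a < `|\sum_j rsign e j * x j|)%R]|)%N.
Proof.
have mid (u v w : R) : v + w = u + u -> a < `|u| -> (a < `|v|) || (a < `|w|).
  move=> h au; rewrite !ltNge -negb_and; apply/negP => /andP[va wa].
  move: au; rewrite ltNge => /negP; apply.
  have : `|u + u| <= a + a by rewrite -h (le_trans (ler_normD _ _))// lerD.
  rewrite -mulr2n normrMn -[a + a]mulr2n => h2; lra.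
pose X (j : J) : {ffun J -> R} := [ffun i => if T j <= T i then x j else 0].
pose BX (u : {ffun J -> R}) := [exists i, a < `|u i|].
have sgE e j (u : R) : (if e j then u else - u) = rsign e j * u.
  by rewrite /rsign; case: (e j); rewrite ?mul1r ?mulN1r.
have BXmid (u v w : {ffun J -> R}) : v + w = u + u -> BX u -> BX v || BX w.
  move=> h /existsP[i ui].
  have hi : v i + w i = u i + u i by move/ffunP : h => /(_ i); rewrite !ffunE.
  by have /orP[vi|wi] := mid _ _ _ hi ui; apply/orP; [left|right]; apply/existsP; exists i.
have h1 := levy_reflection X o BXmid.
have h2 := levy_reflection x T mid.
rewrite -[4%N]/(2 * 2)%N -mulnA; apply: (leq_trans _ (leq_trans h1 _)).
  apply: subset_leq_card; apply/fintype.subsetP => e; rewrite !inE => /existsP[k /existsP[i h]].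
  apply/existsP; exists k; apply/existsP; exists i.
  rewrite sum_ffunE; apply: (lt_le_trans h); rewrite big_mkcondr/=.
  rewrite le_eqVlt; apply/orP; left; apply/eqP; congr `|_|.
  apply: eq_bigr => j _; rewrite -sgE; case: (e j); rewrite !ffunE; case: ifP => //.
  by rewrite oppr0.
rewrite leq_mul2l/=.
have -> : [set e | a < `|\sum_j rsign e j * x j|] =
          [set e : {ffun J -> bool} | a < `|\sum_j (if e j then x j else - x j)|].
  apply/setP => e; rewrite !inE; congr (_ < `|_|).
  by apply: eq_bigr => j _; rewrite sgE.
apply: (leq_trans _ h2).
apply: subset_leq_card; apply/fintype.subsetP => e; rewrite !inE => /existsP[i h].
apply/existsP; exists i; apply: (lt_le_trans h).
rewrite sum_ffunE le_eqVlt; apply/orP; left; apply/eqP; congr `|_|.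
rewrite [RHS]big_mkcond/=; apply: eq_bigr => j _.
by case: (e j); rewrite !ffunE; case: ifP => // _; rewrite oppr0.
Qed.

(** Flipping the sign at [j] is an involution that negates the summand. *)
Lemma rsign_orthogonal j k : j != k -> \sum_e rsign e j * rsign e k = 0.
Proof.
move=> jk.
pose fl e : {ffun J -> bool} := [ffun i => if i == j then ~~ e i else e i].
have flK : involutive fl.
  by move=> e; apply/ffunP => i; rewrite !ffunE; case: (i == j); rewrite ?negbK.
apply/eqP; rewrite -[_ == 0](mulrn_eq0 _ 2) mulr2n.
apply/eqP; rewrite {1}(reindex_inj (inv_inj flK))/= -big_split/= big1// => e _.
rewrite /rsign !ffunE eqxx eq_sym (negbTE jk).
by case: (e j); case: (e k); rewrite /= ?mulN1r ?mul1r ?opprK ?subrr ?addNr.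
Qed.

(** Chebyshev's inequality for counting measure on sign patterns; by orthogonality the mixed terms
    of the squared sums cancel. *)
Lemma rsign_chebyshev (x : J -> R) (a : R) : 0 < a ->
  #|[set e | a < `|\sum_j rsign e j * x j|]|%:R * a ^+ 2 <=
  #|{ffun J -> bool}|%:R * \sum_j x j ^+ 2.
Proof.
move=> a0.
have -> : #|{ffun J -> bool}|%:R * \sum_j x j ^+ 2 = \sum_e (\sum_j rsign e j * x j) ^+ 2.
  transitivity (\sum_j \sum_k (\sum_e rsign e j * rsign e k) * (x j * x k)).
    rewrite mulr_sumr; apply: eq_bigr => j _; rewrite (bigD1 j)//= [X in _ + X]big1 ?addr0.
      rewrite expr2; congr (_ * _).
      rewrite -sum1_card natr_sum; apply: eq_bigr => e _.
      by rewrite /rsign; case: (e j); rewrite ?mulr1// mulrNN mulr1.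
    by move=> k kj; rewrite rsign_orthogonal ?mul0r// eq_sym.
  under [RHS]eq_bigr => e _.
    rewrite expr2 mulr_suml; under eq_bigr do rewrite mulr_sumr; over.
  rewrite [RHS]exchange_big/=; apply: eq_bigr => j _.
  rewrite [RHS]exchange_big/=; apply: eq_bigr => k _.
  by rewrite mulr_suml; apply: eq_bigr => e _; rewrite mulrACA.
rewrite -sum1_card natr_sum mulr_suml big_mkcond/=.
apply: ler_sum => e _; rewrite inE; case: ifPn => [ae|_]; last exact: sqr_ge0.
rewrite mul1r -[leRHS]real_normK ?num_real//.
by rewrite ler_pXn2r// ?nnegrE// ltW.
Qed.

End levy_maximal_inequality.

(** * Borel-Cantelli and summation over dyadic blocks *)

Section borel_cantelli_geometric.
Context {R : realType} d (Om : measurableType d) (P : probability Om R).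

Lemma ae_eventually_geometric (F : nat -> set Om) (C q : R) :
  (forall n, measurable (F n)) -> 0 <= C -> 0 <= q < 1 ->
  (forall n, P (F n) <= (C * q ^+ n)%:E)%E ->
  {ae P, forall w, exists N, forall n, (N <= n)%N -> ~ F n w}.
Proof.
move=> mF C0 /andP[q0 q1] PF.
exists (lim_sup_set F); split.
- by apply: bigcapT_measurable => n; apply: bigcup_measurable => k _.
- apply: lim_sup_set_cvg0 => //.
  apply: (@le_lt_trans _ _ (\sum_(n <oo) (C * q ^+ n)%:E)%E).
    by apply: lee_nneseries => // n *; exact: PF.
  have cv : cvgn (series (geometric C q)).
    by apply: is_cvg_geometric_series; rewrite ger0_norm.
  have -> : (\sum_(n <oo) (C * q ^+ n)%:E)%E = (limn (series (geometric C q)))%:E.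
    rewrite -EFin_lim//; congr (limn _); apply/funext => n /=.
    by rewrite /series/= sumEFin.
  exact: ltry.
- move=> w /= /forallNP h n _.
  have /existsNP[k /not_implyP[nk /contrapT Fk]] := h n.
  by exists k.
Qed.

End borel_cantelli_geometric.

Section dyadic_blocks.
Context {R : realType} (X : Type).
Variables (f : nat -> X -> R) (D : set X) (C q : R) (K : nat).
Hypotheses (C0 : 0 <= C) (q0 : 0 < q < 1).
Hypothesis blk : forall k m t, (K <= k)%N -> (m <= 2 ^ k)%N -> D t ->
  `|\sum_(2 ^ k <= j < 2 ^ k + m) f j t| <= C * q ^+ k.

Let s n t := \sum_(0 <= j < n) f j t.

Let sB m n t : (m <= n)%N -> s n t - s m t = \sum_(m <= j < n) f j t.
Proof. by move=> mn; rewrite /s (@big_cat_nat _ _ _ m 0 n)//= addrAC subrr add0r. Qed.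

(** The bound keeps the telescoping form [q ^+ k0 - q ^+ k], so that the induction closes and slack
    remains for one incomplete block. *)
Let dyadic k0 k t : (K <= k0)%N -> (k0 <= k)%N -> D t ->
  `|s (2 ^ k) t - s (2 ^ k0) t| <= C * (q ^+ k0 - q ^+ k) / (1 - q).
Proof.
have q1 : 0 < 1 - q by rewrite subr_gt0; case/andP : q0.
move=> Kk0 /subnK <- Dt; elim: (k - k0)%N => [|i ih].
  by rewrite add0n !subrr mulr0 mul0r normr0.
rewrite addSn -(subrKA (s (2 ^ (i + k0)) t)).
apply: (le_trans (ler_normD _ _)).
have h : `|s (2 ^ (i + k0).+1) t - s (2 ^ (i + k0)) t| <= C * q ^+ (i + k0).
  rewrite sB ?leq_exp2l// expnS mul2n -addnn; apply: blk => //.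
  by rewrite (leq_trans Kk0)// leq_addl.
apply: (le_trans (lerD h ih)); rewrite exprS le_eqVlt; apply/orP; left; apply/eqP.
by field; rewrite gt_eqF.
Qed.

Lemma dyadic_cauchy k n t : (K <= k)%N -> (2 ^ k <= n)%N -> D t ->
  `|s n t - s (2 ^ k) t| <= C * q ^+ k / (1 - q).
Proof.
have /andP[qp qlt1] := q0; have q1 : 0 < 1 - q by rewrite subr_gt0.
move=> Kk kn Dt.
have n0 : (0 < n)%N by rewrite (leq_trans _ kn)// expn_gt0.
(* [2 ^ k'] is the last power of 2 up to [n]; what remains is an initial piece of one block. *)
pose k' := trunc_log 2 n.
have kk' : (k <= k')%N by exact: trunc_log_max.
have k'n : (2 ^ k' <= n)%N by exact: trunc_logP.
have nk' : (n < 2 ^ k'.+1)%N by exact: trunc_log_ltn.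
rewrite -(subrKA (s (2 ^ k') t)); apply: (le_trans (ler_normD _ _)).
have h1 : `|s n t - s (2 ^ k') t| <= C * q ^+ k'.
  rewrite sB//; rewrite -(subnKC k'n); apply: blk => //; first exact: leq_trans kk'.
  by rewrite leq_subLR addnn -mul2n -expnS ltnW.
apply: (le_trans (lerD h1 (dyadic Kk kk' Dt))).
rewrite ler_pdivlMr// mulrDl mulfVK ?gt_eqF//.
(* After clearing [1 - q], the incomplete block and the telescoped sum add up to
   [C q^k - C q^k' q]. *)
have : 0 <= C * q ^+ k' * q by rewrite !mulr_ge0 ?exprn_ge0 ?(ltW qp).
lra.
Qed.

Lemma dyadic_uniform_cauchy (eps : R) : 0 < eps -> exists N, forall m n t,
  (N <= m)%N -> (N <= n)%N -> D t -> `|s m t - s n t| < eps.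
Proof.
move=> e0; have /andP[qp qlt1] := q0; have q1 : 0 < 1 - q by rewrite subr_gt0.
have qn : `|q| < 1 by rewrite gtr0_norm.
have := @cvg_geometric R (C / (1 - q)) q qn.
have e2 : 0 < eps / 2 by rewrite divr_gt0.
move=> /cvgr0Pnorm_lt /(_ (eps / 2) e2) [k0 _ h].
pose k := maxn k0 K; exists (2 ^ k)%N => m n t km kn Dt.
have hk : C * q ^+ k / (1 - q) < eps / 2.
  have := h k (leq_maxl _ _); rewrite /geometric/= => /(le_lt_trans (ler_norm _)).
  by rewrite mulrAC.
apply: (le_lt_trans (ler_distD (s (2 ^ k) t) _ _)).
rewrite [eps]splitr ltr_leD//; last rewrite distrC.
  by apply: le_lt_trans hk; apply: dyadic_cauchy => //; exact: leq_maxr.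
by apply: le_trans (ltW hk); apply: dyadic_cauchy => //; exact: leq_maxr.
Qed.

End dyadic_blocks.

(** * Norm, scalar product and measurability for vectors *)

Section vector_lemmas.
Context {R : realType} {d : nat}.
Implicit Types x y z : d.-tuple R.

Lemma tnth_vadd x y i : tnth (vadd x y) i = tnth x i + tnth y i.
Proof. by rewrite tnth_mktuple. Qed.
Lemma tnth_vsub x y i : tnth (vsub x y) i = tnth x i - tnth y i.
Proof. by rewrite tnth_mktuple. Qed.
Lemma tnth_vopp x i : tnth (vopp x) i = - tnth x i.
Proof. by rewrite tnth_mktuple. Qed.
Lemma tnth_vscale a x i : tnth (vscale a x) i = a * tnth x i.
Proof. by rewrite tnth_mktuple. Qed.
Lemma tnth_vzero i : tnth (vzero : d.-tuple R) i = 0.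
Proof. by rewrite tnth_mktuple. Qed.

Lemma tnth_vsum (n : nat) (F : 'I_n -> d.-tuple R) i :
  tnth (\big[vadd/vzero]_(j < n) F j) i = \sum_(j < n) tnth (F j) i.
Proof.
by apply: (big_morph (fun x => tnth x i)) => [x y|]; rewrite ?tnth_vadd ?tnth_vzero.
Qed.

Lemma vdotNr z x : vdot z (vopp x) = - vdot z x.
Proof. by rewrite /vdot -sumrN; apply: eq_bigr => i _; rewrite tnth_vopp mulrN. Qed.

Lemma vnorm_ge0 x : 0 <= vnorm x. Proof. exact: sqrtr_ge0. Qed.

Lemma vnormZ a x : vnorm (vscale a x) = `|a| * vnorm x.
Proof.
rewrite /vnorm; have -> : vdot (vscale a x) (vscale a x) = a ^+ 2 * vdot x x.
  by rewrite /vdot mulr_sumr; apply: eq_bigr => i _; rewrite !tnth_vscale; ring.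
by rewrite sqrtrM ?sqr_ge0// sqrtr_sqr.
Qed.

Lemma vnormN x : vnorm (vopp x) = vnorm x.
Proof.
by congr Num.sqrt; apply: eq_bigr => i _; rewrite tnth_vopp mulrNN.
Qed.

Lemma coord_le_vnorm x i : `|tnth x i| <= vnorm x.
Proof.
rewrite -sqrtr_sqr ler_wsqrtr// /vdot (bigD1 i)//= expr2 lerDl.
by apply: sumr_ge0 => j _; rewrite -expr2 sqr_ge0.
Qed.

Lemma vnorm_le_sum x : vnorm x <= \sum_(i < d) `|tnth x i|.
Proof.
have s0 : 0 <= \sum_(i < d) `|tnth x i| by exact: sumr_ge0.
rewrite -[leRHS]ger0_norm// -sqrtr_sqr ler_wsqrtr//.
rewrite expr2 mulr_suml /vdot; apply: ler_sum => i _.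
apply: (@le_trans _ _ (`|tnth x i| * `|tnth x i|)).
  by rewrite -normrM ler_norm.
by rewrite ler_wpM2l// (bigD1 i)//= lerDl sumr_ge0.
Qed.

(** Division by [d.+1] keeps the bound meaningful for [d = 0] and leaves room for the strict
    inequality. *)
Lemma vnorm_lt_coord x (eps : R) : 0 < eps ->
  (forall i, `|tnth x i| < eps / d.+1%:R) -> vnorm x < eps.
Proof.
move=> e0 h; apply: (le_lt_trans (vnorm_le_sum x)).
apply: (@le_lt_trans _ _ (\sum_(i < d) eps / d.+1%:R)).
  by apply: ler_sum => i _; exact: ltW.
rewrite sumr_const card_ord -[ltLHS]mulr_natr -mulrA gtr_pMr// mulrC.
by rewrite ltr_pdivrMr// mul1r ltr_nat.
Qed.

Lemma vdot_le z x : `|vdot z x| <= (\sum_(i < d) `|tnth z i|) * vnorm x.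
Proof.
rewrite mulr_suml (le_trans (ler_norm_sum _ _ _))//; apply: ler_sum => i _.
by rewrite normrM ler_wpM2l// coord_le_vnorm.
Qed.

Lemma vnorm_eq0 x : vnorm x = 0 -> x = vzero.
Proof.
move=> x0; apply: eq_from_tnth => i; rewrite tnth_vzero; apply/eqP.
by rewrite -normr_le0 -x0 coord_le_vnorm.
Qed.

Lemma measurable_vnorm : measurable_fun setT (vnorm : d.-tuple R -> R).
Proof.
apply: (@measurableT_comp _ _ _ _ _ _ (@Num.sqrt R)).
  by apply: continuous_measurable_fun; exact: sqrt_continuous.
apply: (@measurable_sum _ _ R setT _ (index_enum 'I_d)
  (fun i (x : d.-tuple R) => tnth x i * tnth x i)) => i.
by apply: measurable_funM; exact: measurable_tnth.
Qed.

Lemma measurable_vdot z : measurable_fun setT (vdot z).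
Proof.
apply: (@measurable_sum _ _ R setT _ (index_enum 'I_d)
  (fun i (x : d.-tuple R) => tnth z i * tnth x i)) => i.
by apply: measurable_funM => //; exact: measurable_tnth.
Qed.

Lemma measurable_fun_coord d' (T : measurableType d') (f : T -> d.-tuple R) :
  (forall i, measurable_fun setT (fun w => tnth (f w) i)) -> measurable_fun setT f.
Proof. by move=> h; apply/measurable_fun_tnthP => i; exact: h. Qed.

Lemma measurable_vscale d' (T : measurableType d') (a : T -> R) (f : T -> d.-tuple R) :
  measurable_fun setT a -> measurable_fun setT f ->
  measurable_fun setT (fun w => vscale (a w) (f w)).
Proof.
move=> ma mf; apply: measurable_fun_coord => i.
rewrite (_ : (fun w => _) = (fun w => a w * tnth (f w) i)); last first.
  by apply/funext => w; rewrite tnth_vscale.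
apply: measurable_funM => //; exact: (measurableT_comp (measurable_tnth i) mf).
Qed.

Lemma measurable_vopp : measurable_fun setT (vopp : d.-tuple R -> d.-tuple R).
Proof.
apply: measurable_fun_coord => i.
rewrite (_ : (fun x => _) = (fun x => - tnth x i)); last first.
  by apply/funext => x; rewrite tnth_vopp.
by apply: measurableT_comp => //; exact: measurable_tnth.
Qed.

Lemma measurable_sphere : measurable (sphere : set (d.-tuple R)).
Proof.
have := measurable_vnorm measurableT (measurable_set1 (1 : R)).
by rewrite setTI.
Qed.

End vector_lemmas.

(** * The five independent sequences and the law of a mark *)

Section independent_variables.
Context {R : realType} d (Om : measurableType d) (P : probability Om R).
Context (I : choiceType) (F : I -> set (set Om)).
Local Notation sub J := (g_sigma_algebraType (pisys F J)).

Lemma rv_events_measurable d' (S : measurableType d') (X : Om -> S) :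
  measurable_fun setT X -> rv_events X `<=` measurable.
Proof. by move=> mX _ [B mB <-]; rewrite -[X in measurable X]setTI; exact: mX. Qed.

Lemma rv_eventsI d' (S : measurableType d') (X : Om -> S) : setI_closed (rv_events X).
Proof.
by move=> _ _ [B mB <-] [C mC <-]; exists (B `&` C) => //; exact: measurableI.
Qed.

Lemma rv_eventsT d' (S : measurableType d') (X : Om -> S) : rv_events X setT.
Proof. by exists setT. Qed.

Lemma measurable_sub d' (S : measurableType d') (X : Om -> S) (J : set I) i :
  J i -> F i = rv_events X -> measurable_fun setT (X : sub J -> S).
Proof.
move=> Ji FX _ B mB; rewrite setTI; apply: sub_gen_smallest.
by apply: (pisys1 Ji); rewrite FX; exists B.
Qed.

Hypothesis mF : forall i, F i `<=` measurable.
Hypothesis FI : forall i, setI_closed (F i).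
Hypothesis FT : forall i, F i setT.
Hypothesis indepF : mutually_independent P F.

Lemma indep_sub d' (S : measurableType d') (Y : Om -> S) (J J' : set I) A B :
  J `&` J' = set0 -> measurable_fun setT (Y : sub J' -> S) ->
  <<s pisys F J >> A -> measurable B ->
  P (A `&` Y @^-1` B) = (P A * P (Y @^-1` B))%E.
Proof.
move=> JJ' mY sA mB; apply: (pisys_indep mF FI FT indepF JJ' sA).
by have := mY measurableT B mB; rewrite setTI.
Qed.

Lemma pair_law d1 (S1 : measurableType d1) d2 (S2 : measurableType d2)
    (nu1 : probability S1 R) (nu2 : probability S2 R) (X : Om -> S1) (Y : Om -> S2)
    (J J' : set I) : J `&` J' = set0 ->
  measurable_fun setT (X : sub J -> S1) -> measurable_fun setT (Y : sub J' -> S2) ->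
  (forall B, measurable B -> P (X @^-1` B) = nu1 B) ->
  (forall B, measurable B -> P (Y @^-1` B) = nu2 B) ->
  forall C, measurable C -> P ((fun w => (X w, Y w)) @^-1` C) = (nu1 \x nu2)%E C.
Proof.
move=> JJ' mX mY lX lY C mC.
have sJ (K : set I) := @pisys_measurable _ _ _ F mF K.
have mX' : measurable_fun setT (X : Om -> S1) := measurable_fun_coarse (@sJ J) mX.
have mY' : measurable_fun setT (Y : Om -> S2) := measurable_fun_coarse (@sJ J') mY.
have mXY : measurable_fun setT (fun w => (X w, Y w)) by exact: measurable_fun_pair.
pose XY : {mfun Om >-> (S1 * S2)%type} := HB.pack (fun w => (X w, Y w))
  (isMeasurableFun.Build _ _ _ _ _ mXY).
symmetry; apply: (@product_measure_unique _ _ _ _ _ nu1 nu2 (distribution P XY)) => // A B mA mB.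
have sA : <<s pisys F J >> (X @^-1` A) by have := mX measurableT A mA; rewrite setTI.
by have := indep_sub JJ' mY sA mB; rewrite lX// lY.
Qed.

End independent_variables.

Section model.
Context {R : realType} {n : nat} d (Om : measurableType d) (P : probability Om R).
Local Notation mR := (measurableTypeR R).
Variables (E E' Tt U : nat -> {RV P >-> R}) (V : nat -> {RV P >-> n.-tuple R}).
Variables (T : R) (hT : 0 < T) (QV : probability (n.-tuple R) R).

(** The match has the same shape as the family in the theorem, so the independence hypothesis
    applies by conversion. The first index is the kind of variable. *)
Definition ts_events (kj : 'I_5 * nat) : set (set Om) :=
  match nat_of_ord kj.1 with
  | 0 => rv_events (E kj.2)
  | 1 => rv_events (E' kj.2)
  | 2 => rv_events (Tt kj.2)
  | 3 => rv_events (U kj.2)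
  | _ => rv_events (V kj.2)
  end.

Definition ix (k : nat) (k5 : (k < 5)%N) (j : nat) : 'I_5 * nat := (Ordinal k5, j).

Lemma ts_events_measurable i : ts_events i `<=` measurable.
Proof.
by rewrite /ts_events; case: (nat_of_ord i.1) => [|[|[|[|?]]]];
  apply: rv_events_measurable; exact: measurable_funP.
Qed.

Lemma ts_eventsI i : setI_closed (ts_events i).
Proof.
by rewrite /ts_events; case: (nat_of_ord i.1) => [|[|[|[|?]]]]; exact: rv_eventsI.
Qed.

Lemma ts_eventsT i : ts_events i setT.
Proof.
by rewrite /ts_events; case: (nat_of_ord i.1) => [|[|[|[|?]]]]; exact: rv_eventsT.
Qed.

Hypothesis lE : forall j (A : set R), measurable A ->
  distribution P (E j) A = exponential_prob 1 A.
Hypothesis lE' : forall j (A : set R), measurable A ->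
  distribution P (E' j) A = exponential_prob 1 A.
Hypothesis lT : forall j (A : set R), measurable A ->
  distribution P (Tt j) A = uniform_prob hT A.
Hypothesis lU : forall j (A : set R), measurable A ->
  distribution P (U j) A = uniform_prob ltr01 A.
Hypothesis lV : forall j (A : set (n.-tuple R)), measurable A ->
  distribution P (V j) A = QV A.
Hypothesis indep : mutually_independent P ts_events.

Local Notation F := ts_events.
Local Notation sub J := (g_sigma_algebraType (pisys F J)).

Lemma msub_E (J : set ('I_5 * nat)) j : J (@ix 0 isT j) ->
  measurable_fun setT (E j : sub J -> R).
Proof. by move=> Jj; exact: (measurable_sub Jj). Qed.
Lemma msub_E' (J : set ('I_5 * nat)) j : J (@ix 1 isT j) ->
  measurable_fun setT (E' j : sub J -> R).
Proof. by move=> Jj; exact: (measurable_sub Jj). Qed.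
Lemma msub_T (J : set ('I_5 * nat)) j : J (@ix 2 isT j) ->
  measurable_fun setT (Tt j : sub J -> R).
Proof. by move=> Jj; exact: (measurable_sub Jj). Qed.
Lemma msub_U (J : set ('I_5 * nat)) j : J (@ix 3 isT j) ->
  measurable_fun setT (U j : sub J -> R).
Proof. by move=> Jj; exact: (measurable_sub Jj). Qed.
Lemma msub_V (J : set ('I_5 * nat)) j : J (@ix 4 isT j) ->
  measurable_fun setT (V j : sub J -> n.-tuple R).
Proof. by move=> Jj; exact: (measurable_sub Jj). Qed.

(** The jump time comes first, so the law of a mark is the product of the uniform law of the time
    and of the law of the three variables that shape the jump. *)
Definition mark_space := (mR * (mR * (mR * n.-tuple R)))%type.
Definition ts_mark j w : mark_space := (Tt j w, (U j w, (E j w, V j w))).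
Definition ts_mark_law : probability mark_space R :=
  (uniform_prob hT \x (uniform_prob (@ltr01 R) \x (expo R \x QV)))%E.

Let marked j : set ('I_5 * nat) :=
  [set @ix 2 isT j; @ix 3 isT j; @ix 0 isT j; @ix 4 isT j].

Lemma msub_mark (J : set ('I_5 * nat)) j : marked j `<=` J ->
  measurable_fun setT (ts_mark j : sub J -> mark_space).
Proof.
move=> h; apply: measurable_fun_pair.
  by apply: msub_T; apply: h; do 3 left.
apply: measurable_fun_pair.
  by apply: msub_U; apply: h; left; left; right.
apply: measurable_fun_pair.
  by apply: msub_E; apply: h; left; right.
by apply: msub_V; apply: h; right.
Qed.

Lemma measurable_ts_mark j : measurable_fun setT (ts_mark j : Om -> mark_space).
Proof.
apply: (measurable_fun_coarse (@pisys_measurable _ _ _ _ ts_events_measurable setT)).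
exact: msub_mark.
Qed.

(** The components are split off one at a time; each is independent of the remaining tuple because
    the index sets are disjoint. *)
Lemma ts_mark_lawE j B : measurable B -> P (ts_mark j @^-1` B) = ts_mark_law B.
Proof.
move=> mB.
have disj k k5 (J : set ('I_5 * nat)) : (forall i, J i -> nat_of_ord i.1 != k) ->
    [set @ix k k5 j] `&` J = set0.
  by move=> h; apply/seteqP; split => // i [-> /h]; rewrite /= eqxx.
have base := pair_law ts_events_measurable ts_eventsI ts_eventsT indep.
apply: (base _ mR _ _ (uniform_prob hT) _ (Tt j) _ [set @ix 2 isT j]
  [set @ix 3 isT j; @ix 0 isT j; @ix 4 isT j]) => //.
- by apply: disj => i [[->|->]|->].
- exact: msub_T.
- apply: measurable_fun_pair; first by apply: msub_U; left; left.
  by apply: measurable_fun_pair; [apply: msub_E; left; right|apply: msub_V; right].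
- by move=> C mC; exact: lT.
move=> C mC.
apply: (base _ mR _ _ (uniform_prob ltr01) _ (U j) _ [set @ix 3 isT j]
  [set @ix 0 isT j; @ix 4 isT j]) => //.
- by apply: disj => i [->|->].
- exact: msub_U.
- by apply: measurable_fun_pair; [apply: msub_E; left|apply: msub_V; right].
- by move=> D mD; exact: lU.
move=> D mD.
apply: (base _ mR _ _ (expo R) _ (E j) _ [set @ix 0 isT j]
  [set @ix 4 isT j]) => //.
- by apply: disj => i ->.
- exact: msub_E.
- exact: msub_V.
- by move=> G mG; exact: lE.
- by move=> G mG; exact: lV.
Qed.

Lemma ts_mark_indep (J : set ('I_5 * nat)) j : J `&` marked j = set0 ->
  forall A B, <<s pisys F J >> A -> measurable B ->
  P (A `&` ts_mark j @^-1` B) = (P A * ts_mark_law B)%E.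
Proof.
move=> disj A B sA mB; rewrite -(ts_mark_lawE j mB).
apply: (indep_sub ts_events_measurable ts_eventsI ts_eventsT indep disj _ sA mB).
exact: msub_mark.
Qed.

Lemma E'_indep (J : set ('I_5 * nat)) j : ~ J (@ix 1 isT j) ->
  forall A (B : set R), <<s pisys F J >> A -> measurable B ->
  P (A `&` E' j @^-1` B) = (P A * expo R B)%E.
Proof.
move=> nJ A B sA mB; rewrite -[expo R B](lE' j mB).
apply: (indep_sub (J' := [set @ix 1 isT j]) ts_events_measurable ts_eventsI ts_eventsT indep _ _ sA mB).
  by apply/seteqP; split => // i [Ji ij]; apply: nJ; rewrite -ij.
exact: msub_E'.
Qed.

Lemma V_indep (J : set ('I_5 * nat)) j : ~ J (@ix 4 isT j) ->
  forall A B, <<s pisys F J >> A -> measurable B ->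
  P (A `&` V j @^-1` B) = (P A * QV B)%E.
Proof.
move=> nJ A B sA mB; rewrite -(lV j mB).
apply: (indep_sub (J' := [set @ix 4 isT j]) ts_events_measurable ts_eventsI ts_eventsT indep _ _ sA mB).
  by apply/seteqP; split => // i [Ji ij]; apply: nJ; rewrite -ij.
exact: msub_V.
Qed.

End model.

(** * Linear growth of the arrival times *)

Section arrivals.
Context {R : realType} {n : nat} d (Om : measurableType d) (P : probability Om R).
Local Notation mR := (measurableTypeR R).
Variables (E E' Tt U : nat -> {RV P >-> R}) (V : nat -> {RV P >-> n.-tuple R}).
Hypothesis lE' : forall j (A : set R), measurable A ->
  distribution P (E' j) A = exponential_prob 1 A.
Hypothesis indep : mutually_independent P (ts_events E E' Tt U V).

Local Notation F := (ts_events E E' Tt U V).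
Local Notation tau := (arrival (fun j => E' j)).

Lemma E'_ae_gt0 : {ae P, forall w, forall j, 0 < E' j w}.
Proof.
apply: ae_foralln => j; exists (E' j @^-1` `]-oo, 0]%classic); split.
- by rewrite -[X in measurable X]setTI; exact: (measurable_funP (E' j)).
- exact: (etrans (lE' j (measurable_itv `]-oo, 0])) expo_ge0).
- by move=> w /= /negP; rewrite -leNgt in_itv.
Qed.

Lemma arrival_ae_ge0 : {ae P, forall w, forall k, 0 <= tau k w}.
Proof.
apply: filterS E'_ae_gt0 => w h k.
by apply: sumr_ge0 => i _; exact: ltW.
Qed.

(** Equal to [exp (- x)] for nonnegative [x]; the absolute value bounds it everywhere, while the
    gaps are nonnegative only almost surely. *)
Let phi (x : R) := expR (- `|x|).

Let phi01 x : 0 <= phi x <= 1.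
Proof. by rewrite expR_ge0 /phi -[leRHS]expR0 ler_expR oppr_le0 normr_ge0. Qed.

Let cphi : continuous phi.
Proof.
move=> x; apply: continuous_comp; last exact: continuous_expR.
by apply: continuousN; exact: norm_continuous.
Qed.

Let bphi : bmf (phi : mR -> R).
Proof.
split; first exact: continuous_measurable_fun.
by exists 1 => x; have /andP[p0 p1] := phi01 x; rewrite ger0_norm.
Qed.

Let expo_phi : \int[expo R]_x phi x = 2^-1.
Proof.
pose G (x : R) := - 2^-1 * expR (- (2 * x)).
have dG (x : R) : 0 < x -> is_derive x 1 G (phi x * expR (- x)).
  move=> x0; rewrite /phi gtr0_norm// -expRD.
  have -> : - x + - x = - (2 * x) by ring.
  by rewrite /G; apply: is_derive_eq; rewrite /GRing.scale/=; field.
have G0 : G x @[x --> 0^'+] --> G 0.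
  apply: cvg_at_right_filter; apply: cvgM; first exact: cvg_cst.
  apply: continuous_comp; last exact: continuous_expR.
  by apply: continuousN; apply: cvgM; [exact: cvg_cst|exact: cvg_id].
have Goo : G x @[x --> +oo] --> (0 : R).
  rewrite -[X in _ --> X](mulr0 (- 2^-1)); apply: cvgM; first exact: cvg_cst.
  have h : (2 * x : R) @[x --> +oo] --> +oo by exact: gt0_cvgMry.
  exact: (cvg_comp _ _ h (@cvgr_expR R)).
rewrite (@expo_FTC _ phi G bphi (fun x _ => @cphi x) dG G0 Goo) /G.
by rewrite mulr0 oppr0 expR0 mulr1 opprK.
Qed.

Let prodphi k w := \prod_(i < k) phi (E' i w).

Let bprod k : bmf (prodphi k).
Proof. by apply: bmf_prod => i; exact: (bmf_comp (measurable_funP (E' i)) bphi). Qed.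

(** Laplace transform at 1 of a sum of [k] gaps, each contributing [1 / 2]; the last gap is averaged
    with the previous ones frozen. *)
Let E_prodphi k : \int[P]_w prodphi k w = 2^-1 ^+ k.
Proof.
elim: k => [|k ih].
  rewrite expr0; under eq_Rintegral do rewrite /prodphi big_ord0.
  by rewrite RE_cst.
pose J := [set i : 'I_5 * nat | (i.2 < k)%N].
have nJ : ~ J (@ix 1 isT k) by rewrite /J/= ltnn.
have bf : bmf (fun z : g_sigma_algebraType (pisys F J) * mR => prodphi k z.1 * phi z.2).
  apply: bmfM; last exact: (bmf_comp (@measurable_snd _ _ _ mR) bphi).
  apply: (@bmf_comp _ _ _ _ _ (@fst (g_sigma_algebraType (pisys F J)) mR) (prodphi k)) => //.
  apply: (@bmf_prod _ (g_sigma_algebraType (pisys F J)) R _ (index_enum 'I_k)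
    (fun (i : 'I_k) w => phi (E' i w))) => i.
  apply: (@bmf_comp _ _ (g_sigma_algebraType (pisys F J)) mR R (fun w => E' i w) phi) => //.
  by apply: msub_E'; rewrite /J/=.
have := @freezing _ _ Om P _ (@pisys_measurable _ _ _ _ (@ts_events_measurable _ _ _ _ P E E' Tt U V) J) _ mR (expo R)
  (E' k) (measurable_funP (E' k)) (E'_indep lE' indep nJ) _ bf.
rewrite /= => h.
transitivity (\int[P]_w (prodphi k w * phi (E' k w))).
  by apply: eq_Rintegral => w _; rewrite /prodphi big_ord_recr.
rewrite h exprSr -ih -(RintegralZr 2^-1)//; last exact: bmf_integrable.
by apply: eq_Rintegral => w _; rewrite REZ// expo_phi.
Qed.

(** A Chernoff bound: an arrival time of at most [k / 4] has probability at most
    [(exp (1/4) / 2)^k], which is geometric, and Borel-Cantelli excludes these events eventually. *)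
Lemma arrival_growth : {ae P, forall w, exists N, forall k, (N <= k)%N -> k%:R / 4 <= tau k w}.
Proof.
pose A k := [set w | expR (- (k%:R / 4)) <= prodphi k w].
have mA k : measurable (A k).
  rewrite -[A k]setTI; apply: measurable_fun_le => //.
  by case: (bprod k).
have PA k : (P (A k) <= (1 * (2 / 3) ^+ k)%:E)%E.
  rewrite mul1r -(fineK (fin_num_measure P _ (mA k))) lee_fin -RE_indic//.
  rewrite -(ler_pM2l (expR_gt0 (- (k%:R / 4)))) -REZ; last exact: bmf_indic.
  apply: (@le_trans _ _ (\int[P]_w prodphi k w)).
    apply: le_RE => //; first by apply: bmfM; [exact: bmf_cst|exact: bmf_indic].
    move=> w; rewrite indicE; have [|_] := boolP (w \in A k).
      by rewrite inE/= mulr1.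
    rewrite mulr0; apply: prodr_ge0 => i _.
    by have /andP[] := phi01 (E' i w).
  rewrite E_prodphi.
  have -> : - (k%:R / 4) = (- 4^-1) * k%:R :> R by field.
  rewrite expRM_natr -exprMn; apply: lerXn2r; rewrite ?nnegrE//.
  (* Since [exp (- 1/4) >= 3/4], the ratio [exp (1/4) / 2] is at most [2 / 3]. *)
  have : 1 + - 4^-1 <= expR (- 4^-1) :> R by exact: expR_ge1Dx.
  lra.
have q01 : 0 <= (2 / 3 : R) < 1 by apply/andP; split; lra.
have := ae_eventually_geometric mA ler01 q01 PA.
move: E'_ae_gt0; apply: filterS2 => w pos [N hN].
exists N => k Nk; rewrite leNgt; apply/negP => lt; apply: (hN k Nk).
rewrite /A/=.
have -> : prodphi k w = expR (- tau k w).
  rewrite /arrival -sumrN expR_sum; apply: eq_bigr => i _.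
  by rewrite /phi gtr0_norm.
by rewrite ler_expR lerN2 ltW.
Qed.

Lemma arrival_cvgy : {ae P, forall w, tau k w @[k --> \oo] --> +oo}.
Proof.
apply: filterS arrival_growth => w [N hN].
apply: (@ger_cvgy _ _ _ _ (fun k => k%:R / 4)).
  by exists N => // k /= Nk; exact: hN.
apply/cvgryPge => A; near=> k; rewrite ler_pdivlMr//.
by near: k; exact: nbhs_infty_ger.
Unshelve. all: end_near. Qed.

End arrivals.

(** * Jumps, and the maximal estimate on one block *)

Section jumps.
Context {R : realType} {n : nat}.
Local Notation mR := (measurableTypeR R).
Variables (alpha p T sig : R).
Hypotheses (a0 : 0 < alpha) (p0 : 0 < p) (T0 : 0 < T) (sig0 : 0 < sig).

Definition jump_size (x e u : R) (v : n.-tuple R) : R :=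
  Num.min ((alpha * x / (sig * T)) `^ (- alpha^-1))
          (e `^ p^-1 * u `^ alpha^-1 / vnorm v `^ p^-1).

Definition jump (x e u : R) (v : n.-tuple R) : n.-tuple R :=
  vscale (jump_size x e u v / vnorm v) v.

Lemma jump_size_ge0 x e u v : 0 <= jump_size x e u v.
Proof. by rewrite le_min powR_ge0/= divr_ge0// ?mulr_ge0 ?powR_ge0. Qed.

Lemma jump_size_le x e u v : jump_size x e u v <= (alpha * x / (sig * T)) `^ (- alpha^-1).
Proof. by rewrite /jump_size ge_min lexx. Qed.

Lemma vnorm_jump_le x e u v : vnorm (jump x e u v) <= (alpha * x / (sig * T)) `^ (- alpha^-1).
Proof.
apply: (le_trans _ (jump_size_le x e u v)).
rewrite vnormZ ger0_norm ?divr_ge0 ?jump_size_ge0 ?vnorm_ge0//.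
have [->|v0] := eqVneq (vnorm v) 0; first by rewrite mulr0 jump_size_ge0.
by rewrite mulfVK.
Qed.

Lemma jump_vopp x e u v : jump x e u (vopp v) = vopp (jump x e u v).
Proof.
apply: eq_from_tnth => i; rewrite /jump /jump_size vnormN.
by rewrite tnth_vopp !tnth_vscale tnth_vopp mulrN.
Qed.

Lemma measurable_jump d' (Om : measurableType d') (x e u : Om -> R) (v : Om -> n.-tuple R) :
  measurable_fun setT x -> measurable_fun setT e -> measurable_fun setT u ->
  measurable_fun setT v -> measurable_fun setT (fun w => jump (x w) (e w) (u w) (v w)).
Proof.
move=> mx me mu mv.
have mpow (r : R) (f : Om -> R) : measurable_fun setT f -> measurable_fun setT (fun w => f w `^ r).
  by move=> mf; exact: (measurableT_comp (measurable_powR r) mf).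
have mn : measurable_fun setT (fun w => vnorm (v w)).
  exact: (measurableT_comp measurable_vnorm mv).
have mV (f : Om -> R) : (forall w, 0 <= f w) -> measurable_fun setT f ->
    measurable_fun setT (fun w => (f w)^-1).
  move=> f0 mf; rewrite (_ : (fun w => _) = (fun w => f w `^ (-1))); first exact: mpow.
  by apply/funext => w; rewrite powR_inv1.
apply: measurable_vscale => //; apply: measurable_funM; last first.
  by apply: mV => // w; exact: vnorm_ge0.
apply: measurable_minr.
  apply: mpow; apply: measurable_funM => //; exact: measurable_funM.
apply: measurable_funM; first by apply: measurable_funM; exact: mpow.
by apply: mV => [w|]; [exact: powR_ge0|exact: mpow].
Qed.

(* Continuity in the arrival time away from 0; at 0 the power takes the junk value 0. *)
Lemma continuous_jump (x e u : R) v i : 0 < x ->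
  {for x, continuous (fun y => tnth (jump y e u v) i)}.
Proof.
move=> x0.
rewrite (_ : (fun y => _) = (fun y => jump_size y e u v * (tnth v i / vnorm v))); last first.
  by apply/funext => y; rewrite tnth_vscale; ring.
apply: cvgM; last exact: cvg_cst.
apply: (@continuous_min _ _ (fun y => (alpha * y / (sig * T)) `^ (- alpha^-1))
  (fun=> e `^ p^-1 * u `^ alpha^-1 / vnorm v `^ p^-1)); last exact: cvg_cst.
apply: (@continuous_comp _ _ _ (fun y => alpha * y / (sig * T)) (fun z => z `^ (- alpha^-1))).
  apply: cvgM; last exact: cvg_cst.
  by apply: cvgM; [exact: cvg_cst|exact: cvg_id].
apply: differentiable_continuous; apply/derivable1_diffP; apply: derivable_powR.
by rewrite in_itv/= andbT divr_gt0// mulr_gt0.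
Qed.

End jumps.

(** A block sum as a function of a time threshold changes only at the times [tm i]. A maximum over
    all thresholds thus reduces to finitely many, which keeps the event measurable. *)
Definition max_event {R : realType} (N : nat) {Z : Type} (a : R)
    (tm x : 'I_N -> Z -> R) : set Z :=
  [set z | exists k i : 'I_N,
    a < `|\sum_(j < N | (j <= k)%N && (tm j z <= tm i z)) x j z|].

Lemma indic_max_event {R : realType} (N : nat) (Z Z' : Type) (a : R)
    (tm x : 'I_N -> Z -> R) (tm' x' : 'I_N -> Z' -> R) z z' :
  (forall j, tm j z = tm' j z') -> (forall j, x j z = x' j z') ->
  \1_(max_event a tm x) z = \1_(max_event a tm' x') z' :> R.
Proof.
move=> et ex; rewrite !indicE; congr (_%:R); congr (nat_of_bool _).
have E k i : \sum_(j < N | (j <= k)%N && (tm j z <= tm i z)) x j z =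
    \sum_(j < N | (j <= k)%N && (tm' j z' <= tm' i z')) x' j z'.
  by apply: eq_big => [j|j _]; rewrite ?et ?ex.
by apply/idP/idP; rewrite !inE => -[k [i h]]; exists k, i; move: h; rewrite E.
Qed.

Lemma measurable_max_event {R : realType} (N : nat) d (Z : measurableType d) (a : R)
    (tm x : 'I_N -> Z -> R) : (forall j, measurable_fun setT (tm j)) ->
  (forall j, measurable_fun setT (x j)) -> measurable (max_event a tm x).
Proof.
move=> mtm mx.
rewrite (_ : max_event a tm x = \bigcup_(k in [set: 'I_N]) \bigcup_(i in [set: 'I_N]) [set z |
    a < `|\sum_(j < N) (if (j <= k)%N && (tm j z <= tm i z) then x j z else 0)|]); last first.
  apply/seteqP; split => z.
    by move=> [k [i h]]; exists k => //; exists i => //=; rewrite -big_mkcond.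
  by move=> [k _ [i _ /= h]]; exists k, i; rewrite big_mkcond.
apply: fin_bigcup_measurable => // k _; apply: fin_bigcup_measurable => // i _.
have mg : measurable_fun setT (fun z => `|\sum_(j < N)
    (if (j <= k)%N && (tm j z <= tm i z) then x j z else 0)|); last first.
  have := measurable_fun_ltr (measurable_cst a) mg => /(_ measurableT [set true] I).
  by rewrite setTI.
apply: measurableT_comp => //.
apply: (@measurable_sum _ Z R setT _ (index_enum 'I_N)
  (fun j z => if (j <= k)%N && (tm j z <= tm i z) then x j z else 0)) => j.
case: (j <= k)%N => //=.
by apply: measurable_fun_ifT => //; exact: measurable_fun_ler.
Qed.

Lemma RE_sym {R : realType} n (QV : probability (n.-tuple R) R) :
  (forall A, measurable A -> QV (vopp @^-1` A) = QV A) ->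
  forall h : n.-tuple R -> R, bmf h -> \int[QV]_v h (vopp v) = \int[QV]_v h v.
Proof.
move=> sym h bh; congr fine.
have bho : bmf (fun v => h (vopp v)) := bmf_comp (@measurable_vopp R n) bh.
pose vo : {mfun n.-tuple R >-> n.-tuple R} :=
  HB.pack (@vopp R n) (isMeasurableFun.Build _ _ _ _ _ (@measurable_vopp R n)).
transitivity (\int[distribution QV vo]_v (h v)%:E)%E.
  rewrite integral_pushforward//; first by apply/measurable_EFinP; case: bh.
  exact: (bmf_integrable QV bho).
by apply: eq_measure_integral => A mA _; exact: sym.
Qed.

Section block.
Context {R : realType} {n : nat} d (Om : measurableType d) (P : probability Om R).
Local Notation mR := (measurableTypeR R).
Variables (E E' Tt U : nat -> {RV P >-> R}) (V : nat -> {RV P >-> n.-tuple R}).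
Variables (QV : probability (n.-tuple R) R).
Hypothesis lV : forall j (A : set (n.-tuple R)), measurable A ->
  distribution P (V j) A = QV A.
Hypothesis indep : mutually_independent P (ts_events E E' Tt U V).
Variables (alpha p T sig : R).
Hypotheses (a0 : 0 < alpha) (p0 : 0 < p) (T0 : 0 < T) (sig0 : 0 < sig).
Variable i0 : 'I_n.

Local Notation F := (ts_events E E' Tt U V).
Local Notation tau := (arrival (fun j => E' j)).

(* The [i0]-coordinate of the j-th jump, cut off on the event that the arrival
   time is atypically small, so that it is bounded by a constant. *)
Definition cut_jump (j : nat) (w : Om) (v : n.-tuple R) : R :=
  (if (0 < Tt j w) && (j.+1%:R / 4 <= tau j.+1 w) then
   tnth (jump alpha p T sig (tau j.+1 w) (E j w) (U j w) v) i0 else 0).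

Definition cut_bound (j : nat) : R := (alpha * (j.+1%:R / 4) / (sig * T)) `^ (- alpha^-1).

Lemma cut_jump_le j w v : `|cut_jump j w v| <= cut_bound j.
Proof.
rewrite /cut_jump; case: ifPn => [/andP[_ h]|_]; last by rewrite normr0 powR_ge0.
apply: (le_trans (coord_le_vnorm _ _)); apply: (le_trans (vnorm_jump_le _ _ _ _ _ _ _ _)).
rewrite /cut_bound !powRN lef_pV2 ?posrE ?powR_gt0 ?divr_gt0 ?mulr_gt0//; last first.
  by rewrite (lt_le_trans _ h)// divr_gt0.
apply: ge0_ler_powR; rewrite ?nnegrE ?invr_ge0 ?(ltW a0)//.
- by rewrite divr_ge0// ?mulr_ge0// ?divr_ge0 ?ltW.
- by rewrite divr_ge0// ?mulr_ge0// ?(le_trans _ h) ?divr_ge0 ?ltW.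
- by rewrite ler_pM2r ?invr_gt0 ?mulr_gt0// ler_pM2l.
Qed.

Lemma cut_jump_vopp j w v : cut_jump j w (vopp v) = - cut_jump j w v.
Proof. by rewrite /cut_jump; case: ifP => _; rewrite ?oppr0// jump_vopp tnth_vopp. Qed.

Let mcut (J : set ('I_5 * nat)) d' (Z : measurableType d')
    (pr : Z -> g_sigma_algebraType (pisys F J)) (v : Z -> n.-tuple R) j :
  (forall i, J (@ix 0 isT i) /\ J (@ix 1 isT i) /\ J (@ix 2 isT i) /\ J (@ix 3 isT i)) ->
  measurable_fun setT pr -> measurable_fun setT v ->
  measurable_fun setT (fun z => cut_jump j (pr z) (v z)).
Proof.
move=> hJ mpr mv.
have mE : measurable_fun setT (fun z => E j (pr z)).
  exact: (measurableT_comp (@msub_E _ _ _ _ P E E' Tt U V J j (hJ j).1) mpr).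
have mT : measurable_fun setT (fun z => Tt j (pr z)).
  exact: (measurableT_comp (@msub_T _ _ _ _ P E E' Tt U V J j (hJ j).2.2.1) mpr).
have mU : measurable_fun setT (fun z => U j (pr z)).
  exact: (measurableT_comp (@msub_U _ _ _ _ P E E' Tt U V J j (hJ j).2.2.2) mpr).
have mtau : measurable_fun setT (fun z => tau j.+1 (pr z)).
  apply: (@measurable_sum _ Z R setT _ (index_enum 'I_j.+1) (fun i z => E' i (pr z))) => i.
  exact: (measurableT_comp (@msub_E' _ _ _ _ P E E' Tt U V J i (hJ i).2.1) mpr).
apply: measurable_fun_ifT => //.
  apply: measurable_and; [exact: measurable_fun_ltr|exact: measurable_fun_ler].
apply: (measurableT_comp (measurable_tnth i0)).
exact: measurable_jump.
Qed.

Variable N : nat.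
Let xs (e : {ffun 'I_N -> bool}) (l : 'I_N) w := rsign e l * cut_jump (N + l) w (V (N + l) w).
Let tm (l : 'I_N) w := Tt (N + l) w.

Let mxs e l : measurable_fun setT (xs e l).
Proof.
apply: measurable_funM => //.
pose pr : Om -> g_sigma_algebraType (pisys F setT) := id.
have mpr : measurable_fun setT pr.
  by move=> _ B mB; rewrite setTI; apply: (g_sigma_sub _ mB);
    exact: (pisys_measurable (@ts_events_measurable _ _ _ _ P E E' Tt U V)).
by apply: (mcut (pr := pr)) => //; exact: measurable_funP.
Qed.

Lemma measurable_cut_event a e : measurable (max_event a tm (xs e)).
Proof. by apply: measurable_max_event => // j; exact: measurable_funP. Qed.

Definition flip_at (l : 'I_N) (e : {ffun 'I_N -> bool}) : {ffun 'I_N -> bool} :=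
  [ffun m => if m == l then ~~ e m else e m].

Hypothesis sym : forall A, measurable A -> QV (vopp @^-1` A) = QV A.

(** Neither the cut-off nor the size of a jump sees the sign of [V], so reversing [V (N + l)]
    reverses this one summand. With all other variables frozen, the symmetry of [QV] leaves the
    probability unchanged. *)
Lemma max_event_flip a e l :
  \int[P]_w \1_(max_event a tm (xs (flip_at l e))) w =
  \int[P]_w (\1_(max_event a tm (xs e)) w : R).
Proof.
pose J := [set i : 'I_5 * nat | i != @ix 4 isT (N + l)%N].
have nJ : ~ J (@ix 4 isT (N + l)%N) by rewrite /J/= eqxx.
pose Z := (g_sigma_algebraType (pisys F J) * n.-tuple R)%type.
have hJ : forall i, J (@ix 0 isT i) /\ J (@ix 1 isT i) /\ J (@ix 2 isT i) /\ J (@ix 3 isT i).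
  by move=> i; rewrite /J/=; do !split.
pose xv (m : 'I_N) (z : Z) := rsign e m *
  (if m == l then cut_jump (N + m) z.1 z.2 else cut_jump (N + m) z.1 (V (N + m) z.1)).
pose tv (m : 'I_N) (z : Z) := Tt (N + m) z.1.
have mtv m : measurable_fun setT (tv m).
  exact: (measurableT_comp (@msub_T _ _ _ _ P E E' Tt U V J (N + m) isT) measurable_fst).
have mxv m : measurable_fun setT (xv m).
  apply: measurable_funM => //; rewrite /xv.
  have [ml|ml] := eqVneq m l; first by apply: (mcut (pr := fst)).
  have Jm : J (@ix 4 isT (N + m)%N).
    rewrite /J/=; apply/eqP => -[/addnI/val_inj ml'].
    by rewrite ml' eqxx in ml.
  apply: (mcut (pr := fst)) => //.
  exact: (measurableT_comp (@msub_V _ _ _ _ P E E' Tt U V J (N + m) Jm) measurable_fst).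
have mM : measurable (max_event a tv xv) by exact: measurable_max_event.
have bf : bmf (fun z : Z => \1_(max_event a tv xv) z : R) by exact: bmf_indic.
have mflip : measurable_fun setT (fun z : Z => (z.1, vopp z.2) : Z).
  apply: measurable_fun_pair => //.
  exact: (measurableT_comp (@measurable_vopp R n)).
have bf' : bmf (fun z : Z => \1_(max_event a tv xv) (z.1, vopp z.2) : R).
  exact: (bmf_comp mflip bf).
have pm := @pisys_measurable _ _ _ _ (@ts_events_measurable _ _ _ _ P E E' Tt U V) J.
have ind := V_indep lV indep nJ.
have fr := freezing pm (measurable_funP (V (N + l)%N)) ind bf.
have fr' := freezing pm (measurable_funP (V (N + l)%N)) ind bf'.
have eq1 w : \1_(max_event a tm (xs e)) w = \1_(max_event a tv xv) (w, V (N + l)%N w) :> R.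
  apply: indic_max_event => // m.
  by rewrite /xs /xv/=; case: eqVneq => [->|].
have eq2 w : \1_(max_event a tm (xs (flip_at l e))) w =
    \1_(max_event a tv xv) (w, vopp (V (N + l)%N w)) :> R.
  have E2 m : xs (flip_at l e) m w = xv m (w, vopp (V (N + l)%N w)).
    rewrite /xs /xv/= /rsign ffunE; case: eqVneq => [->|//].
    by rewrite cut_jump_vopp; case: (e l); rewrite /= ?mulN1r ?mul1r ?opprK.
  exact: indic_max_event.
under eq_Rintegral do rewrite eq2.
under [RHS]eq_Rintegral do rewrite eq1.
rewrite [RHS]fr [LHS]fr'; apply: eq_Rintegral => w _ /=.
apply: (RE_sym sym).
exact: (bmf_comp (pair1_measurable (w : g_sigma_algebraType (pisys F J))) bf).
Qed.

Lemma max_event_sign a e :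
  \int[P]_w \1_(max_event a tm (xs e)) w =
  \int[P]_w (\1_(max_event a tm (xs [ffun=> true])) w : R).
Proof.
(* [em m] has the signs of [e] below [m] and plus signs from [m] on, so consecutive patterns differ
   in at most one sign. *)
pose em m : {ffun 'I_N -> bool} := [ffun l : 'I_N => if (l < m)%N then e l else true].
have -> : e = em N by apply/ffunP => l; rewrite ffunE ltn_ord.
suff H m : (m <= N)%N -> \int[P]_w \1_(max_event a tm (xs (em m))) w =
    \int[P]_w (\1_(max_event a tm (xs [ffun=> true])) w : R) by exact: H.
elim: m => [_|m ih mN].
  by have -> : em 0%N = [ffun=> true] by apply/ffunP => l; rewrite !ffunE.
rewrite -ih ?(ltnW mN)//; pose l := Ordinal mN.
have [el|el] := boolP (e l).
  suff -> : em m.+1 = em m by [].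
  apply/ffunP => j; rewrite !ffunE ltnS leq_eqVlt.
  case: eqVneq => //= jm; have -> : j = l by exact: val_inj.
  by rewrite el; case: ifP.
rewrite -(max_event_flip a (em m) l).
suff -> : em m.+1 = flip_at l (em m) by [].
apply/ffunP => j; rewrite !ffunE ltnS leq_eqVlt -val_eqE/=.
case: eqVneq => //= jm; have -> : j = l by exact: val_inj.
by rewrite ltnn (negbTE el).
Qed.

(** The probability is the same for all sign patterns, so it equals its average over them. Inside
    the expectation the variables are fixed and the average is a count, bounded by Levy's inequality
    and then Chebyshev's. *)
Lemma max_event_prob (a b : R) : 0 < a -> 0 <= b ->
  (forall l : 'I_N, cut_bound (N + l) <= b) ->
  (\int[P]_w \1_(max_event a tm (xs [ffun=> true])) w) * a ^+ 2 <= 4 * (N%:R * b ^+ 2).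
Proof.
move=> ap b0 hb.
pose pr := \int[P]_w (\1_(max_event a tm (xs [ffun=> true])) w : R).
pose C : R := #|{ffun 'I_N -> bool}|%:R.
rewrite -[X in X * _]/pr.
have C0 : 0 < C.
  by rewrite /C ltr0n; apply/card_gt0P; exists [ffun=> true].
have CE : C * pr = \int[P]_w (\sum_(e : {ffun 'I_N -> bool}) \1_(max_event a tm (xs e)) w).
  rewrite RE_sum; last by move=> e; apply: bmf_indic; exact: measurable_cut_event.
  under eq_bigr do rewrite max_event_sign.
  by rewrite sumr_const -[RHS]mulr_natl.
rewrite -(ler_pM2l C0) [leLHS]mulrA CE.
have bs : bmf (fun w => \sum_(e : {ffun 'I_N -> bool}) (\1_(max_event a tm (xs e)) w : R)).
  split.
    apply: (@measurable_sum _ Om R setT _ (index_enum {ffun 'I_N -> bool})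
      (fun e => \1_(max_event a tm (xs e)))) => e.
    by case: (bmf_indic R (measurable_cut_event a e)).
  exists C => w; rewrite /C -sum1_card natr_sum (le_trans (ler_norm_sum _ _ _))//.
  apply: ler_sum => e _; rewrite indicE.
  by case: (_ \in _); rewrite ?normr1 ?normr0.
rewrite mulrC -REZ// -[leRHS](RE_cst P).
apply: le_RE; [by apply: bmfM => //; exact: bmf_cst|exact: bmf_cst|].
move=> w; pose x (l : 'I_N) := cut_jump (N + l) w (V (N + l) w).
(* The first order is the position in the block, the second the jump times. *)
have h1 := @levy_maximal R _ (fun l : 'I_N => l%:R) (tm ^~ w) x a.
have h2 := @rsign_chebyshev R _ x a ap.
rewrite mulrC; apply: (@le_trans _ _
   ((4 * #|[set e : {ffun 'I_N -> bool} | a < `|\sum_j rsign e j * x j|]%SET|)%:R * a ^+ 2)).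
  move: h1; set A := (X in (#|X| <= _)%N) => h1.
  rewrite ler_wpM2r ?sqr_ge0//; apply: (@le_trans _ _ (#|A|%:R)); last by rewrite ler_nat.
  rewrite /A -sum1_card natr_sum [leRHS]big_mkcond/=; apply: ler_sum => e _.
  rewrite indicE; have [|_] := boolP (w \in _); last by case: ifP.
  rewrite inE => -[k [i h]]; rewrite ifT// inE; apply/existsP; exists k; apply/existsP; exists i.
  rewrite (eq_bigl (fun j : 'I_N => (j <= k)%N && (tm j w <= tm i w)))//.
  by move=> j; rewrite ler_nat.
rewrite natrM -mulrA [leRHS]mulrCA ler_wpM2l//.
apply: (le_trans h2); rewrite ler_wpM2l ?(ltW C0)//.
apply: (@le_trans _ _ (\sum_(j < N) b ^+ 2)).
  apply: ler_sum => l _; rewrite -[leLHS]real_normK ?num_real// lerXn2r ?nnegrE//.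
  by rewrite (le_trans (cut_jump_le _ _ _)).
by rewrite sumr_const card_ord -[leLHS]mulr_natl.
Qed.

Lemma not_max_event (a : R) w : 0 <= a -> ~ max_event a tm (xs [ffun=> true]) w ->
  forall m t, (m <= N)%N ->
  `|\sum_(N <= j < N + m) (if Tt j w <= t then cut_jump j w (V j w) else 0)| <= a.
Proof.
move=> a_ge0 nev m t mN.
rewrite -[X in \sum_(X <= _ < _) _]add0n big_addn addKn big_mkord.
case: m mN => [|m] mN; first by rewrite big_ord0 normr0.
rewrite -big_mkcond/=.
have [/existsP[l0 hl0]|/existsPn no] := boolP [exists l : 'I_N, Tt (N + l) w <= t]; last first.
  rewrite big_pred0 ?normr0// => l; apply/negbTE.
  by have := no (widen_ord mN l); rewrite addnC.
(* The threshold [t] is replaced by the largest jump time of the block not exceeding it, among all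
   [N] indices; the same terms are selected. *)
case: (@Order.TotalTheory.arg_maxP _ _ _ l0 (fun l : 'I_N => Tt (N + l) w <= t)
  (fun l : 'I_N => Tt (N + l) w) hl0) => i it imax.
rewrite leNgt; apply/negP => lt; apply: nev; exists (Ordinal mN), i.
apply: (lt_le_trans lt); rewrite le_eqVlt; apply/orP; left; apply/eqP; congr `|_|.
rewrite (big_ord_widen_cond N (fun l => Tt (l + N) w <= t)
  (fun l => cut_jump (l + N) w (V (l + N) w)))//.
apply: eq_big => l; last by move=> _; rewrite /xs /rsign ffunE mul1r addnC.
rewrite /tm ltnS andbC [(l + N)%N]addnC; congr (_ && _).
by apply/idP/idP => [lt'|/le_trans]; [exact: imax|exact].
Qed.

End block.

(** * Almost sure uniform convergence of the series *)

Section convergence.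
Context {R : realType} {n : nat} d (Om : measurableType d) (P : probability Om R).
Local Notation mR := (measurableTypeR R).
Variables (E E' Tt U : nat -> {RV P >-> R}) (V : nat -> {RV P >-> n.-tuple R}).
Variables (QV : probability (n.-tuple R) R).
Hypothesis lE' : forall j (A : set R), measurable A ->
  distribution P (E' j) A = exponential_prob 1 A.
Hypothesis lV : forall j (A : set (n.-tuple R)), measurable A ->
  distribution P (V j) A = QV A.
Hypothesis indep : mutually_independent P (ts_events E E' Tt U V).
Variables (alpha p T sig : R).
Hypotheses (a02 : 0 < alpha < 2) (p0 : 0 < p) (T0 : 0 < T) (sig0 : 0 < sig).
Hypothesis hcase : alpha < 1 \/
  (forall A, measurable A -> QV (vopp @^-1` A) = QV A).

Local Notation tau := (arrival (fun j => E' j)).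
Local Notation term := (ts_term alpha p T sig (fun j => E j) (fun j => E' j)
  (fun j => Tt j) (fun j => U j) (fun j => V j)).
Local Notation partial := (ts_partial alpha p T sig (fun j => E j) (fun j => E' j)
  (fun j => Tt j) (fun j => U j) (fun j => V j)).

Let a0 : 0 < alpha. Proof. by case/andP : a02. Qed.

Lemma tnth_ts_term j t w i : tnth (term j t w) i =
  (if 0 < Tt j w <= t then
   tnth (jump alpha p T sig (tau j.+1 w) (E j w) (U j w) (V j w)) i else 0).
Proof.
rewrite !tnth_vscale indicE; case: ifPn => h.
  by rewrite mem_set// mul1r.
by rewrite memNset ?mul0r//=; exact/negP.
Qed.

(** Constants of the bound [c * rho ^+ k] on the block starting at [2 ^ k]: there the cut-off forces
    arrival times of at least [2 ^ k / 4], and jumps are of the order of their power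
    [- 1 / alpha]. *)
Let c := (alpha / 4 / (sig * T)) `^ (- alpha^-1).
Let rho := 2 `^ (- alpha^-1) : R.

Let rho_gt0 : 0 < rho. Proof. exact: powR_gt0. Qed.
Let c_gt0 : 0 < c. Proof. by rewrite powR_gt0// !divr_gt0// mulr_gt0. Qed.

Let cut_bound_le k l : cut_bound alpha T sig (2 ^ k + l) <= c * rho ^+ k.
Proof.
have pos0 : 0 < alpha / 4 / (sig * T) by rewrite !divr_gt0// mulr_gt0.
have -> : c * rho ^+ k = (alpha / 4 / (sig * T) * 2 ^+ k) `^ (- alpha^-1).
  rewrite powRM ?exprn_ge0//; last exact: ltW.
  by rewrite -(@powR_mulrn _ 2)// powRAC powR_mulrn ?powR_ge0.
have pos1 : 0 < alpha / 4 / (sig * T) * 2 ^+ k by rewrite mulr_gt0 ?exprn_gt0.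
have le1 : alpha / 4 / (sig * T) * 2 ^+ k <= alpha * ((2 ^ k + l).+1%:R / 4) / (sig * T).
  have -> : alpha * ((2 ^ k + l).+1%:R / 4) / (sig * T) =
            alpha / 4 / (sig * T) * (2 ^ k + l).+1%:R.
    by field; rewrite !gt_eqF.
  rewrite ler_wpM2l ?(ltW pos0)//.
  by rewrite -natrX ler_nat (leq_trans (leq_addr l _)).
rewrite /cut_bound !powRN lef_pV2 ?posrE ?powR_gt0//; last exact: lt_le_trans le1.
apply: ge0_ler_powR => //; rewrite ?nnegrE ?invr_ge0 ?(ltW a0) ?(ltW pos1)//.
by rewrite (le_trans (ltW pos1)).
Qed.

Let two_powR (x : R) : x < 0 -> 2 `^ x < 1 :> R.
Proof.
move=> x0; rewrite /powR gt_eqF// expR_lt1 nmulr_rlt0// ln_gt0// ltr1n//.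
Qed.

Section coordinate.
Variable i0 : 'I_n.
Local Notation cut := (cut_jump E E' Tt U alpha p T sig i0).
Local Notation ev k a := (max_event (N := 2 ^ k) a (fun l w => Tt (2 ^ k + l) w)
  (fun l w => rsign [ffun=> true] l * cut (2 ^ k + l)%N w (V (2 ^ k + l) w))).

Let block_ae : exists C q, [/\ 0 <= C, 0 < q < 1 &
  {ae P, forall w, exists K, forall k, (K <= k)%N -> ~ ev k (C * q ^+ k) w}].
Proof.
have mev k a : measurable (ev k a : set Om).
  exact: measurable_cut_event.
case: hcase => [alt1|sym].
  (* For [alpha < 1] absolute values suffice: [2 ^ k] terms of size at most [c rho^k], and
     [2 rho = 2^(1 - 1/alpha) < 1]. *)
  exists c, (2 * rho); split; first exact: ltW.
    rewrite mulr_gt0//= -[X in X * _](@powRr1 _ 2)// -powRD ?pnatr_eq0 ?implybT//.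
    by apply: two_powR; rewrite subr_lt0 invf_gt1.
  apply: aeW => w; exists 0%N => k _ [l [i]]; apply/negP; rewrite -leNgt.
  apply: (le_trans (ler_norm_sum _ _ _)).
  apply: (@le_trans _ _ (\sum_(j < 2 ^ k) c * rho ^+ k)).
    rewrite big_mkcond/=; apply: ler_sum => j _; case: ifPn => _; last first.
      by rewrite mulr_ge0 ?exprn_ge0 ?ltW.
    rewrite /rsign ffunE mul1r; apply: le_trans (cut_bound_le k j).
    exact: cut_jump_le.
  by rewrite sumr_const card_ord -[leLHS]mulr_natl natrX exprMn mulrCA.
(* [r = 2^(1 - 2/alpha)] is the rate of the sum of squares over a block, below 1 because
   [alpha < 2]. *)
pose r := 2 * rho ^+ 2.
have r0 : 0 < r by rewrite mulr_gt0// exprn_gt0.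
have r1 : r < 1.
  rewrite /r expr2 -!powRD ?pnatr_eq0 ?implybT// -[X in X * _](@powRr1 _ 2)//.
  rewrite -powRD ?pnatr_eq0 ?implybT//; apply: two_powR.
  have : 1 < alpha^-1 + alpha^-1.
    by case/andP: a02 => _ a2; rewrite -mulr2n -[_ *+ 2]mulr_natl ltr_pdivlMr// mul1r.
  lra.
(* A fourth root of [r] as rate of the levels: [r / q^2] is then the square root of [r], so levels
   and probabilities are both geometric. *)
pose q := Num.sqrt (Num.sqrt r).
have sr0 : 0 < Num.sqrt r by rewrite sqrtr_gt0.
have sr1 : Num.sqrt r < 1 by rewrite -sqrtr1 ltr_sqrt.
have q0 : 0 < q by rewrite sqrtr_gt0.
have q1 : q < 1 by rewrite -sqrtr1 ltr_sqrt.
exists 1, q; split; rewrite ?q0//.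
apply: (@ae_eventually_geometric _ _ _ P (fun k => ev k (1 * q ^+ k)) (4 * c ^+ 2) (Num.sqrt r)) => //.
- by rewrite mulr_ge0 ?sqr_ge0.
- by rewrite sqrtr_ge0.
move=> k; rewrite mul1r -(fineK (fin_num_measure P _ (mev k _))) lee_fin -RE_indic//.
have := @max_event_prob _ _ _ _ P E E' Tt U V QV lV indep alpha p T sig a0 T0 sig0 i0 (2 ^ k)%N sym
  (q ^+ k) (c * rho ^+ k) (exprn_gt0 _ q0) _ (fun l => cut_bound_le k l).
have cr0 : 0 <= c * rho ^+ k by rewrite mulr_ge0 ?exprn_ge0 ?ltW.
move=> /(_ cr0); set pr := \int[P]_w _ => h.
have qq : (q ^+ k) ^+ 2 = Num.sqrt r ^+ k.
  by rewrite exprAC sqr_sqrtr// ltW.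
rewrite -(ler_pM2r (exprn_gt0 k sr0)) -{1}qq (le_trans h)//.
rewrite -[leRHS]mulrA -exprD addnn -mul2n exprM sqr_sqrtr ?(ltW r0)//.
rewrite /r le_eqVlt; apply/orP; left; apply/eqP.
rewrite natrX !exprMn -exprD addnn -muln2 -!exprM.
by rewrite [X in 4 * X]mulrCA !mulrA.
Qed.

Lemma coordinate_uniform_cauchy : {ae P, forall w, forall eps : R, 0 < eps ->
  exists N, forall k m t, (N <= k)%N -> (N <= m)%N ->
  `|tnth (partial k t w) i0 - tnth (partial m t w) i0| < eps}.
Proof.
have [C [q [C0 q01 h]]] := block_ae.
move: h (arrival_growth lE' indep); apply: filterS2 => w [K1 hK1] [K2 hK2] eps e0.
have blk k m t : (maxn K1 K2 <= k)%N -> (m <= 2 ^ k)%N -> [set: R] t ->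
    `|\sum_(2 ^ k <= j < 2 ^ k + m) tnth (term j t w) i0| <= C * q ^+ k.
  rewrite geq_max => /andP[K1k K2k] mk _.
  have Cq0 : 0 <= C * q ^+ k by rewrite mulr_ge0// exprn_ge0//; case/andP : q01 => /ltW.
  have := not_max_event Cq0 (hK1 k K1k) t mk.
  rewrite (@eq_big_nat _ _ _ _ _ _ (fun j => tnth (term j t w) i0))//.
  move=> j /andP[kj _]; rewrite tnth_ts_term /cut_jump.
  (* Here [j >= 2 ^ k >= k >= K2], so the cut-off is inactive and cut jumps coincide with the true
     terms. *)
  rewrite (_ : j.+1%:R / 4 <= tau j.+1 w = true); last first.
    apply: hK2; rewrite (leq_trans K2k)// (leq_trans _ (leqW kj))//.
    by rewrite ltnW// ltn_expl.
  by rewrite andbT; case: (Tt j w <= t); rewrite ?andbT ?andbF.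
have [N hN] := dyadic_uniform_cauchy C0 q01 blk e0.
exists N => k m t Nk Nm; have := hN k m t Nk Nm I.
by rewrite /ts_partial !tnth_vsum !big_mkord.
Qed.

End coordinate.

Lemma series_uniform_cauchy : {ae P, forall w, forall (i : 'I_n) (eps : R), 0 < eps ->
  exists N, forall k m t, (N <= k)%N -> (N <= m)%N ->
  `|tnth (partial k t w) i - tnth (partial m t w) i| < eps}.
Proof.
case: (posnP n) => [n0|n0].
  by apply: aeW => w i; have := ltn_ord i; rewrite {2}n0.
(* Almost sure statements are gathered over [nat], so coordinates are enumerated by naturals with a
   default value. *)
pose i' k : 'I_n := insubd (Ordinal n0) k.
have : {ae P, forall w, forall (k : nat) (eps : R), 0 < eps ->
  exists N, forall k' m t, (N <= k')%N -> (N <= m)%N ->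
  `|tnth (partial k' t w) (i' k) - tnth (partial m t w) (i' k)| < eps}.
  by apply: ae_foralln => k; exact: coordinate_uniform_cauchy.
apply: filterS => w h i; have := h i.
by rewrite /i' valKd.
Qed.

End convergence.

(** * Path properties of the limit process *)

Section uniform_limit_paths.
Context {R : realType} {n : nat}.
Implicit Types s : nat -> R -> n.-tuple R.

Definition uniform_cauchy s := forall (i : 'I_n) (eps : R), 0 < eps ->
  exists N, forall k m t, (N <= k)%N -> (N <= m)%N ->
  `|tnth (s k t) i - tnth (s m t) i| < eps.

(** The upper limit is defined for every outcome and measurable in it, and is the limit where the
    sums converge; the process needs no exceptional set in its definition. *)
Definition limit_path s (t : R) : n.-tuple R :=
  [tuple fine (limn_esup (fun k => (tnth (s k t) i)%:E)) | i < n].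

Lemma limit_path_cvg s t i : uniform_cauchy s ->
  tnth (s k t) i @[k --> \oo] --> tnth (limit_path s t) i.
Proof.
move=> uc.
have cv : cvgn (fun k => tnth (s k t) i).
  apply: cauchy_cvg; apply: cauchy_exP => e e0.
  have [N hN] := uc i e e0; exists (tnth (s N t) i).
  by exists N => // k /= Nk; apply: hN.
rewrite tnth_mktuple is_cvg_limn_esupE; last first.
  by apply/cvg_ex; exists (limn (fun k => tnth (s k t) i))%:E; apply: cvg_EFin => //; exact: nearW.
by rewrite EFin_lim.
Qed.

Lemma limit_path_unif s : uniform_cauchy s -> forall eps : R, 0 < eps ->
  exists N, forall k t, (N <= k)%N -> vnorm (vsub (s k t) (limit_path s t)) < eps.
Proof.
move=> uc eps e0.
have e1 : 0 < eps / n.+1%:R / 2 by rewrite !divr_gt0.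
have /choice[N hN] := fun i => uc i _ e1.
exists (\max_(i < n) N i)%N => k t Nk; apply: vnorm_lt_coord => // i.
have Nik : (N i <= k)%N by rewrite (leq_trans _ Nk)// leq_bigmax.
apply: (@le_lt_trans _ _ (eps / n.+1%:R / 2)); last first.
  by rewrite ltr_pdivrMr// ltr_pMr ?divr_gt0// ltr1n.
have := @limit_path_cvg s t i uc.
move=> cv; rewrite tnth_vsub.
have cv2 : `|tnth (s k t) i - tnth (s m t) i| @[m --> \oo] -->
    `|tnth (s k t) i - tnth (limit_path s t) i|.
  by apply: cvg_norm; apply: cvgB => //; exact: cvg_cst.
rewrite -(cvg_lim _ cv2)//; apply: limr_le; first by apply/cvg_ex; eexists; exact: cv2.
by exists (N i) => // m /= Nm; apply: ltW; exact: hN.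
Qed.

Let dist3 (a b c e x : R) : `|a - b| < x / 3 -> `|c - e| < x / 3 -> b = c -> `|a - e| < x.
Proof.
move=> h1 h2 bc; rewrite bc in h1.
have -> : a - e = (a - c) + (c - e) by ring.
have x0 : 0 < x / 3 by apply: le_lt_trans h1.
apply: (le_lt_trans (ler_normD _ _)); lra.
Qed.

(** How regularity reaches the limit: partial sums are step functions of time, so equality of a
    single one of them at two times is what will be available. *)
Lemma limit_path_close s : uniform_cauchy s ->
  forall eps : R, 0 < eps ->
  exists k, forall t t', s k t = s k t' -> vnorm (vsub (limit_path s t) (limit_path s t')) < eps.
Proof.
move=> uc eps e0.
have e3 : 0 < eps / n.+1%:R / 3 by rewrite !divr_gt0.
have [k hk] := limit_path_unif uc e3; exists k => t t' e.
apply: vnorm_lt_coord => // i; rewrite tnth_vsub.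
have c u : `|tnth (s k u) i - tnth (limit_path s u) i| < eps / n.+1%:R / 3.
  by rewrite -tnth_vsub (le_lt_trans (coord_le_vnorm _ _))// hk.
apply: (@dist3 _ (tnth (s k t) i) (tnth (s k t') i)); rewrite ?e//.
by rewrite distrC -e.
Qed.

(* The left limit of the limit path is the limit of the left limits. *)
Lemma limit_path_left s (t : R) : uniform_cauchy s ->
  (forall k, exists l delta, 0 < delta /\ forall u, t - delta < u < t -> s k u = l) ->
  exists l, forall eps : R, 0 < eps -> exists2 delta : R, 0 < delta &
    forall u, t - delta < u < t -> vnorm (vsub (limit_path s u) l) < eps.
Proof.
move=> uc /choice[l /choice[dl hl]].
(* The left limits as constant paths, so that the results on limit paths apply to them. *)
pose s' k (_ : R) := l k.
have uc' : uniform_cauchy s'.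
  move=> i eps e0; have [N hN] := uc i eps e0; exists N => k m u Nk Nm.
  (* A point so close to [t] that both partial sums already take their left limits there. *)
  pose v := t - (Num.min (dl k) (dl m)) / 2.
  have [dk hk] := hl k; have [dm hm] := hl m.
  have mn0 : 0 < Num.min (dl k) (dl m) by rewrite lt_min dk dm.
  have mnk : Num.min (dl k) (dl m) <= dl k by rewrite ge_min lexx.
  have mnm : Num.min (dl k) (dl m) <= dl m by rewrite ge_min lexx orbT.
  rewrite /s' -(hk v) -?(hm v); first exact: hN.
    by rewrite /v; apply/andP; split; lra.
  by rewrite /v; apply/andP; split; lra.
exists (limit_path s' 0) => eps e0.
have e3 : 0 < eps / n.+1%:R / 3 by rewrite !divr_gt0.
have [k1 hk1] := limit_path_unif uc e3; have [k2 hk2] := limit_path_unif uc' e3.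
pose k := maxn k1 k2; have [dk hk] := hl k.
exists (dl k) => // u /hk su; apply: vnorm_lt_coord => // i; rewrite tnth_vsub.
apply: (@dist3 _ (tnth (s k u) i) (tnth (s' k 0) i)).
- by rewrite distrC -tnth_vsub (le_lt_trans (coord_le_vnorm _ _))// hk1// leq_maxl.
- by rewrite -tnth_vsub (le_lt_trans (coord_le_vnorm _ _))// hk2// leq_maxr.
- by rewrite su.
Qed.

End uniform_limit_paths.

Section limit_process.
Context {R : realType} {n : nat} d (Om : measurableType d) (P : probability Om R).
Variables (E E' Tt U : nat -> {RV P >-> R}) (V : nat -> {RV P >-> n.-tuple R}).
Variables (alpha p T sig : R).
Hypothesis hT : 0 < T.
Hypothesis lT : forall j (A : set R), measurable A ->
  distribution P (Tt j) A = uniform_prob hT A.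

Local Notation term := (ts_term alpha p T sig (fun j => E j) (fun j => E' j)
  (fun j => Tt j) (fun j => U j) (fun j => V j)).
Local Notation partial := (ts_partial alpha p T sig (fun j => E j) (fun j => E' j)
  (fun j => Tt j) (fun j => U j) (fun j => V j)).

Definition ts_limit (t : R) (w : Om) : n.-tuple R :=
  limit_path (fun k t => partial k t w) t.
Local Notation L := ts_limit.

Let mtau j : measurable_fun setT (fun w => arrival (fun j => E' j) j w).
Proof.
apply: (@measurable_sum _ Om R setT _ (index_enum 'I_j) (fun i => E' i)) => i.
exact: measurable_funP.
Qed.

Lemma measurable_partial_coord k t i : measurable_fun setT (fun w => tnth (partial k t w) i).
Proof.
rewrite (_ : (fun w => _) = (fun w => \sum_(j < k) tnth (term j t w) i)); last first.
  by apply/funext => w; rewrite tnth_vsum.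
apply: (@measurable_sum _ Om R setT _ (index_enum 'I_k) (fun j w => tnth (term j t w) i)) => j.
rewrite (_ : (fun w => _) = (fun w => if 0 < Tt j w <= t then
   tnth (jump alpha p T sig (arrival (fun j => E' j) j.+1 w) (E j w) (U j w) (V j w)) i else 0)); last first.
  by apply/funext => w; rewrite tnth_ts_term.
apply: measurable_fun_ifT => //.
  by apply: measurable_and; [apply: measurable_fun_ltr|apply: measurable_fun_ler] => //;
    exact: measurable_funP.
apply: (measurableT_comp (measurable_tnth i)).
by apply: measurable_jump => //; exact: measurable_funP.
Qed.

Lemma measurable_ts_limit t : measurable_fun setT (L t).
Proof.
apply: measurable_fun_coord => i.
rewrite (_ : (fun w => _) = (fun w => fine (limn_esup (fun k => (tnth (partial k t w) i)%:E)))); last first.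
  by apply/funext => w; rewrite tnth_mktuple.
apply: (@measurableT_comp _ _ _ _ _ _ (@fine R)) => //.
apply: (@measurable_fun_limn_esup _ _ _ setT (fun k w => (tnth (partial k t w) i)%:E)) => k.
by apply/measurable_EFinP; exact: measurable_partial_coord.
Qed.

Section path.
Variable w : Om.

Let partialS k u : partial k.+1 u w = vadd (partial k u w) (term k u w).
Proof.
apply: eq_from_tnth => i.
by rewrite tnth_vadd /ts_partial !tnth_vsum big_ord_recr.
Qed.

(** [D dl u] stands for membership of [u] in a one- or two-sided neighbourhood of size [dl];
    finitely many terms, each locally constant there, admit a common [dl]. *)
Let partial_local (D : R -> R -> Prop) : (forall dl dl' u, dl <= dl' -> D dl u -> D dl' u) ->
  (forall j, exists l dl, 0 < dl /\ forall u, D dl u -> term j u w = l) ->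
  forall k, exists l dl, 0 < dl /\ forall u, D dl u -> partial k u w = l.
Proof.
move=> mono h; elim=> [|k [l [dl [dl0 hl]]]].
  by exists vzero, 1; split => // u _; rewrite /ts_partial big_ord0.
have [l' [dl' [dl0' hl']]] := h k.
exists (vadd l l'), (Num.min dl dl'); split; first by rewrite lt_min dl0 dl0'.
move=> u Du; rewrite partialS hl ?hl'//; apply: mono Du.
  by rewrite ge_min lexx orbT.
by rewrite ge_min lexx.
Qed.

Let term_eq j u v : (Tt j w <= u) = (Tt j w <= v) -> term j u w = term j v w.
Proof. by move=> e; apply: eq_from_tnth => i; rewrite !tnth_ts_term e. Qed.

Let term_late j u v : u < v -> v <= Tt j w -> term j u w = vzero.
Proof.
move=> uv vT; apply: eq_from_tnth => i; rewrite tnth_ts_term tnth_vzero.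
by rewrite [X in _ && X]leNgt (lt_le_trans uv vT) andbF.
Qed.

Lemma partial_right k t : exists2 dl : R, 0 < dl &
  forall u, t <= u < t + dl -> partial k u w = partial k t w.
Proof.
have [||l [dl [dl0 hl]]] := @partial_local (fun dl u => t <= u < t + dl) _ _ k.
- move=> dl dl' u dd /andP[tu ut]; rewrite tu/=; apply: (lt_le_trans ut).
  by rewrite lerD2l.
- move=> j; have [jt|tj] := leP (Tt j w) t.
    exists (term j t w), 1; split => // u /andP[tu _]; apply: term_eq.
    by rewrite jt (le_trans jt tu).
  exists (term j t w), (Tt j w - t); split; first by rewrite subr_gt0.
  move=> u /andP[tu]; rewrite addrC subrK => uT; apply: term_eq.
  by rewrite !leNgt uT tj.
- by exists dl => // u hu; rewrite hl// hl// lexx ltrDl.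
Qed.

Lemma partial_left k t : exists l dl, 0 < dl /\
  forall u, t - dl < u < t -> partial k u w = l.
Proof.
apply: (@partial_local (fun dl u => t - dl < u < t)) => [dl dl' u dd|j].
  by move=> /andP[tu ->]; rewrite andbT (le_lt_trans _ tu)// lerD2l lerN2.
have [tj|jt] := leP t (Tt j w).
  by exists vzero, 1; split => // u /andP[_ ut]; exact: (term_late ut).
exists (term j t w), (t - Tt j w); split; first by rewrite subr_gt0.
move=> u /andP[]; rewrite subKr => ju ut; apply: term_eq.
by rewrite (ltW ju) (ltW jt).
Qed.

Lemma partial_cont k t : (forall j, Tt j w != t) -> exists2 dl : R, 0 < dl &
  forall u, `|u - t| < dl -> partial k u w = partial k t w.
Proof.
move=> nt.
have [||l [dl [dl0 hl]]] := @partial_local (fun dl u => `|u - t| < dl) _ _ k.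
- by move=> dl dl' u dd h; exact: lt_le_trans dd.
- move=> j; exists (term j t w), `|Tt j w - t|; split; first by rewrite normr_gt0 subr_eq0.
  move=> u hu; apply: term_eq; move: hu; have [jt|tj|jt] := ltgtP (Tt j w) t.
  + rewrite [X in _ < X]ltr0_norm ?subr_lt0// opprB => /ltr_normlP[h1 _].
    by apply/idP; lra.
  + rewrite [X in _ < X]gtr0_norm ?subr_gt0// => /ltr_normlP[_ h1].
    by apply/negbTE; rewrite -ltNge; lra.
  + by move: (nt j); rewrite jt eqxx.
- by exists dl => // u hu; rewrite hl// hl// subrr normr0.
Qed.

(** Valid for every outcome, convergent or not: at time 0 each term carries the indicator of an
    empty interval. *)
Lemma ts_limit0 : L 0 w = vzero.
Proof.
apply: eq_from_tnth => i; rewrite tnth_mktuple tnth_vzero.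
rewrite (_ : (fun k => _) = (fun=> 0%E)); last first.
  apply/funext => k; rewrite tnth_vsum big1// => j _; rewrite tnth_ts_term.
  by case: ifPn => // /andP[h1 h2]; have := lt_le_trans h1 h2; rewrite ltxx.
have h : (fun=> 0%E : \bar R) @ \oo --> (0%E : \bar R) by exact: cvg_cst.
rewrite is_cvg_limn_esupE; first by rewrite (cvg_lim _ h).
by apply/cvg_ex; exists 0%E.
Qed.

Hypothesis uc : uniform_cauchy (fun k t => partial k t w).

Lemma ts_limit_right t : forall eps : R, 0 < eps ->
  exists2 delta : R, 0 < delta & forall s, t <= s < t + delta ->
  vnorm (vsub (L s w) (L t w)) < eps.
Proof.
move=> eps e0; have [k hk] := limit_path_close uc e0.
by have [dl dl0 hdl] := partial_right k t; exists dl => // s hs; apply: hk; exact: hdl.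
Qed.

Lemma ts_limit_left t : exists l, forall eps : R, 0 < eps ->
  exists2 delta : R, 0 < delta & forall s, t - delta < s < t ->
  vnorm (vsub (L s w) l) < eps.
Proof. by apply: (limit_path_left uc) => k; exact: partial_left. Qed.

Lemma ts_limit_cont t : (forall j, Tt j w != t) -> forall eps : R, 0 < eps ->
  exists2 delta : R, 0 < delta & forall s, `|s - t| < delta ->
  vnorm (vsub (L s w) (L t w)) < eps.
Proof.
move=> nt eps e0; have [k hk] := limit_path_close uc e0.
by have [dl dl0 hdl] := partial_cont k nt; exists dl => // s hs; apply: hk; exact: hdl.
Qed.

End path.

Hypothesis ucs : {ae P, forall w, uniform_cauchy (fun k t => partial k t w)}.

Lemma Tt_neq t : {ae P, forall w, forall j, Tt j w != t}.
Proof.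
apply: ae_foralln => j; exists (Tt j @^-1` [set t]); split.
- by rewrite -[X in measurable X]setTI; exact: (measurable_funP (Tt j)).
- apply: (etrans (lT j (measurable_set1 t))).
  by rewrite /uniform_prob integral_set1.
- by move=> w /= /negP; rewrite negbK => /eqP.
Qed.

Lemma measurable_increment t s : measurable_fun setT (fun w => vsub (L t w) (L s w)).
Proof.
apply: measurable_fun_coord => i.
rewrite (_ : (fun w => _) = (fun w => tnth (L t w) i - tnth (L s w) i)); last first.
  by apply/funext => w; rewrite tnth_vsub.
apply: measurable_funB; apply: (measurableT_comp (measurable_tnth i));
  exact: measurable_ts_limit.
Qed.

(** A fixed [t] is almost surely not a jump time, so almost every path is continuous at [t].
    Dominated convergence along a sequence chosen by contradiction gives convergence in
    probability. *)
Lemma ts_limit_stoch_cont t eps eta : 0 < eps -> 0 < eta ->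
  exists2 delta : R, 0 < delta & forall s, `|s - t| < delta ->
  (P [set w | (eps < vnorm (vsub (L s w) (L t w)))%R] < eta%:E)%E.
Proof.
move=> e0 eta0; apply: contrapT => no.
have ex k : exists s, `|s - t| < k.+1%:R^-1 /\
    (eta%:E <= P [set w | (eps < vnorm (vsub (L s w) (L t w)))%R])%E.
  apply: contrapT => nex; apply: no; exists k.+1%:R^-1 => // s hs.
  by rewrite ltNge; apply/negP => h; apply: nex; exists s.
have /choice[s hs] := ex.
pose A k := [set w | eps < vnorm (vsub (L (s k) w) (L t w))].
have mA k : measurable (A k).
  have mv : measurable_fun setT (fun w => vnorm (vsub (L (s k) w) (L t w))).
    exact: (measurableT_comp measurable_vnorm (measurable_increment _ _)).
  have := measurable_fun_ltr (measurable_cst eps) mv => /(_ measurableT [set true] I).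
  by rewrite setTI.
have cv : (\int[P]_w \1_(A k) w) @[k --> \oo] --> \int[P]_w (0 : R).
  apply: (@RE_dominated_cvg _ _ _ _ _ _ 1) => //.
  - by move=> k; case: (bmf_indic R (mA k)).
  - by move=> k w; rewrite indicE; case: (_ \in _); rewrite ?normr1 ?normr0.
  - move: ucs (Tt_neq t); apply: filterS2 => w uc nt.
    have [dl dl0 hdl] := ts_limit_cont uc nt e0.
    apply: cvg_near_cst; near=> k; rewrite indicE memNset// /A/=.
    apply/negP; rewrite -leNgt ltW//; apply: hdl.
    have [h _] := hs k; apply: (lt_trans h).
    near: k.
    have := @cvg_harmonic R => /cvgr0_norm_lt /(_ dl dl0).
    by apply: filterS => k; rewrite /= gtr0_norm// invr_gt0.
rewrite RE_cst in cv.
have := cvgr_lt _ cv _ eta0.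
move=> [k _ /(_ k (leqnn k))]; apply/negP; rewrite -leNgt RE_indic//.
by have [_] := hs k; rewrite -lee_fin fineK// fin_num_measure.
Unshelve. all: end_near. Qed.

End limit_process.

(** * Radial computation: the law of jump sizes along a direction *)

Section density_measure.
Context d (T : measurableType d) (R : realType).
Variables (mu : {measure set T -> \bar R}) (g : T -> R).
Hypotheses (g0 : forall x, 0 <= g x) (mg : measurable_fun setT g).

(** Packaged as a measure so that continuity from below and uniqueness of measures apply to
    integrals over varying sets. *)
Definition dens (A : set T) : \bar R := (\int[mu]_(x in A) (g x)%:E)%E.

Let dens0 : dens set0 = 0%E. Proof. exact: integral_set0. Qed.
Let dens_ge0 A : (0 <= dens A)%E.
Proof. by apply: integral_ge0 => x _; rewrite lee_fin. Qed.
Let dens_sigma_additive : semi_sigma_additive dens.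
Proof.
move=> /= F mF tF mUF; rewrite /dens; apply: cvg_toP.
  apply: ereal_nondecreasing_is_cvgn => m n mn.
  by apply: lee_sum_nneg_natr => // k _ _; exact: dens_ge0.
rewrite ge0_integral_bigcup//=.
- exact/measurable_funTS/measurable_EFinP.
- by move=> x _; rewrite lee_fin.
Qed.

HB.instance Definition _ := isMeasure.Build _ _ _ dens dens0 dens_ge0 dens_sigma_additive.
Definition dens_measure : {measure set T -> \bar R} := dens.

End density_measure.

Section radial_unique.
Context {R : realType}.
Local Notation mR := (measurableTypeR R).

(** The measures may be infinite near 0, so uniqueness is applied to their restrictions to []c,
    +oo[], finite and determined by tails; then [c] tends to 0. *)
Lemma radial_measure_unique (m1 m2 : {measure set mR -> \bar R}) :
  (forall a : R, 0 < a -> m1 `]a, +oo[%classic = m2 `]a, +oo[%classic) ->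
  (forall a : R, 0 < a -> (m1 `]a, +oo[%classic < +oo)%E) ->
  forall A : set mR, measurable A -> A `<=` Rpos -> m1 A = m2 A.
Proof.
move=> m12 m1oo A mA A0.
have tail (c : R) : 0 < c -> m1 (A `&` `]c, +oo[%classic) = m2 (A `&` `]c, +oo[%classic).
  move=> c0.
  have mD : measurable (`]c, +oo[%classic : set mR) by exact: measurable_itv.
  have rayI a b : (`]a, +oo[%classic `&` `]b, +oo[%classic : set mR) =
      `]Num.max a b, +oo[%classic.
    apply/seteqP; split => x /=; rewrite !in_itv/= !andbT gt_max.
      by move=> [-> ->].
    by move/andP.
  apply: (@measure_unique _ R mR (@RGenOInfty.G R) (fun k => `](- k%:R), +oo[%classic)
    (RGenOInfty.measurableE R) _ _ _ (mrestr m1 mD) (mrestr m2 mD) _ _ A mA).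
  - by move=> _ _ [a ->] [b ->]; exists (Num.max a b); exact: rayI.
  - by move=> k; exists (- k%:R).
  - apply/seteqP; split => // x _; exists (Num.truncn `|x|).+1 => //=.
    rewrite in_itv/= andbT ltrNl (le_lt_trans (ler_norm _))// normrN.
    by rewrite truncnS_gt.
  - move=> _ [a ->]; have := m12 (Num.max a c); rewrite -rayI; apply.
    by rewrite lt_max c0 orbT.
  - move=> k; have := m1oo (Num.max (- k%:R) c); rewrite -rayI; apply.
    by rewrite lt_max c0 orbT.
pose c k : R := k.+1%:R^-1.
have AE : A = \bigcup_k (A `&` `]c k, +oo[%classic).
  rewrite -setI_bigcupr; apply/esym/setIidPl => x /A0; rewrite /Rpos/= in_itv/= andbT => x0.
  exists (Num.truncn x^-1) => //=; rewrite in_itv/= andbT.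
  by rewrite /c invf_plt ?posrE// truncnS_gt.
have cv (m : {measure set mR -> \bar R}) :
    m (A `&` `]c k, +oo[%classic) @[k --> \oo] --> m A.
  rewrite [in X in _ --> X]AE; apply: nondecreasing_cvg_mu.
  - by move=> k; apply: measurableI => //; exact: measurable_itv.
  - by rewrite -AE.
  - move=> k l kl; apply/subsetPset; apply: setIS => x /=.
    rewrite !in_itv/= !andbT; apply: le_lt_trans.
    by rewrite /c lef_pV2 ?posrE// ler_nat.
have c1 := cv m1; have c2 := cv m2.
have E : (fun k => m1 (A `&` `]c k, +oo[%classic)) = (fun k => m2 (A `&` `]c k, +oo[%classic)).
  by apply/funext => k; apply: tail; rewrite /c.
by move: c1; rewrite E => c1; exact: (cvg_unique _ c1 c2).
Qed.

End radial_unique.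

Section tails.
Context {R : realType}.
Local Notation mu := (@lebesgue_measure R).
Local Notation mR := (measurableTypeR R).
Variables (alpha p s a : R).
Hypotheses (al0 : 0 < alpha) (a0 : 0 < a).

Let cpow (r : R) (x : R) : 0 < x -> {for x, continuous (fun y : R => y `^ r)}.
Proof.
move=> x0; apply: differentiable_continuous; apply/derivable1_diffP.
by apply: derivable_powR; rewrite in_itv/= andbT.
Qed.

Let cK (k : R) (h : R -> R) (x : R) :
  {for x, continuous h} -> {for x, continuous (fun y => k * h y)}.
Proof. by move=> ch; exact: (@cvgM _ _ (nbhs x) _ (fun=> k) h _ _ (cvg_cst k) ch). Qed.

Lemma tail_substitution (b : R) : a < b ->
  (\int[mu]_(u in `[(a `^ alpha * b `^ (- alpha))%R, 1%R])
     (expR (- (s * a `^ p * u `^ (- (p / alpha)))))%:E =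
   (alpha * a `^ alpha)%:E *
   \int[mu]_(r in `[a, b]) (expR (- (s * r `^ p)) * r `^ (- alpha - 1))%:E)%E.
Proof.
move=> ab.
pose c := a `^ alpha.
have c0 : 0 < c by exact: powR_gt0.
(* The decreasing change of variable, with [F a = 1]; minus its derivative is
   [alpha a^alpha r^(- alpha - 1)]. *)
pose F (r : R) := c * r `^ (- alpha).
pose G (u : R) := expR (- (s * a `^ p * u `^ (- (p / alpha)))).
have F0 (r : R) : 0 < r -> 0 < F r by move=> r0; rewrite mulr_gt0// powR_gt0.
have dF (r : R) : 0 < r -> is_derive r 1 F (c * (- alpha * r `^ (- alpha - 1))).
  move=> r0; have D := is_derive1_powR (- alpha) r0.
  exact: (@is_deriveZ _ _ _ (fun r : R => r `^ (- alpha)) c r 1 _ D).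
have aD (x y : R) : a `^ x * a `^ y = a `^ (x + y).
  by rewrite powRD// (gt_eqF a0) implybT.
have Fa : F a = 1 by rewrite /F /c aD addrN powRr0.
have Flt (x y : R) : 0 < x -> x < y -> F y < F x.
  move=> x0 xy; have y0 : 0 < y by exact: lt_trans xy.
  rewrite /F ltr_pM2l// !powRN ltf_pV2 ?posrE ?powR_gt0//.
  by apply: gt0_ltr_powR => //; rewrite ?nnegrE ?ltW.
have dFE (r : R) : 0 < r -> derive1 F r = c * (- alpha * r `^ (- alpha - 1)).
  by move=> r0; rewrite derive1E; have [_ ->] := dF r r0.
have cF' (r : R) : 0 < r -> {for r, continuous (derive1 F)}.
  move=> r0; rewrite /prop_for /continuous_at dFE//.
  apply: (@cvg_trans _ ((fun r : R => c * (- alpha * r `^ (- alpha - 1))) @ r)).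
    apply: near_eq_cvg; near=> x; apply/esym/dFE; near: x; exact: lt_nbhsr.
  exact: (@cK c _ r (@cK (- alpha) _ r (@cpow (- alpha - 1) r r0))).
have cF (r : R) : 0 < r -> {for r, continuous F}.
  by move=> r0; exact: (@cK c _ r (@cpow (- alpha) r r0)).
have b0 : 0 < b by exact: lt_trans ab.
have cG (u : R) : 0 < u -> {for u, continuous G}.
  move=> u0; apply: (@continuous_comp _ _ _ (fun u : R => - (s * a `^ p * u `^ (- (p / alpha)))) expR).
    by apply: cvgN; exact: (@cK _ _ u (@cpow _ u u0)).
  exact: continuous_expR.
have := @integration_by_substitution_decreasing R F G a b (ltW ab).
rewrite Fa => ->.
- rewrite -ge0_integralZl//=.
  + apply: eq_integral => r; rewrite inE/= in_itv/= => /andP[ar _].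
    have r0 : 0 < r by exact: lt_le_trans ar.
    rewrite -EFinM; congr EFin; rewrite [LHS](_ : _ = G (F r) * - derive1 F r)// dFE//.
    have -> : G (F r) = expR (- (s * r `^ p)).
      rewrite /G /F powRM ?powR_ge0// /c -!powRrM.
      rewrite [alpha * _](_ : _ = - p); last by field; rewrite gt_eqF.
      rewrite [- alpha * _](_ : _ = p); last by field; rewrite gt_eqF.
      by rewrite mulrA -(mulrA s) aD addrN powRr0 mulr1.
    by rewrite /c; ring.
  + apply/measurable_EFinP; apply: measurable_funM.
      apply: measurableT_comp => //; apply: measurableT_comp => //.
      by apply: measurable_funM; [exact: measurable_cst|apply: measurable_funTS; exact: measurable_powR].
    by apply: measurable_funTS; exact: measurable_powR.
  + by move=> r _; rewrite lee_fin mulr_ge0 ?expR_ge0 ?powR_ge0.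
  + by rewrite lee_fin mulr_ge0 ?powR_ge0// ltW.
- move=> x y; rewrite !in_itv/= => /andP[ax _] /andP[ay _] xy.
  by apply: Flt => //; exact: lt_le_trans ay.
- by move=> x; rewrite in_itv/= => /andP[ax _]; apply: cF'; exact: lt_trans ax.
- by apply: cvgP; apply: cvg_at_right_filter; exact: cF'.
- by apply: cvgP; apply: cvg_at_left_filter; exact: cF'.
- split.
  + move=> x; rewrite in_itv/= => /andP[ax _].
    by have [] := dF x (lt_trans a0 ax).
  + by apply: cvg_at_right_filter; exact: cF.
  + by apply: cvg_at_left_filter; exact: cF.
- apply: continuous_in_subspaceT => u; rewrite inE/= in_itv/= => /andP[Fu _].
  by apply: cG; exact: lt_le_trans (F0 b b0) Fu.
Unshelve. all: end_near.
Qed.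

End tails.

Section radial_tails.
Context {R : realType}.
Local Notation mu := (@lebesgue_measure R).
Local Notation mR := (measurableTypeR R).
Variables (alpha p s : R).
Hypothesis al0 : 0 < alpha.

Definition radial_density (r : mR) : R := expR (- (s * r `^ p)) * r `^ (- alpha - 1).

Lemma radial_density_ge0 r : 0 <= radial_density r.
Proof. by rewrite mulr_ge0 ?expR_ge0 ?powR_ge0. Qed.

Lemma measurable_radial_density : measurable_fun setT radial_density.
Proof.
apply: measurable_funM; last exact: measurable_powR.
apply: measurableT_comp => //; apply: measurableT_comp => //.
by apply: measurable_funM; [exact: measurable_cst|exact: measurable_powR].
Qed.

Let tempering (a : R) (u : mR) : R := expR (- (s * a `^ p * u `^ (- (p / alpha)))).

Let mtempering a : measurable_fun setT (tempering a).
Proof.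
apply: measurableT_comp => //; apply: measurableT_comp => //.
by apply: measurable_funM; [exact: measurable_cst|exact: measurable_powR].
Qed.

(** The intervals [[a, b]] grow to the half line while their images grow to []0, 1]]; continuity
    from below on both sides extends the substitution formula. *)
Lemma tail_radial_density (a : R) : 0 < a ->
  (\int[mu]_(u in `]0%R, 1%R]) (tempering a u)%:E =
   (alpha * a `^ alpha)%:E * \int[mu]_(r in `]a, +oo[) (radial_density r)%:E)%E.
Proof.
move=> a0.
pose b k : R := a + k.+1%:R.
have b0 k : 0 < b k by rewrite addr_gt0.
have ab k : a < b k by rewrite ltrDl.
have bmono k l : (k <= l)%N -> b k <= b l by move=> kl; rewrite lerD2l ler_nat.
have lowmono (x y : R) : 0 < x -> x <= y ->
    a `^ alpha * y `^ (- alpha) <= a `^ alpha * x `^ (- alpha).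
  move=> x0 xy; have y0 : 0 < y by exact: lt_le_trans xy.
  rewrite ler_pM2l ?powR_gt0// !powRN lef_pV2 ?posrE ?powR_gt0//.
  by apply: ge0_ler_powR => //; rewrite ?nnegrE ltW.
rewrite integral_itv_obnd_cbnd; last first.
  by apply/measurable_EFinP/measurable_funTS; exact: measurable_radial_density.
pose m1 := dens_measure mu (fun u => expR_ge0 _ : 0 <= tempering a u) (mtempering a).
pose m2 := dens_measure mu radial_density_ge0 measurable_radial_density.
rewrite -[LHS]/(m1 `]0, 1]%classic) -[X in (_ * X)%E]/(m2 `[a, +oo[%classic).
have U1 : (`]0, 1]%classic : set mR) =
    \bigcup_k `[(a `^ alpha * b k `^ (- alpha))%R, 1%R]%classic.
  apply/seteqP; split => [u|u [k _]] /=; rewrite !in_itv/= => /andP[u0 u1]; last first.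
    by rewrite u1 andbT (lt_le_trans _ u0)// mulr_gt0 ?powR_gt0.
  (* The preimage of [u] under the substitution; any [b k] beyond it brings the lower end below
     [u]. *)
  pose y := a * u `^ (- alpha^-1).
  have y0 : 0 < y by rewrite mulr_gt0 ?powR_gt0.
  exists (Num.truncn y) => //=; rewrite in_itv/= u1 andbT.
  apply: (le_trans (lowmono y _ y0 _)).
    by apply: (le_trans (ltW (truncnS_gt y))); rewrite lerDr ltW.
  rewrite /y powRM ?powR_ge0 ?(ltW a0)// -powRrM mulrNN mulVf ?gt_eqF//.
  rewrite powRr1 ?(ltW u0)// mulrA -powRD ?(gt_eqF a0) ?implybT//.
  by rewrite addrN powRr0 mul1r.
have U2 : (`[a, +oo[%classic : set mR) = \bigcup_k `[a, b k]%classic.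
  apply/seteqP; split => [r|r [k _]] /=; rewrite !in_itv/=; last first.
    by move=> /andP[-> _].
  rewrite andbT => ar; exists (Num.truncn r) => //=; rewrite in_itv/= ar/=.
  by apply: (le_trans (ltW (truncnS_gt r))); rewrite lerDr ltW.
have c1 : m1 `[(a `^ alpha * b k `^ (- alpha))%R, 1%R]%classic @[k --> \oo]
    --> m1 `]0, 1]%classic.
  rewrite [in X in _ --> X]U1; apply: nondecreasing_cvg_mu.
  - by move=> k; exact: measurable_itv.
  - by rewrite -U1; exact: measurable_itv.
  - move=> k l kl; apply/subsetPset => u /=; rewrite !in_itv/= => /andP[h ->].
    by rewrite andbT (le_trans _ h)// lowmono// bmono.
have c2 : m2 `[a, b k]%classic @[k --> \oo] --> m2 `[a, +oo[%classic.
  rewrite [in X in _ --> X]U2; apply: nondecreasing_cvg_mu.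
  - by move=> k; exact: measurable_itv.
  - by rewrite -U2; exact: measurable_itv.
  - move=> k l kl; apply/subsetPset => u /=; rewrite !in_itv/= => /andP[-> h] /=.
    by rewrite (le_trans h)// bmono.
have fk : (alpha * a `^ alpha)%:E \is a fin_num by [].
have c3 := cvgeZl fk c2.
have E k : (m1 `[(a `^ alpha * b k `^ (- alpha))%R, 1%R]%classic =
    (alpha * a `^ alpha)%:E * m2 `[a, b k]%classic)%E by exact: tail_substitution.
by move: c1; under eq_fun do rewrite E; move=> c1; exact: (cvg_unique _ c1 c3).
Qed.

End radial_tails.

Section expo_tail.
Context {R : realType}.
Local Notation mu := (@lebesgue_measure R).
Local Notation mR := (measurableTypeR R).

Lemma expo_tail (c : R) : 0 < c -> expo R `]c, +oo[%classic = (expR (- c))%:E.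
Proof.
move=> c0.
have e1 : expo R `]-oo, 0[%classic = 0%E.
  apply/eqP; rewrite eq_le measure_ge0 andbT -(@expo_ge0 R).
  by apply: le_measure; rewrite ?inE// => x /=; rewrite !in_itv/=; exact: ltW.
have e2 : expo R `[0, c]%classic = (1 - (expR (- c))%:E)%E.
  by have := @exponential_prob_itv0c R 1 c c0; rewrite mulN1r => <-.
have : expo R (`]-oo, 0[%classic `|` `[0, c]%classic) = (1 - (expR (- c))%:E)%E.
  rewrite -e2 -[RHS]add0e -e1; apply: measureU => //.
  rewrite -subset0 => x /= []; rewrite !in_itv/= => x0 /andP[x0' _].
  by rewrite ltNge x0' in x0.
have -> : (`]-oo, 0[%classic `|` `[0, c]%classic : set mR) = ~` `]c, +oo[%classic.
  apply/seteqP; split => x /=; rewrite !in_itv/= ?andbT.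
    case=> [x0|/andP[_ xc]]; apply/negP; rewrite -leNgt//.
    by rewrite ltW// (lt_trans x0).
  move/negP; rewrite -leNgt => xc; have [x0|x0] := ltP x 0; [by left|right].
  by rewrite xc.
rewrite probability_setC//.
have := fin_num_measure (expo R) _ (measurable_itv `]c, +oo[).
case: (expo R _) => // r _ /= /(congr1 fine)/= h.
by congr EFin; lra.
Qed.

End expo_tail.

Lemma ltr_powR2r (R : realType) (r x y : R) : 0 < r -> 0 <= x -> 0 <= y ->
  (x `^ r < y `^ r) = (x < y).
Proof.
move=> r0 x0 y0; apply/idP/idP; last first.
  by apply: gt0_ltr_powR; rewrite ?nnegrE.
apply: contraTT; rewrite -!leNgt => yx.
by apply: ge0_ler_powR; rewrite ?nnegrE// ltW.
Qed.

Section push_measure.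
Context d1 d2 (T1 : measurableType d1) (T2 : measurableType d2) (R : realType).
Variables (m : {measure set T1 -> \bar R}) (f : T1 -> T2).
Hypothesis mf : measurable_fun setT f.

Definition push_measure : {measure set T2 -> \bar R}.
Proof. by refine (pushforward m f : {measure set T2 -> \bar R}); exact: mf. Defined.

Lemma push_measureE A : push_measure A = m (f @^-1` A). Proof. by []. Qed.

End push_measure.

Section radial_law.
Context {R : realType}.
Local Notation mu := (@lebesgue_measure R).
Local Notation mR := (measurableTypeR R).
Variables (alpha p s K : R).
Hypotheses (al0 : 0 < alpha) (p0 : 0 < p) (s0 : 0 < s) (K0 : 0 < K).

Local Notation unif01 := (uniform_prob (@ltr01 R)).

(** Lebesgue measure also charges negative arrival times. They are folded onto 0, where [powR] with
    a nonzero exponent is 0, so they yield size 0 and do not enter the tails. *)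
Let shot (x : R) : R := (alpha * Num.max x 0 / K) `^ (- alpha^-1).
Let cut (u e : R) : R := e `^ p^-1 * u `^ alpha^-1 / s `^ p^-1.

Definition radial_map (z : mR * (mR * mR)) : mR := Num.min (shot z.1) (cut z.2.1 z.2.2).

Let mshot : measurable_fun setT (shot : mR -> mR).
Proof.
apply: (measurableT_comp (measurable_powR _)).
apply: measurable_funM; last exact: measurable_cst.
apply: measurable_funM; first exact: measurable_cst.
by apply: measurable_maxr; [exact: measurable_id|exact: measurable_cst].
Qed.

Let mcut : measurable_fun setT (fun z : mR * mR => cut z.1 z.2 : mR).
Proof.
apply: measurable_funM; last exact: measurable_cst.
by apply: measurable_funM; apply: (measurableT_comp (measurable_powR _)).
Qed.

Lemma measurable_radial_map : measurable_fun setT radial_map.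
Proof.
apply: measurable_minr.
  exact: (measurableT_comp mshot measurable_fst).
exact: (measurableT_comp mcut measurable_snd).
Qed.

Lemma radial_map_ge0 z : 0 <= radial_map z.
Proof. by rewrite le_min powR_ge0/= divr_ge0 ?mulr_ge0 ?powR_ge0. Qed.

Definition cut_law : probability (mR * mR)%type R := (unif01 \x expo R)%E.

Definition shot_law : {measure set (mR * (mR * mR)) -> \bar R} :=
  product_measure1 (mu : {measure set mR -> \bar R}) cut_law.

Let shot_lawE (A1 : set mR) (A2 : set (mR * mR)) : measurable A1 -> measurable A2 ->
  shot_law (A1 `*` A2) = (mu A1 * cut_law A2)%E.
Proof. exact: product_measure1E. Qed.

Definition radial_law : {measure set mR -> \bar R} :=
  push_measure shot_law measurable_radial_map.

Let mray (a : R) : measurable (`]a, +oo[%classic : set mR).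
Proof. exact: measurable_itv. Qed.

Let shot_gt (a x : R) : 0 < a -> (a < shot x) = (0 < x < K / alpha * a `^ (- alpha)).
Proof.
move=> a0; rewrite /shot; have [x0|x0] := leP x 0.
  rewrite mulr0 mul0r powR0 ?oppr_eq0 ?invr_eq0 ?gt_eqF//.
  by apply/negbTE; rewrite -leNgt ltW.
set y := alpha * x / K.
have y0 : 0 < y by rewrite divr_gt0// mulr_gt0.
rewrite -(ltr_powR2r al0 (ltW a0) (powR_ge0 _ _)) -powRrM mulNr mulVf ?gt_eqF//.
rewrite powR_inv1 ?(ltW y0)// powRN -[LHS]ltf_pV2 ?posrE ?powR_gt0 ?invr_gt0//.
rewrite invrK /y ltr_pdivrMr// -[RHS](ltr_pM2l al0); congr (_ < _).
by field; rewrite !gt_eqF ?powR_gt0.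
Qed.

Let mu_shot (a : R) : 0 < a -> mu (shot @^-1` `]a, +oo[%classic) = (K / alpha * a `^ (- alpha))%:E.
Proof.
move=> a0.
have -> : shot @^-1` `]a, +oo[%classic = `]0, K / alpha * a `^ (- alpha)[%classic.
  by apply/seteqP; split => x /=; rewrite !in_itv/= andbT shot_gt.
by rewrite lebesgue_measure_itv/= lte_fin mulr_gt0 ?divr_gt0 ?powR_gt0// oppr0 adde0.
Qed.

Let expo_pos (A : set mR) : measurable A -> expo R A = expo R (A `&` `]0, +oo[%classic).
Proof.
move=> mA.
rewrite (@measureDI _ _ _ (expo R) A `]0, +oo[%classic)//.
rewrite [X in (X + _)%E](_ : _ = 0%E) ?add0e//.
apply/eqP; rewrite eq_le measure_ge0 andbT -(@expo_ge0 R).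
apply: le_measure; rewrite ?inE//; first exact: measurableD.
by move=> x [_] /=; rewrite !in_itv/= andbT => /negP; rewrite -leNgt.
Qed.

Let expo_cut (a u : R) : 0 < a -> 0 < u ->
  expo R (cut u @^-1` `]a, +oo[%classic) =
  (expR (- (s * a `^ p * u `^ (- (p / alpha)))))%:E.
Proof.
move=> a0 u0; rewrite -expo_tail ?mulr_gt0 ?powR_gt0//.
have mu' : measurable_fun setT (cut u : mR -> mR).
  exact: (measurableT_comp mcut (@pair1_measurable _ _ mR mR u)).
rewrite expo_pos; last first.
  by rewrite -[X in measurable X]setTI; apply: mu'.
pose c := s * a `^ p * u `^ (- (p / alpha)).
have cutE (e : R) : 0 < e -> (a < cut u e) = (c < e).
  move=> e0; rewrite -(ltr_powR2r p0 (ltW a0)); last by rewrite divr_ge0 ?mulr_ge0 ?powR_ge0.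
  rewrite /cut /c powRM ?mulr_ge0 ?invr_ge0 ?powR_ge0// powRM ?powR_ge0//.
  rewrite -[(s `^ p^-1)^-1]powR_inv1 ?powR_ge0//.
  rewrite -!powRrM mulVf ?gt_eqF// powRr1 ?(ltW e0)//.
  rewrite [X in _ < _ * s `^ X](_ : _ = -1); last by field; rewrite gt_eqF.
  rewrite powR_inv1 ?(ltW s0)// ltr_pdivlMr// powRN ltr_pdivrMr ?powR_gt0//.
  by rewrite mulrC [_^-1 * p]mulrC.
have c0 : 0 < c by rewrite !mulr_gt0 ?powR_gt0.
congr (expo R _); apply/seteqP; split => e /=; rewrite !in_itv/= !andbT.
  by move=> [+ e0]; rewrite cutE.
by move=> ce; have e0 := lt_trans c0 ce; split=> //; rewrite cutE.
Qed.

(** A minimum exceeds [a] exactly when both entries do, so the event is a rectangle. Lebesgue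
    measure gives [K / alpha a^(- alpha)], and the cut-off gives the integral over []0, 1]] computed
    above, whose factor [alpha a^alpha] cancels. *)
Lemma radial_law_tail (a : R) : 0 < a ->
  radial_law `]a, +oo[%classic =
  (K%:E * \int[mu]_(r in `]a, +oo[) (radial_density alpha p s r)%:E)%E.
Proof.
move=> a0; rewrite /radial_law push_measureE.
have -> : radial_map @^-1` `]a, +oo[%classic = (shot @^-1` `]a, +oo[%classic) `*`
    ((fun z : mR * mR => cut z.1 z.2 : mR) @^-1` `]a, +oo[%classic).
  apply/seteqP; split => -[x z] /=; rewrite !in_itv/= !andbT lt_min.
    by move/andP.
  by move=> [-> ->].
have mA2 : measurable ((fun z : mR * mR => cut z.1 z.2 : mR) @^-1` `]a, +oo[%classic).
  by rewrite -[X in measurable X]setTI; apply: mcut.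
rewrite shot_lawE//; last first.
  by rewrite -[X in measurable X]setTI; apply: mshot.
rewrite mu_shot//.
have -> : (cut_law ((fun z : mR * mR => cut z.1 z.2 : mR) @^-1` `]a, +oo[%classic) =
   \int[mu]_(u in `]0%R, 1%R]) (expR (- (s * a `^ p * u `^ (- (p / alpha)))))%:E)%E.
  rewrite /cut_law/= /product_measure1/= integral_uniform.
  - rewrite subr0 invr1 mul1e -integral_itv_obnd_cbnd.
      apply: eq_integral => u; rewrite inE/= in_itv/= => /andP[u0 _].
      by rewrite -expo_cut// xsectionE.
    by apply: measurable_funTS; exact: measurable_fun_xsection.
  - exact: measurable_fun_xsection.
  - by move=> u; exact: measure_ge0.
rewrite (@tail_radial_density R alpha p s al0 a a0) muleA -EFinM.
congr (_%:E * _)%E; rewrite powRN; field.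
by rewrite !gt_eqF ?powR_gt0.
Qed.

Lemma radial_law_tail_lty (a : R) : 0 < a -> (radial_law `]a, +oo[%classic < +oo)%E.
Proof.
move=> a0; rewrite /radial_law push_measureE.
have mA1 : measurable (shot @^-1` `]a, +oo[%classic : set mR).
  by rewrite -[X in measurable X]setTI; apply: mshot.
apply: (@le_lt_trans _ _ (shot_law ((shot @^-1` `]a, +oo[%classic) `*` setT))).
  apply: le_measure; rewrite ?inE//.
  - by rewrite -[X in measurable X]setTI; apply: measurable_radial_map.
  - exact: measurableX.
  - by move=> [x z] /=; rewrite !in_itv/= !andbT lt_min => /andP[-> _].
by rewrite shot_lawE// mu_shot// [X in (_ * X)%E]probability_setT mule1 ltry.
Qed.

Lemma radial_lawE (A : set mR) : measurable A -> A `<=` Rpos ->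
  radial_law A = (K%:E * \int[mu]_(r in A) (radial_density alpha p s r)%:E)%E.
Proof.
move=> mA A0.
pose m := dens_measure mu (radial_density_ge0 alpha p s) (measurable_radial_density alpha p s).
pose k : {nonneg R} := NngNum (ltW K0).
have := @radial_measure_unique R radial_law (mscale k m).
by apply => // a a0; [exact: radial_law_tail|exact: radial_law_tail_lty].
Qed.

End radial_law.

(** * Mixtures, iterated integrals and integrals of set functions *)

Section iterated_integrals.
Import HBNNSimple.
Local Open Scope ereal_scope.

Lemma ge0_integral_mixture dY dT (Y : measurableType dY) (T : measurableType dT) (R : realType)
    (mu : {measure set Y -> \bar R}) (k : Y -> {measure set T -> \bar R})
    (nu : {measure set T -> \bar R}) :
  (forall A, measurable A -> measurable_fun setT (k ^~ A)) ->
  (forall A, measurable A -> nu A = \int[mu]_y k y A) ->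
  forall f : T -> \bar R, measurable_fun setT f -> (forall x, 0 <= f x) ->
  \int[nu]_x f x = \int[mu]_y \int[k y]_x f x.
Proof.
move=> mk nuE f mf f0.
have mI (g : T -> \bar R) : measurable_fun setT g -> (forall x, 0 <= g x) ->
    measurable_fun setT (fun y => \int[k y]_x g x).
  by move=> mg g0; exact: (@measurable_fun_integral_kernel _ _ _ _ _ k).
have simple (g : {nnsfun T >-> R}) :
    \int[nu]_x (g x)%:E = \int[mu]_y \int[k y]_x (g x)%:E.
  under [LHS]eq_integral do rewrite fimfunE -fsumEFin//.
  rewrite [LHS]ge0_integral_fsum//; last 2 first.
    - by move=> r; exact/measurable_EFinP/measurableT_comp.
    - by move=> n x _; rewrite EFinM nnfun_muleindic_ge0.
  under [RHS]eq_integral => y _.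
    under eq_integral do rewrite fimfunE -fsumEFin//.
    rewrite ge0_integral_fsum//; last 2 first.
      - by move=> r; exact/measurable_EFinP/measurableT_comp.
      - by move=> n x _; rewrite EFinM nnfun_muleindic_ge0.
    over.
  rewrite [RHS]ge0_integral_fsum//; last 2 first.
    - move=> r; apply: mI; first exact/measurable_EFinP/measurableT_comp.
      by move=> x; rewrite EFinM nnfun_muleindic_ge0.
    - by move=> n y _; apply: integral_ge0 => x _; rewrite EFinM nnfun_muleindic_ge0.
  apply: eq_fsbigr => r; rewrite inE/= => -[y _ ry].
  have r0 : (0 <= r)%R by rewrite -ry.
  have ZE (m : {measure set T -> \bar R}) :
      \int[m]_x (r * \1_(g @^-1` [set r]) x)%:E = r%:E * m (g @^-1` [set r]).
    under eq_integral do rewrite EFinM.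
    rewrite ge0_integralZl//; last exact/measurable_EFinP/measurable_indic.
    by rewrite integral_indic// setIT.
  rewrite ZE nuE// -ge0_integralZl//; last exact: mk.
  by apply: eq_integral => y' _; rewrite ZE.
pose f_ := nnsfun_approx measurableT mf.
have cvf x : (f_ n x)%:E @[n --> \oo] --> f x.
  by apply: cvg_nnsfun_approx => // y _.
have mono (m : {measure set T -> \bar R}) :
    \int[m]_x f x = limn (fun n => \int[m]_x (f_ n x)%:E).
  rewrite -monotone_convergence//=.
  - by apply: eq_integral => x _; apply/esym/cvg_lim => //; exact: cvf.
  - by move=> n; exact/measurable_EFinP/measurable_funTS.
  - by move=> n x _; rewrite lee_fin.
  - by move=> x _ a b ab; rewrite lee_fin; exact/lefP/nd_nnsfun_approx.
rewrite mono; under eq_fun do rewrite simple.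
rewrite -monotone_convergence//=.
- by apply: eq_integral => y _; rewrite mono.
- by move=> n; apply: mI => [|x]; [exact/measurable_EFinP|rewrite lee_fin].
- by move=> n y _; apply: integral_ge0 => x _; rewrite lee_fin.
- move=> y _ a b ab; apply: ge0_le_integral => //.
  + by move=> x _; rewrite lee_fin.
  + by apply/measurable_EFinP/measurable_funTS.
  + by apply/measurable_EFinP/measurable_funTS.
  + by move=> x _; rewrite lee_fin; exact/lefP/nd_nnsfun_approx.
Qed.

Lemma tonelli_in d1 d2 (T1 : measurableType d1) (T2 : measurableType d2) (R : realType)
    (m1 : {sigma_finite_measure set T1 -> \bar R})
    (m2 : {sigma_finite_measure set T2 -> \bar R}) (D1 : set T1) (D2 : set T2)
    (f : T1 * T2 -> \bar R) : measurable D1 -> measurable D2 ->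
  measurable_fun setT f -> (forall z, 0 <= f z) ->
  \int[m1]_(x in D1) \int[m2]_(y in D2) f (x, y) =
  \int[m2]_(y in D2) \int[m1]_(x in D1) f (x, y).
Proof.
move=> mD1 mD2 mf f0.
pose g z := f z * ((\1_D1 z.1)%:E * (\1_D2 z.2)%:E).
have mg : measurable_fun setT g.
  apply: emeasurable_funM => //; apply: emeasurable_funM; apply/measurable_EFinP.
    exact: (measurableT_comp (measurable_indic _) measurable_fst).
  exact: (measurableT_comp (measurable_indic _) measurable_snd).
have g0 z : 0 <= g z by rewrite !mule_ge0// lee_fin.
have f1 x : measurable_fun setT (fun y => f (x, y)).
  by apply: measurableT_comp => //; exact: pair1_measurable.
have f2 y : measurable_fun setT (fun x => f (x, y)).
  by apply: measurableT_comp => //; exact: pair2_measurable.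
have := @fubini_tonelli _ _ _ _ _ m1 m2 g mg g0.
congr (_ = _); [rewrite [RHS]integral_mkcond epatch_indic|rewrite [RHS]integral_mkcond epatch_indic].
- apply: eq_integral => x _; rewrite [X in _ = X * _]integral_mkcond epatch_indic -ge0_integralZr//.
  + by apply: eq_integral => y _; rewrite /g/= -muleA [X in _ * X]muleC.
  + by apply: emeasurable_funM => //; apply/measurable_EFinP; exact: measurable_indic.
  + by move=> y _; rewrite mule_ge0// lee_fin.
  + by rewrite lee_fin.
- apply: eq_integral => y _; rewrite [X in _ = X * _]integral_mkcond epatch_indic -ge0_integralZr//.
  + by apply: eq_integral => x _; rewrite /g/= -muleA.
  + by apply: emeasurable_funM => //; apply/measurable_EFinP; exact: measurable_indic.
  + by move=> x _; rewrite mule_ge0// lee_fin.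
  + by rewrite lee_fin.
Qed.

(** Brings the last variable, in use [V], outermost; for fixed [V] the other three integrals are the
    radial computation. *)
Lemma tonelli4 d1 d2 d3 d4 (T1 : measurableType d1) (T2 : measurableType d2)
    (T3 : measurableType d3) (T4 : measurableType d4) (R : realType)
    (m1 : {sigma_finite_measure set T1 -> \bar R})
    (m2 : {sigma_finite_measure set T2 -> \bar R})
    (m3 : {sigma_finite_measure set T3 -> \bar R})
    (m4 : {sigma_finite_measure set T4 -> \bar R})
    (f : T1 * (T2 * (T3 * T4)) -> \bar R) :
  measurable_fun setT f -> (forall z, 0 <= f z) ->
  \int[m1]_x \int[m2]_y \int[m3]_z \int[m4]_v f (x, (y, (z, v))) =
  \int[m4]_v \int[m1]_x \int[m2]_y \int[m3]_z f (x, (y, (z, v))).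
Proof.
move=> mf f0.
have int1 x : \int[m2]_y \int[m3]_z \int[m4]_v f (x, (y, (z, v))) =
    \int[m4]_v \int[m2]_y \int[m3]_z f (x, (y, (z, v))).
  have int2 y : \int[m3]_z \int[m4]_v f (x, (y, (z, v))) =
      \int[m4]_v \int[m3]_z f (x, (y, (z, v))).
    apply: (@fubini_tonelli _ _ _ _ _ m3 m4 (fun zv => f (x, (y, zv)))) => //.
    apply: measurableT_comp => //; apply: measurable_fun_pair; first exact: measurable_cst.
    by apply: measurable_fun_pair; [exact: measurable_cst|exact: measurable_id].
  under eq_integral do rewrite int2.
  apply: (@fubini_tonelli _ _ _ _ _ m2 m4
    (fun yv => \int[m3]_z f (x, (yv.1, (z, yv.2))))) => [|yv].
    apply: (@measurable_fun_fubini_tonelli_F _ _ _ _ _ m3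
      (fun w => f (x, (w.1.1, (w.2, w.1.2))))) => //.
    apply: measurableT_comp => //; apply: measurable_fun_pair; first exact: measurable_cst.
    apply: measurable_fun_pair; first exact: measurableT_comp.
    by apply: measurable_fun_pair; [exact: measurable_snd|exact: measurableT_comp].
  by apply: integral_ge0.
under eq_integral do rewrite int1.
apply: (@fubini_tonelli _ _ _ _ _ m1 m4
  (fun xv => \int[m2]_y \int[m3]_z f (xv.1, (y, (z, xv.2))))) => [|xv]; last first.
  by apply: integral_ge0 => y _; apply: integral_ge0.
apply: (@measurable_fun_fubini_tonelli_F _ _ _ _ _ m2
  (fun w => \int[m3]_z f (w.1.1, (w.2, (z, w.1.2))))) => [|w]; last by apply: integral_ge0.
apply: (@measurable_fun_fubini_tonelli_F _ _ _ _ _ m3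
  (fun w => f (w.1.1.1, (w.1.2, (w.2, w.1.1.2))))) => //.
apply: measurableT_comp => //.
have m11 : measurable_fun setT (fun w : ((T1 * T4) * T2) * T3 => w.1.1).
  by apply: measurableT_comp.
apply: measurable_fun_pair; first exact: (measurableT_comp measurable_fst m11).
apply: measurable_fun_pair; first exact: measurableT_comp.
by apply: measurable_fun_pair; [exact: measurable_snd|exact: (measurableT_comp measurable_snd m11)].
Qed.

End iterated_integrals.

Section raw_integral.
Import HBNNSimple.

(* The integral of a set function that is not known to be a measure. *)
Lemma eq_raw_integral d (T : measurableType d) (R : realType)
    (m1 m2 : set T -> \bar R) (x0 : T) (f : T -> \bar R) : f x0 = 0%E ->
  (forall A, measurable A -> ~ A x0 -> m1 A = m2 A) ->
  (\int[m1]_x f x = \int[m2]_x f x)%E.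
Proof.
move=> f0 m12; rewrite /integral patch_setT.
have nnE (g : T -> \bar R) : g x0 = 0%E ->
    ereal_sup [set sintegral m1 h | h in [set h : {nnsfun T >-> R} | forall x, ((h x)%:E <= g x)%E]] =
    ereal_sup [set sintegral m2 h | h in [set h : {nnsfun T >-> R} | forall x, ((h x)%:E <= g x)%E]].
  move=> g0; congr ereal_sup; apply/seteqP.
  have sE (h : {nnsfun T >-> R}) : (forall x, ((h x)%:E <= g x)%E) -> sintegral m1 h = sintegral m2 h.
    move=> hg; rewrite /sintegral; apply: eq_fsbigr => r _.
    have [->|r0] := eqVneq r 0; first by rewrite !mul0e.
    (* A nonnegative simple function below [g] vanishes at [x0], so its nonzero level sets avoid
       that point. *)
    congr (_ * _)%E; apply: m12 => [//|/= hr].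
    have := hg x0; rewrite hr g0 lee_fin => rle.
    by move/eqP: r0; apply; apply/eqP; rewrite eq_le rle -hr/=.
  by split => _ [h hg <-]; exists h => //; rewrite sE.
by congr (_ - _)%E; apply: nnE; rewrite ?funeposE ?funenegE f0 ?oppe0 maxxx.
Qed.

End raw_integral.

Section probability_of_measure.
Context d (T : measurableType d) (R : realType) (m : {measure set T -> \bar R}).
Hypothesis m1 : m setT = 1%E.

(** Bundles a measure of total mass 1 as a probability; used for [Qk u], which is typed as a mere
    measure. *)
Definition prob_fun (A : set T) : \bar R := m A.

Let prob_fun0 : prob_fun set0 = 0%E. Proof. exact: measure0. Qed.
Let prob_fun_ge0 A : (0 <= prob_fun A)%E. Proof. exact: measure_ge0. Qed.
Let prob_fun_sigma_additive : semi_sigma_additive prob_fun.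
Proof. exact: measure_semi_sigma_additive. Qed.

HB.instance Definition _ :=
  isMeasure.Build _ _ _ prob_fun prob_fun0 prob_fun_ge0 prob_fun_sigma_additive.
HB.instance Definition _ := Measure_isProbability.Build _ _ _ prob_fun m1.

Definition prob_of : probability T R := prob_fun.

End probability_of_measure.

(** * Identification of the image measure with the Levy measure *)

Section levy_measure.
Context {R : realType} {n : nat}.
Local Notation mu := (@lebesgue_measure R).
Local Notation mR := (measurableTypeR R).
Local Notation Rn := (n.-tuple R).
Local Notation unif01 := (uniform_prob (@ltr01 R)).
Variables (sigma : {finite_measure set Rn -> \bar R}) (Qk : R.-pker Rn ~> R).
Variables (alpha p T : R) (QV : probability Rn R).
Local Notation sig := (fine (sigma setT)).
Hypotheses (al0 : 0 < alpha) (p0 : 0 < p) (T0 : 0 < T) (sig0 : 0 < sig).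
Hypothesis Qk_pos : forall u, sphere u -> Qk u Rpos = 1%E.
Hypothesis QVE : forall A : set Rn, measurable A ->
  QV A = (measQ sigma Qk A * (sig^-1)%:E)%E.

(** The coordinates are arrival, [U], [E], [V]. As in [radial_map], the maximum with 0 gives
    negative arrivals a zero jump, so that Lebesgue measure on the whole line can serve as
    intensity. *)
Definition jump_map (z : mR * (mR * (mR * Rn))) : Rn :=
  jump alpha p T sig (Num.max z.1 0) z.2.2.1 z.2.1 z.2.2.2.

Lemma measurable_jump_map : measurable_fun setT jump_map.
Proof.
have m2 : measurable_fun setT (fun z : mR * (mR * (mR * Rn)) => z.2.2).
  exact: (measurableT_comp measurable_snd measurable_snd).
apply: measurable_jump.
- by apply: measurable_maxr; [exact: measurable_fst|exact: measurable_cst].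
- exact: (measurableT_comp measurable_fst m2).
- exact: (measurableT_comp measurable_fst measurable_snd).
- exact: (measurableT_comp measurable_snd m2).
Qed.

Definition temper_law : probability (mR * Rn)%type R := (expo R \x QV)%E.

Definition jump_mark_law : probability (mR * (mR * Rn))%type R :=
  (unif01 \x temper_law)%E.

Definition jump_base : {measure set (mR * (mR * (mR * Rn))) -> \bar R} :=
  product_measure1 (mu : {measure set mR -> \bar R}) jump_mark_law.

Definition jump_measure : {measure set Rn -> \bar R} :=
  push_measure jump_base measurable_jump_map.

Let mRpos : measurable (Rpos : set mR). Proof. exact: measurable_itv. Qed.
Let mRpos' : measurable (Rpos : set R). Proof. exact: measurable_itv. Qed.

Let scaled u : R -> Rn := fun s => vscale s u.

Let mscaled u : measurable_fun setT (scaled u).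
Proof. by apply: measurable_vscale; [exact: measurable_id|exact: measurable_cst]. Qed.

(** The image of [Qk u] on the ray through [u]. Off the sphere, where [Qk_pos] says nothing, the
    zero measure is taken. *)
Let radial_kernel (u : Rn) : {measure set Rn -> \bar R} :=
  if pselect (sphere u) then push_measure (Qk u) (mscaled u) else mzero.

Let Qk_posI u (A : set R) : sphere u -> measurable A -> Qk u (A `&` Rpos) = Qk u A.
Proof.
move=> su mA; rewrite [RHS](@measureDI _ _ _ (Qk u) A Rpos)//.
rewrite [X in (_ = X + _)%E](_ : _ = 0%E) ?add0e//.
apply/eqP; rewrite eq_le measure_ge0 andbT.
have Q0 : Qk u (~` Rpos) = 0%E.
  pose Pu : probability R R := prob_of (prob_kernel (s := Qk) u).
  by rewrite -[LHS]/(Pu (~` Rpos)) probability_setC// [X in (1 - X)%E]Qk_pos// subee.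
rewrite -Q0; apply: le_measure; last by move=> x [].
- by rewrite inE; exact: measurableD.
- by rewrite inE; exact: measurableC.
Qed.

Let Qk_pos_integral u (f : R -> \bar R) : sphere u -> measurable_fun setT f ->
  (forall s, 0 <= f s)%E -> (\int[Qk u]_s f s = \int[Qk u]_(s in Rpos) f s)%E.
Proof.
move=> su mf f0.
rewrite (@ge0_negligible_integral _ _ _ (Qk u) setT (~` Rpos))//.
- by rewrite setTD setCK.
- exact: measurableC.
- by rewrite -Qk_posI// ?setICl ?measure0//; exact: measurableC.
Qed.

Let mradial_kernel (A : set Rn) : measurable A -> measurable_fun setT (radial_kernel ^~ A).
Proof.
move=> mA.
have mI : measurable_fun setT (fun u => \int[Qk u]_s (\1_A (vscale s u))%:E)%E.
  apply: (@measurable_fun_integral_finite_kernel _ _ _ _ _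
    (fun us : Rn * R => (\1_A (vscale us.2 us.1))%:E) Qk) => [z|]; first by rewrite lee_fin.
  apply/measurable_EFinP; apply: (measurableT_comp (measurable_indic _)) => //.
  by apply: measurable_vscale; [exact: measurable_snd|exact: measurable_fst].
rewrite (_ : (fun u => radial_kernel u A) =
    (fun u => (\int[Qk u]_s (\1_A (vscale s u))%:E * (\1_sphere u)%:E)%E)).
  apply: emeasurable_funM => //; apply/measurable_EFinP; apply: measurable_indic.
  exact: measurable_sphere.
apply/funext => u; rewrite /radial_kernel indicE; case: pselect => su; last first.
  by rewrite memNset// mule0.
rewrite mem_set// mule1 push_measureE.
have -> : (fun s => (\1_A (vscale s u))%:E) = (fun s => (\1_(scaled u @^-1` A) s)%:E :> \bar R) by [].
rewrite integral_indic ?setIT//.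
by rewrite -[X in measurable X]setTI; exact: mscaled.
Qed.

(** Polar decomposition of the law of [V]: [measQ] is a mixture over [sigma] of measures on rays. *)
Lemma QV_mixture (f : Rn -> \bar R) : measurable_fun setT f -> (forall v, 0 <= f v)%E ->
  (sig%:E * \int[QV]_v f v =
   \int[sigma]_(u in sphere) \int[Qk u]_(s in Rpos) f (vscale s u))%E.
Proof.
move=> mf f0.
pose k : {nonneg R} := NngNum (ltW sig0).
have := @ge0_integral_mscale _ _ _ QV setT measurableT k f mf (fun x _ => f0 x).
move=> /= <-.
rewrite (@ge0_integral_mixture _ _ _ _ _ sigma radial_kernel (mscale k QV))//.
- rewrite [RHS]integral_mkcond; apply: eq_integral => u _.
  rewrite /radial_kernel patchE; case: pselect => su; last first.
    by rewrite memNset// integral_measure_zero.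
  rewrite mem_set// [LHS]ge0_integral_pushforward//.
  rewrite preimage_setT -Qk_pos_integral//.
  exact: (measurableT_comp mf (mscaled u)).
- move=> A mA; rewrite -[LHS]/(sig%:E * QV A)%E QVE// muleCA -EFinM divff ?gt_eqF// mule1.
  rewrite /measQ [LHS]integral_mkcond; apply: eq_integral => u _.
  rewrite /radial_kernel patchE; case: pselect => su; last by rewrite memNset.
  have mS : measurable (scaled u @^-1` A).
    by rewrite -[X in measurable X]setTI; exact: mscaled.
  rewrite mem_set// push_measureE -Qk_posI//.
  have -> : (fun s => (\1_A (vscale s u))%:E) = (fun s => (\1_(scaled u @^-1` A) s)%:E :> \bar R) by [].
  by rewrite integral_indic.
Qed.

Section jump_measureE.
Variable A : set Rn.
Hypotheses (mA : measurable A) (A0 : ~ A vzero).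

Let F (v : Rn) : \bar R :=
  (\int[mu]_x \int[unif01]_u \int[expo R]_e (\1_A (jump_map (x, (u, (e, v)))))%:E)%E.

Let mIA : measurable_fun setT (fun z => (\1_A (jump_map z))%:E : \bar R).
Proof. by apply/measurable_EFinP; exact: (measurableT_comp (measurable_indic _) measurable_jump_map). Qed.

Let F_ge0 v : (0 <= F v)%E.
Proof.
by apply: integral_ge0 => x _; apply: integral_ge0 => u _; apply: integral_ge0 => e _; rewrite lee_fin.
Qed.

Let mF : measurable_fun setT F.
Proof.
apply: (@measurable_fun_fubini_tonelli_F _ _ _ _ _ (mu : {sigma_finite_measure set mR -> \bar R})
  (fun w : Rn * mR => \int[unif01]_u \int[expo R]_e (\1_A (jump_map (w.2, (u, (e, w.1)))))%:E)%E)
  => [|w]; last first.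
  by apply: integral_ge0 => u _; apply: integral_ge0 => e _; rewrite lee_fin.
apply: (@measurable_fun_fubini_tonelli_F _ _ _ _ _ unif01
  (fun w : (Rn * mR) * mR => \int[expo R]_e (\1_A (jump_map (w.1.2, (w.2, (e, w.1.1)))))%:E)%E)
  => [|w]; last first.
  by apply: integral_ge0 => e _; rewrite lee_fin.
apply: (@measurable_fun_fubini_tonelli_F _ _ _ _ _ (expo R)
  (fun w : ((Rn * mR) * mR) * mR => (\1_A (jump_map (w.1.1.2, (w.1.2, (w.2, w.1.1.1)))))%:E)%E)
  => [|w]; last by rewrite lee_fin.
have m11 : measurable_fun setT (fun w : ((Rn * mR) * mR) * mR => w.1.1).
  exact: (measurableT_comp measurable_fst measurable_fst).
apply: (measurableT_comp mIA).
apply: measurable_fun_pair; first exact: (measurableT_comp measurable_snd m11).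
apply: measurable_fun_pair; first exact: (measurableT_comp measurable_snd measurable_fst).
apply: measurable_fun_pair; first exact: measurable_snd.
exact: (measurableT_comp measurable_fst m11).
Qed.

Let jump_measure_section : jump_measure A = (\int[QV]_v F v)%E.
Proof.
rewrite /jump_measure push_measureE.
transitivity (\int[jump_base]_z (\1_A (jump_map z))%:E)%E.
  have -> : (fun z => (\1_A (jump_map z))%:E : \bar R) = (fun z => (\1_(jump_map @^-1` A) z)%:E) by [].
  rewrite integral_indic ?setIT//.
  by rewrite -[X in measurable X]setTI; apply: measurable_jump_map.
rewrite /F -(tonelli4 mu unif01 (expo R) QV mIA) => [|z]; last by rewrite lee_fin.
rewrite [LHS](@fubini_tonelli1 _ _ _ _ _ (mu : {measure set mR -> \bar R}) jump_mark_law)//.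
apply: eq_integral => x _; rewrite /fubini_F.
have mx : measurable_fun setT (fun y => (\1_A (jump_map (x, y)))%:E : \bar R).
  by apply: (measurableT_comp mIA); exact: pair1_measurable.
rewrite [LHS](@fubini_tonelli1 _ _ _ _ _ unif01 temper_law)//.
apply: eq_integral => u _; rewrite /fubini_F.
rewrite [LHS](@fubini_tonelli1 _ _ _ _ _ (expo R) QV)//.
by apply: (measurableT_comp mx); exact: pair1_measurable.
Qed.

(** For fixed [v] the jump is a radial variable times the unit vector of [v]; [radial_lawE] applies
    with [s = vnorm v] and [K = sig * T]. *)
Let F_radial (v : Rn) : 0 < vnorm v ->
  F v = ((sig * T)%:E * \int[mu]_(r in Rpos)
    ((\1_A (vscale (r / vnorm v) v))%:E * (radial_density alpha p (vnorm v) r)%:E))%E.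
Proof.
move=> v0.
pose B : set mR := [set r | A (vscale (r / vnorm v) v)].
have mB : measurable B.
  have mf : measurable_fun setT (fun r : mR => vscale (r / vnorm v) v).
    apply: measurable_vscale; last exact: measurable_cst.
    by apply: measurable_funM; [exact: measurable_id|exact: measurable_cst].
  by rewrite -[X in measurable X]setTI; exact: mf.
have K0 : 0 < sig * T by rewrite mulr_gt0.
have := @radial_lawE R alpha p (vnorm v) (sig * T) al0 p0 v0 K0 (B `&` Rpos)
  (measurableI _ _ mB mRpos) (@subIsetr _ _ _).
have -> : (\int[mu]_(r in B `&` Rpos) (radial_density alpha p (vnorm v) r)%:E =
  \int[mu]_(r in Rpos) ((\1_A (vscale (r / vnorm v) v))%:E * (radial_density alpha p (vnorm v) r)%:E))%E.
  rewrite setIC integral_mkcondr; apply: eq_integral => r _.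
  by rewrite epatch_indic muleC.
move=> <-; rewrite /radial_law push_measureE.
set phi := radial_map _ _ _ _.
have mphi : measurable_fun setT phi by exact: measurable_radial_map.
(* Radius 0 would give the origin, which [A] omits, so restricting to positive radii loses
   nothing. *)
have -> : phi @^-1` (B `&` Rpos) = phi @^-1` B.
  apply/seteqP; split => [z []//|z Bz]; split=> //=.
  rewrite /Rpos/= in_itv/= andbT lt_neqAle radial_map_ge0 andbT eq_sym.
  apply: contra_notN A0 => /eqP z0; move: Bz => /=.
  rewrite z0 /B/= mul0r; congr (A _); apply: eq_from_tnth => i.
  by rewrite tnth_vscale mul0r tnth_vzero.
have mphiB : measurable (phi @^-1` B) by rewrite -[X in measurable X]setTI; apply: mphi.
transitivity (\int[@shot_law R]_z (\1_(phi @^-1` B) z)%:E)%E; last first.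
  by rewrite integral_indic ?setIT.
have mI : measurable_fun setT (fun z => (\1_(phi @^-1` B) z)%:E : \bar R).
  by apply/measurable_EFinP; exact: measurable_indic.
rewrite [RHS](@fubini_tonelli1 _ _ _ _ _ (mu : {measure set mR -> \bar R}) (@cut_law R))//.
apply: eq_integral => x _; rewrite /fubini_F.
rewrite [RHS](@fubini_tonelli1 _ _ _ _ _ unif01 (expo R))//.
by apply: (measurableT_comp mI); exact: pair1_measurable.
Qed.

Lemma jump_measureE : jump_measure A = (T%:E * levy_M sigma Qk alpha p A)%E.
Proof.
have K0 : 0 < sig * T by rewrite mulr_gt0.
(* Normalised so that exactly the factor [sig] demanded by [QV_mixture] and the final [T] come
   out. *)
pose F' v := (((sig * T)^-1)%:E * F v)%E.
have mF' : measurable_fun setT F' by apply: emeasurable_funM => //; exact: measurable_cst.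
have F'0 v : (0 <= F' v)%E by rewrite mule_ge0// lee_fin invr_ge0 ltW.
have -> : jump_measure A = (T%:E * (sig%:E * \int[QV]_v F' v))%E.
  rewrite jump_measure_section ge0_integralZl//; last by rewrite lee_fin invr_ge0 ltW.
  rewrite !muleA -!EFinM [X in X%:E](_ : _ = 1) ?mul1e//.
  by field; rewrite !gt_eqF.
rewrite QV_mixture//; congr (_ * _)%E; apply: eq_integral => u; rewrite inE => su.
have posE (r : R) : (Rpos : set mR) r -> 0 < r by rewrite /Rpos/= in_itv/= andbT.
pose G (rs : mR * R) : \bar R :=
  ((\1_A (vscale rs.1 u))%:E * (radial_density alpha p rs.2 rs.1)%:E)%E.
have mG : measurable_fun setT G.
  apply: emeasurable_funM.
    apply/measurable_EFinP; apply: (measurableT_comp (measurable_indic mA)).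
    by apply: measurable_vscale; [exact: measurable_fst|exact: measurable_cst].
  apply/measurable_EFinP; apply: measurable_funM; last first.
    exact: (measurableT_comp (measurable_powR _) measurable_fst).
  apply: measurableT_comp => //; apply: measurableT_comp => //.
  apply: measurable_funM; first exact: measurable_snd.
  exact: (measurableT_comp (measurable_powR _) measurable_fst).
have G0 z : (0 <= G z)%E by rewrite mule_ge0// lee_fin// radial_density_ge0.
pose Pu : probability R R := prob_of (prob_kernel (s := Qk) u).
(* At [v = s u] the length is [s] and the direction [u]. Exchanging the integrals in [s] and [r]
   then makes the inner one the tempering function at the power [p] of [r]. *)
transitivity (\int[Pu]_(s in Rpos) \int[mu]_(r in Rpos) G (r, s))%E.
  apply: eq_integral => s; rewrite inE => /posE s0.
  have sv : vnorm (vscale s u) = s by rewrite vnormZ su mulr1 gtr0_norm.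
  rewrite /F' F_radial sv// muleA -EFinM mulVf ?gt_eqF// mul1e.
  apply: eq_integral => r _; rewrite /G/=; congr ((\1_A _)%:E * _)%E.
  by apply: eq_from_tnth => i; rewrite !tnth_vscale mulrA divfK// gt_eqF.
rewrite -(tonelli_in (mu : {sigma_finite_measure set mR -> \bar R}) Pu)//.
apply: eq_integral => r; rewrite inE => /posE r0.
have me : measurable_fun Rpos (fun s : R => (expR (- (r `^ p * s)))%:E : \bar R).
  apply/measurable_EFinP/measurable_funTS.
  by apply: measurableT_comp => //; apply: measurableT_comp.
have e0 (s : R) : Rpos s -> (0 <= (expR (- (r `^ p * s)))%:E :> \bar R)%E.
  by rewrite lee_fin expR_ge0.
have p0' : (0 <= (r `^ (- alpha - 1))%:E :> \bar R)%E by rewrite lee_fin powR_ge0.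
rewrite /temp_q -muleA -ge0_integralZr//.
rewrite -ge0_integralZl//.
- by apply: eq_integral => s _; rewrite /G /radial_density/= EFinM [r `^ p * s]mulrC.
- by apply: emeasurable_funM => //; exact: measurable_cst.
- by move=> s ss; rewrite mule_ge0// e0.
Qed.

End jump_measureE.

End levy_measure.

Lemma RE_prod d1 d2 (T1 : measurableType d1) (T2 : measurableType d2) (R : realType)
    (P1 : probability T1 R) (P2 : probability T2 R) (f : T1 * T2 -> R) : bmf f ->
  \int[(P1 \x P2)%E]_z f z = \int[P1]_x \int[P2]_y f (x, y).
Proof.
move=> bf; pose P12 : probability (T1 * T2)%type R := (P1 \x P2)%E.
have intf := bmf_integrable P12 bf.
congr fine; rewrite -integral12_prod_meas1//; apply: eq_integral => x _.
by rewrite /fubini_F/= RE_EFin//; apply: (bmf_comp _ bf); exact: pair1_measurable.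
Qed.

Lemma integral_mscale_signed d (T : measurableType d) (R : realType)
    (m : {measure set T -> \bar R}) (k : {nonneg R}) (f : T -> \bar R) :
  m.-integrable setT f -> (\int[mscale k m]_x f x = k%:num%:E * \int[m]_x f x)%E.
Proof.
move=> intf; have mf := measurable_int _ intf.
rewrite [LHS]integralE [X in (_ = _ * X)%E]integralE ge0_integral_mscale//;
  first rewrite ge0_integral_mscale//.
- have fp := integrable_pos_fin_num measurableT intf.
  have fn := integrable_neg_fin_num measurableT intf.
  by rewrite -(fineK fp) -(fineK fn) -EFinB -!EFinM mulrBr.
- exact: measurable_funeneg.
- exact: measurable_funepos.
Qed.

(** * Integrability against the Levy measure *)

Section power_tail.
Context {R : realType}.
Local Notation mu := (@lebesgue_measure R).
Local Notation mR := (measurableTypeR R).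

(** Majorant in the arrival time: constant near 0, where only boundedness of the test function
    helps, and a power beyond 1, where jumps are small. *)
Definition power_tail (C C' b : R) (x : mR) : R :=
  C * \1_(`]0, 1]%classic : set mR) x +
  C' * (x `^ (- b - 1) * \1_(`]1, +oo[%classic : set mR) x).

Lemma measurable_power_tail C C' b : measurable_fun setT (power_tail C C' b).
Proof.
apply: measurable_funD; apply: measurable_funM; try exact: measurable_cst.
  exact: measurable_indic.
by apply: measurable_funM; [exact: measurable_powR|exact: measurable_indic].
Qed.

Lemma integrable_power_tail C C' b : 0 < b -> mu.-integrable setT (EFin \o power_tail C C' b).
Proof.
move=> b0.
have i1 : mu.-integrable setT (EFin \o (\1_(`]0, 1]%classic : set mR) : mR -> R)).
  apply/integrableP; split; first by apply/measurable_EFinP; exact: measurable_indic.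
  under eq_integral do rewrite /= ger0_norm//.
  rewrite integral_indic// setIT [X in (X < _)%E]lebesgue_measure_itv/= lte_fin ltr01.
  by rewrite oppr0 adde0 ltry.
have i2 : mu.-integrable setT
    (EFin \o (fun x : mR => x `^ (- b - 1) * \1_(`]1, +oo[%classic : set mR) x)).
  apply/integrableP; split.
    by apply/measurable_EFinP; apply: measurable_funM; [exact: measurable_powR|exact: measurable_indic].
  under eq_integral do rewrite /= ger0_norm ?mulr_ge0 ?powR_ge0// EFinM.
  have -> : (\int[mu]_x ((x `^ (- b - 1))%:E * (\1_(`]1, +oo[%classic : set mR) x)%:E) =
    \int[mu]_(r in `]1%R, +oo[) (radial_density b 1 0 r)%:E)%E.
    rewrite [RHS]integral_mkcond epatch_indic; apply: eq_integral => x _.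
    by rewrite /radial_density mul0r oppr0 expR0 mul1r.
  (* With [s = 0] there is no tempering: at [a = 1] the formula says that [b] times the integral of
     the power is 1, so the integral is finite. *)
  have := @tail_radial_density R b 1 0 b0 1 ltr01.
  rewrite powR1; under eq_integral do rewrite !mul0r oppr0 expR0.
  rewrite integral_cst// [X in (1 * X)%E]lebesgue_measure_itv/= lte_fin ltr01 oppr0 adde0 mule1.
  case: (\int[_]_(_ in _) _)%E => [r _|h|h]; first exact: ltry.
    by move: h; rewrite gt0_muley// lte_fin mulr1.
  by [].
have j1 := integrableZl measurableT C i1; have j2 := integrableZl measurableT C' i2.
apply: eq_integrable (integrableD measurableT j1 j2) => // x _ /=.
Qed.

End power_tail.

Lemma vnorm_vzero (R : realType) (n : nat) : vnorm (@vzero R n) = 0.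
Proof.
by rewrite /vnorm /vdot big1 ?sqrtr0// => i _; rewrite tnth_vzero mulr0.
Qed.

Section levy_integrals.
Context {R : realType} {n : nat}.
Local Notation mu := (@lebesgue_measure R).
Local Notation mR := (measurableTypeR R).
Local Notation Rn := (n.-tuple R).
Local Notation unif01 := (uniform_prob (@ltr01 R)).
Variables (sigma : {finite_measure set Rn -> \bar R}) (Qk : R.-pker Rn ~> R).
Variables (alpha p T : R) (QV : probability Rn R).
Local Notation sig := (fine (sigma setT)).
Hypotheses (al0 : 0 < alpha) (p0 : 0 < p) (T0 : 0 < T) (sig0 : 0 < sig).
Hypothesis Qk_pos : forall u, sphere u -> Qk u Rpos = 1%E.
Hypothesis QVE : forall A : set Rn, measurable A ->
  QV A = (measQ sigma Qk A * (sig^-1)%:E)%E.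
Local Notation jmap := (jump_map sigma alpha p T).
Local Notation base := (jump_base QV).
Local Notation marks := (jump_mark_law QV).
Local Notation M := (levy_M sigma Qk alpha p).

Let iT_ge0 : 0 <= T^-1. Proof. by rewrite invr_ge0 ltW. Qed.
Let iT : {nonneg R} := NngNum iT_ge0.

(** A genuine measure to integrate against. It charges the origin, where negative arrivals land, so
    it is compared with [levy_M] only on sets without the origin and for integrands vanishing
    there. *)
Definition levy_measure : {measure set Rn -> \bar R} :=
  mscale iT (jump_measure sigma alpha p T QV).

Lemma levy_M_measure A : measurable A -> ~ A vzero -> M A = levy_measure A.
Proof.
move=> mA A0; transitivity ((T^-1)%:E * jump_measure sigma alpha p T QV A)%E => //.
by rewrite (@jump_measureE R n sigma Qk alpha p T QV)// muleA -EFinM mulVf ?gt_eqF// mul1e.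
Qed.

Lemma levy_M_integral (h : Rn -> R) : h vzero = 0 ->
  (\int[M]_x (h x)%:E = \int[levy_measure]_x (h x)%:E)%E.
Proof.
move=> h0; apply: (@eq_raw_integral _ _ _ _ _ vzero); first by rewrite h0.
exact: levy_M_measure.
Qed.

Section dominated.
Variables (k : nat) (C : R) (h : Rn -> R).
Hypotheses (ak : alpha < k%:R) (C0 : 0 <= C) (bh : bmf h).
Hypothesis hC : forall x, `|h x| <= C * Num.min 1 (vnorm x ^+ k).

(** A jump at arrival [x] has norm at most [(c x)^(- 1/alpha)], so [h] is of order
    [x^(- k/alpha) = x^(- b - 1)], and [alpha < k] makes [b] positive. Used with [k = 2], and with
    [k = 1] when [alpha < 1]. *)
Let b := k%:R / alpha - 1.
Let c := alpha / (sig * T).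
Let D := power_tail C (C * c `^ (- (k%:R / alpha))) b.

Let b0 : 0 < b. Proof. by rewrite subr_gt0 ltr_pdivlMr// mul1r. Qed.
Let k0 : (0 < k)%N. Proof. by rewrite -(ltr_nat R) (lt_trans al0). Qed.
Let jump_dom z : `|h (jmap z)| <= D z.1.
Proof.
apply: (le_trans (hC _)).
have jl := @vnorm_jump_le R n alpha p T sig (Num.max z.1 0) z.2.2.1 z.2.1 z.2.2.2.
rewrite -[jump _ _ _ _ _ _ _ _]/(jmap z) in jl.
have e1 : (z.1 \in (`]0, 1]%classic : set mR)) = (0 < z.1 <= 1).
  by apply/idP/idP; rewrite inE/= in_itv.
have e2 : (z.1 \in (`]1, +oo[%classic : set mR)) = (1 < z.1).
  by apply/idP/idP; rewrite inE/= in_itv/= andbT.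
rewrite /D /power_tail !indicE e1 e2; have [x0|x0] := leP z.1 0.
  have v0 : vnorm (jmap z) = 0.
    apply/eqP; rewrite eq_le vnorm_ge0 andbT (le_trans jl)//.
    by rewrite (max_idPr x0) mulr0 mul0r powR0// oppr_eq0 invr_eq0 gt_eqF.
  have vk : vnorm (jmap z) ^+ k = 0 by rewrite v0 expr0n (gtn_eqF k0).
  by rewrite vk min_r// mulr0 addr_ge0 ?mulr_ge0 ?powR_ge0.
have [x1|x1] := leP z.1 1; rewrite /= ?mulr0 ?mulr1 ?addr0 ?add0r.
  by rewrite ler_piMr// ge_min lexx.
rewrite -mulrA ler_wpM2l//.
rewrite ge_min; apply/orP; right.
rewrite (max_idPl (ltW x0)) in jl.
apply: (@le_trans _ _ (((alpha * z.1 / (sig * T)) `^ (- alpha^-1)) ^+ k)).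
  by apply: lerXn2r => //; rewrite nnegrE ?vnorm_ge0 ?powR_ge0.
rewrite -powR_mulrn ?powR_ge0// -powRrM.
rewrite [alpha * _ / _](_ : _ = c * z.1); last by rewrite /c mulrAC.
rewrite powRM ?(ltW x0) ?divr_ge0 ?mulr_ge0 ?(ltW al0) ?(ltW T0) ?(ltW sig0)//.
rewrite le_eqVlt; apply/orP; left; apply/eqP; congr (_ `^ _ * _ `^ _); rewrite /b; field;
  by rewrite gt_eqF.
Qed.

Lemma jump_base_integrable : base.-integrable setT (EFin \o (h \o jmap)).
Proof.
have [mh _] := bh.
have mD : measurable_fun setT (fun z : mR * (mR * (mR * Rn)) => D z.1).
  exact: (measurableT_comp (measurable_power_tail _ _ _) measurable_fst).
have intD : base.-integrable setT (fun z => (D z.1)%:E).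
  apply/integrableP; split; first exact/measurable_EFinP.
  rewrite [X in (X < _)%E](@fubini_tonelli1 _ _ _ _ _ (mu : {measure set mR -> \bar R}) marks)//; last first.
    by apply: measurableT_comp => //; exact/measurable_EFinP.
  have /integrableP[_] := integrable_power_tail C (C * c `^ (- (k%:R / alpha))) b0.
  congr (_ < _)%E; apply: eq_integral => x _; rewrite /fubini_F.
  transitivity (\int[marks]_y cst (`|D x|%:E) y)%E => //.
  by rewrite integral_cst// [X in (_ * X)%E]probability_setT mule1.
apply: (le_integrable measurableT _ _ intD).
  by apply/measurable_EFinP; exact: (measurableT_comp mh (measurable_jump_map _ _ _ _)).
by move=> z _ /=; rewrite lee_fin (le_trans (jump_dom z)) ?ler_norm.
Qed.

Lemma levy_measure_integrable : levy_measure.-integrable setT (EFin \o h).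
Proof.
have [mh _] := bh.
apply/integrableP; split; first exact/measurable_EFinP.
rewrite [X in (X < _)%E]ge0_integral_mscale//; last first.
  by apply: measurableT_comp => //; exact/measurable_EFinP.
have mE : measurable_fun setT (EFin \o h) by exact/measurable_EFinP.
have /integrableP[_ /= fin] := @integrable_pushforward _ _ _ _ _ jmap (measurable_jump_map _ _ _ _)
  base setT (EFin \o h) mE jump_base_integrable measurableT.
by rewrite lte_mul_pinfty// lee_fin.
Qed.

Let sections x : bmf (fun y => h (jmap (x, y))).
Proof.
apply: (bmf_comp (f := h) _ bh).
by apply: (measurableT_comp (measurable_jump_map _ _ _ _)); exact: pair1_measurable.
Qed.

Lemma jump_mean_integrable :
  mu.-integrable setT (fun x : mR => (\int[marks]_y h (jmap (x, y)))%:E).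
Proof.
have := @integrable_fubini_F _ _ _ _ _ (mu : {measure set mR -> \bar R}) marks _ jump_base_integrable.
by apply: eq_integrable => // x _; rewrite /fubini_F/= RE_EFin.
Qed.

Lemma levy_measure_integral : T * \int[levy_measure]_x h x =
  \int[mu]_x \int[marks]_y h (jmap (x, y)).
Proof.
have [mh _] := bh.
have mE : measurable_fun setT (EFin \o h) by exact/measurable_EFinP.
have intp := @integrable_pushforward _ _ _ _ _ jmap (measurable_jump_map _ _ _ _)
  base setT (EFin \o h) mE jump_base_integrable measurableT.
have intb : (\int[base]_z (h (jmap z))%:E = \int[mu]_x (\int[marks]_y h (jmap (x, y)))%:E)%E.
  rewrite [LHS](esym (@integral12_prod_meas1 _ _ _ _ _ (mu : {measure set mR -> \bar R}) marks _ jump_base_integrable)).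
  by apply: eq_integral => x _; rewrite /fubini_F/= RE_EFin.
have -> : \int[levy_measure]_x h x = T^-1 * fine (\int[base]_z (h (jmap z))%:E)%E.
  rewrite /Rintegral [X in fine X](@integral_mscale_signed _ _ _ (jump_measure sigma alpha p T QV))//.
  rewrite [X in (_ * X)%E](@integral_pushforward _ _ _ _ _ jmap (measurable_jump_map _ _ _ _)
    base setT (EFin \o h) mE jump_base_integrable measurableT).
  rewrite preimage_setT fineM//; exact: (integrable_fin_num measurableT jump_base_integrable).
by rewrite intb mulrA mulfV ?gt_eqF// mul1r.
Qed.

End dominated.

(** The jump is odd in [V], so averaging over [V] alone already gives 0 for each value of the other
    variables. *)
Lemma odd_jump_mean (h : Rn -> R) x :
  (forall A : set Rn, measurable A -> QV (vopp @^-1` A) = QV A) ->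
  bmf h -> (forall v, h (vopp v) = - h v) -> \int[marks]_y h (jmap (x, y)) = 0.
Proof.
move=> sym bh odd.
have bs : bmf (fun y => h (jmap (x, y))).
  apply: (bmf_comp (f := h) _ bh).
  by apply: (measurableT_comp (measurable_jump_map _ _ _ _)); exact: pair1_measurable.
have bu u : bmf (fun ev => h (jmap (x, (u, ev)))).
  by apply: (bmf_comp _ bs); exact: pair1_measurable.
have E2 u e : \int[QV]_v h (jmap (x, (u, (e, v)))) = 0.
  have be : bmf (fun v => h (jmap (x, (u, (e, v))))).
    by apply: (bmf_comp _ (bu u)); exact: pair1_measurable.
  have := RE_sym sym be.
  rewrite /jump_map/=; under eq_Rintegral do rewrite jump_vopp odd -mulN1r.
  by rewrite REZ// => hh; lra.
have E1 u : \int[temper_law QV]_ev h (jmap (x, (u, ev))) = 0.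
  rewrite [LHS](@RE_prod _ _ _ _ _ (expo R) QV _ (bu u)).
  by under eq_Rintegral do rewrite E2; rewrite RE_cst.
rewrite [LHS](@RE_prod _ _ _ _ _ unif01 (temper_law QV) _ bs).
by under eq_Rintegral do rewrite E1; rewrite RE_cst.
Qed.

Lemma levy_M_is_levy_measure : alpha < 2 -> is_levy_measure M.
Proof.
move=> a2; split.
  rewrite /levy_M; apply: integral0_eq => u su; apply: integral0_eq => r.
  rewrite /Rpos/= in_itv/= andbT => r0; rewrite indicE memNset ?mul0e//= => ru.
  have : vnorm (vscale r u) = 0.
    by rewrite ru vnorm_vzero.
  by rewrite vnormZ su mulr1 gtr0_norm// => r00; rewrite r00 ltxx in r0.
pose h (x : Rn) := Num.min 1 (vnorm x ^+ 2).
have bh : bmf h.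
  split.
    apply: measurable_minr; first exact: measurable_cst.
    by apply: measurable_funX; exact: measurable_vnorm.
  by exists 1 => x; rewrite ger0_norm ?ge_min ?lexx// le_min ler01 exprn_ge0 ?vnorm_ge0.
have h0 : h vzero = 0.
  by rewrite /h vnorm_vzero expr0n min_r.
rewrite (levy_M_integral h0).
have hle x : `|h x| <= 1 * Num.min 1 (vnorm x ^+ 2).
  by rewrite mul1r ger0_norm// le_min ler01 exprn_ge0 ?vnorm_ge0.
by have /integrable_lty := levy_measure_integrable a2 ler01 bh hle; apply.
Qed.

End levy_integrals.

(** * Trigonometric bounds and the Levy-Khintchine exponent *)

Section trig_bounds.
Context {R : realType}.

Lemma mean_value_bound0 (f df : R -> R) (y K : R) : (forall x : R, is_derive x 1 f (df x)) ->
  (forall c, `|c| <= `|y| -> `|df c| <= K) -> `|f y - f 0| <= K * `|y|.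
Proof.
move=> Df dK.
have cf (A : set R) : {within A, continuous f}.
  apply: continuous_subspaceT => x; apply: differentiable_continuous.
  by apply/derivable1_diffP; have [] := Df x.
have [y0|y0] := leP 0 y.
  have [c] := @MVT_segment R f df 0 y y0 (fun x _ => Df x) (cf _).
  rewrite in_itv/= => /andP[c0 cy] ->; rewrite subr0 normrM ler_wpM2r//.
  by apply: dK; rewrite !ger0_norm.
have [c] := @MVT_segment R f df y 0 (ltW y0) (fun x _ => Df x) (cf _).
rewrite in_itv/= => /andP[cy c0]; rewrite distrC => ->; rewrite sub0r normrM normrN ler_wpM2r//.
by apply: dK; rewrite ler0_norm// ler0_norm ?(ltW y0)// lerN2.
Qed.

Lemma norm_sin_le (y : R) : `|sin y| <= `|y|.
Proof.
have := @mean_value_bound0 sin cos y 1; rewrite sin0 subr0 mul1r; apply.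
by move=> c _; exact: cos_max.
Qed.

Let derive_cos (x : R) : is_derive x 1 cos ((fun x => - sin x) x).
Proof. exact: is_derive_cos. Qed.

Lemma norm_cosB1_le (y : R) : `|cos y - 1| <= `|y|.
Proof.
have := @mean_value_bound0 cos (fun x => - sin x) y 1 derive_cos; rewrite cos0 mul1r; apply.
by move=> c _; rewrite normrN; exact: sin_max.
Qed.

Lemma norm_cosB1_le_sqr (y : R) : `|cos y - 1| <= y ^+ 2.
Proof.
have := @mean_value_bound0 cos (fun x => - sin x) y `|y| derive_cos.
rewrite cos0 -expr2 real_normK ?num_real//; apply.
by move=> c cy; rewrite normrN (le_trans (norm_sin_le c)).
Qed.

Lemma norm_sinB_le_sqr (y : R) : `|sin y - y| <= y ^+ 2.
Proof.
have D (x : R) : is_derive x 1 (fun x : R => sin x - x) ((fun x => cos x - 1) x).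
  exact: (@is_deriveB _ _ _ sin id x 1 (cos x) 1 (is_derive_sin x) (is_derive_id x 1)).
have := @mean_value_bound0 (fun x => sin x - x) (fun x => cos x - 1) y `|y| D.
rewrite sin0 !subr0 -expr2 real_normK ?num_real//; apply.
by move=> c cy; rewrite (le_trans (norm_cosB1_le c)).
Qed.

End trig_bounds.

Lemma Rintegral_sumr d (T : measurableType d) (R : realType) (m : {measure set T -> \bar R})
    (I : Type) (s : seq I) (f : I -> T -> R) :
  (forall i, m.-integrable setT (EFin \o f i)) ->
  m.-integrable setT (EFin \o (fun x => \sum_(i <- s) f i x)) /\
  \int[m]_x (\sum_(i <- s) f i x) = \sum_(i <- s) \int[m]_x f i x.
Proof.
move=> intf; elim: s => [|i s [ih1 ih2]].
  have E : (fun x => \sum_(i <- [::]) f i x) = (fun=> 0) by apply/funext => x; rewrite big_nil.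
  by rewrite E big_nil; split; [exact: integrable0|rewrite /Rintegral integral0].
have E : (fun x => \sum_(i <- i :: s) f i x) = (fun x => f i x + \sum_(i <- s) f i x).
  by apply/funext => x; rewrite big_cons.
split; first by rewrite E; apply: eq_integrable (integrableD measurableT (intf i) ih1).
by rewrite E RintegralD// big_cons ih2.
Qed.

Section levy_exponent.
Context {R : realType} {n : nat}.
Local Notation mu := (@lebesgue_measure R).
Local Notation mR := (measurableTypeR R).
Local Notation Rn := (n.-tuple R).
Variables (sigma : {finite_measure set Rn -> \bar R}) (Qk : R.-pker Rn ~> R).
Variables (alpha p T : R) (QV : probability Rn R).
Local Notation sig := (fine (sigma setT)).
Hypotheses (a02 : 0 < alpha < 2) (p0 : 0 < p) (T0 : 0 < T) (sig0 : 0 < sig).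
Hypothesis Qk_pos : forall u, sphere u -> Qk u Rpos = 1%E.
Hypothesis QVE : forall A : set Rn, measurable A ->
  QV A = (measQ sigma Qk A * (sig^-1)%:E)%E.
Hypothesis hcase : alpha < 1 \/
  (forall A : set Rn, measurable A -> QV (vopp @^-1` A) = QV A).
Local Notation jmap := (jump_map sigma alpha p T).
Local Notation marks := (jump_mark_law QV).
Local Notation M := (levy_M sigma Qk alpha p).
Local Notation Mm := (levy_measure sigma alpha p QV T0).

Let al0 : 0 < alpha. Proof. by case/andP: a02. Qed.
Let al2 : alpha < 2%:R. Proof. by case/andP: a02. Qed.

Let vdot0 (z : Rn) : vdot z vzero = 0.
Proof. by rewrite /vdot big1// => i _; rewrite tnth_vzero mulr0. Qed.

(** Merges a global bound and a bound of order [k] near the origin into the form expected by the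
    domination results. *)
Let dominate (k : nat) (h : Rn -> R) (a b : R) : 0 <= a -> 0 <= b ->
  (forall x, `|h x| <= a) -> (forall x, vnorm x <= 1 -> `|h x| <= b * vnorm x ^+ k) ->
  forall x, `|h x| <= (a + b) * Num.min 1 (vnorm x ^+ k).
Proof.
move=> a0 b0 ha hb x; have [x1|x1] := leP (vnorm x) 1.
  rewrite min_r ?exprn_ile1 ?vnorm_ge0// (le_trans (hb x x1))//.
  by rewrite ler_wpM2r ?exprn_ge0 ?vnorm_ge0// lerDr.
rewrite min_l ?mulr1; last by rewrite exprn_ege1// ltW.
by rewrite (le_trans (ha x))// lerDl.
Qed.

Let norm1 (z : Rn) : R := \sum_(i < n) `|tnth z i|.
Let norm1_ge0 z : 0 <= norm1 z. Proof. exact: sumr_ge0. Qed.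

Let sqr_vdot_le z x : vdot z x ^+ 2 <= norm1 z ^+ 2 * vnorm x ^+ 2.
Proof.
rewrite -exprMn -[leLHS]real_normK ?num_real//.
by apply: lerXn2r; rewrite ?nnegrE ?mulr_ge0 ?vnorm_ge0//; exact: vdot_le.
Qed.

(** [1 - cos] is of second order at the origin, so [k = 2] serves for all admissible [alpha]. *)
Lemma mean_cos (z : Rn) :
  mu.-integrable setT (fun x : mR => (\int[marks]_y (cos (vdot z (jmap (x, y))) - 1))%:E) /\
  \int[mu]_x \int[marks]_y (cos (vdot z (jmap (x, y))) - 1) = T * lk_re M z.
Proof.
pose h (x : Rn) := cos (vdot z x) - 1.
have bh : bmf h by apply: bmfB; [apply: bmf_cos; exact: measurable_vdot|exact: bmf_cst].
have hle : forall x, `|h x| <= (2 + norm1 z ^+ 2) * Num.min 1 (vnorm x ^+ 2).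
  apply: dominate; rewrite ?exprn_ge0// => x.
    by rewrite (le_trans (ler_normB _ _))// normr1 -[2]/(1 + 1) lerD2r cos_max.
  by move=> _; exact: le_trans (norm_cosB1_le_sqr _) (sqr_vdot_le _ _).
have C0 : 0 <= 2 + norm1 z ^+ 2 by rewrite addr_ge0// exprn_ge0.
split; first exact: (@jump_mean_integrable R n sigma alpha p T QV al0 T0 sig0 2 _ h al2 C0 bh hle).
rewrite -(@levy_measure_integral R n sigma alpha p T QV al0 T0 sig0 2 _ h al2 C0 bh hle).
rewrite /lk_re /Rintegral; congr (_ * fine _); apply/esym.
by apply: (@levy_M_integral R n sigma Qk) => //; rewrite /h vdot0 cos0 subrr.
Qed.

(** The sine is only of first order: integrable for [alpha < 1], and of mean 0 over a symmetric mark
    otherwise. The drift [b] accounts for the truncated linear term of the Levy-Khintchine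
    formula. *)
Lemma mean_sin : exists b : Rn, forall z : Rn,
  mu.-integrable setT (fun x : mR => (\int[marks]_y sin (vdot z (jmap (x, y))))%:E) /\
  \int[mu]_x \int[marks]_y sin (vdot z (jmap (x, y))) = T * lk_im M b z.
Proof.
pose ind (x : Rn) : R := \1_[set y | (vnorm y <= 1)%R] x.
have ind0 x : 1 < vnorm x -> ind x = 0.
  by move=> x1; rewrite /ind indicE memNset//=; apply/negP; rewrite -ltNge.
have ind1 x : vnorm x <= 1 -> ind x = 1 by move=> x1; rewrite /ind indicE mem_set.
have mind : measurable_fun setT ind.
  apply: measurable_indic; rewrite -[X in measurable X]setTI.
  by apply: measurable_fun_le => //; exact: measurable_vnorm.
have rest z (h := fun x => sin (vdot z x) - vdot z x * ind x) : bmf h /\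
    forall x, `|h x| <= (1 + norm1 z + norm1 z ^+ 2) * Num.min 1 (vnorm x ^+ 2).
  have dom : forall x, `|h x| <= (1 + norm1 z + norm1 z ^+ 2) * Num.min 1 (vnorm x ^+ 2).
    apply: dominate; rewrite ?addr_ge0 ?exprn_ge0// => x; rewrite /h; last first.
      move=> /ind1->; rewrite mulr1.
      by exact: le_trans (norm_sinB_le_sqr _) (sqr_vdot_le _ _).
    have [x1|x1] := leP (vnorm x) 1; last first.
      by rewrite ind0// mulr0 subr0 (le_trans (sin_max _))// lerDl.
    rewrite ind1// mulr1 (le_trans (ler_normB _ _))// lerD ?sin_max//.
    by apply: (le_trans (vdot_le _ _)); apply: ler_piMr => //; exact: norm1_ge0.
  split=> //; split; last first.
    exists (1 + norm1 z + norm1 z ^+ 2) => x; rewrite (le_trans (dom x))//.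
    by rewrite ler_piMr ?addr_ge0 ?exprn_ge0// ge_min lexx.
  apply: measurable_funB; first by have [] := bmf_sin (measurable_vdot z).
  by apply: measurable_funM => //; exact: measurable_vdot.
have lkE z : fine (\int[M]_x (sin (vdot z x) - vdot z x * ind x)%:E)%E =
    \int[Mm]_x (sin (vdot z x) - vdot z x * ind x).
  congr fine; apply: (@levy_M_integral R n sigma Qk) => //.
  by rewrite vdot0 sin0 mul0r subrr.
have bsin z : bmf (fun x : Rn => sin (vdot z x)) by apply: bmf_sin; exact: measurable_vdot.
have C2 z : 0 <= 1 + norm1 z + norm1 z ^+ 2 by rewrite !addr_ge0 ?exprn_ge0.
case: hcase => [a1|sym]; last first.
  (* Both the sine and its compensated version are odd, so all means vanish and the drift is
     zero. *)
  exists vzero => z.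
  have E x : \int[marks]_y sin (vdot z (jmap (x, y))) = 0.
    apply: (@odd_jump_mean R n sigma alpha p T QV (fun v => sin (vdot z v)) x sym) => //.
    by move=> v; rewrite vdotNr sinN.
  split; first by under eq_fun do rewrite E; exact: integrable0.
  under eq_Rintegral do rewrite E.
  rewrite /Rintegral integral0/= /lk_im lkE.
  have [bh hle] := rest z.
  suff -> : \int[Mm]_x (sin (vdot z x) - vdot z x * ind x) = 0.
    by rewrite addr0 /vdot big1 ?mulr0// => i _; rewrite tnth_vzero mul0r.
  apply: (mulfI (lt0r_neq0 T0)).
  rewrite (@levy_measure_integral R n sigma alpha p T QV al0 T0 sig0 2 _ _ al2 (C2 z) bh hle) mulr0.
  have E' x : \int[marks]_y (sin (vdot z (jmap (x, y))) - vdot z (jmap (x, y)) * ind (jmap (x, y))) = 0.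
    apply: (@odd_jump_mean R n sigma alpha p T QV
      (fun v => sin (vdot z v) - vdot z v * ind v) x sym) => //.
    move=> v; have -> : ind (vopp v) = ind v by rewrite /ind !indicE /in_mem/= /in_set/= vnormN.
    by rewrite vdotNr sinN mulNr opprB opprK addrC.
  by under eq_Rintegral do rewrite E'; rewrite /Rintegral integral0.
have a11 : alpha < 1%:R by [].
have dsin z : forall x, `|sin (vdot z x)| <= (1 + norm1 z) * Num.min 1 (vnorm x ^+ 1).
  apply: dominate => // x; first exact: sin_max.
  by move=> _; rewrite expr1 (le_trans (norm_sin_le _))// vdot_le.
have C1 z : 0 <= 1 + norm1 z by rewrite addr_ge0.
have isin z := @levy_measure_integrable R n sigma alpha p T QV al0 T0 sig0 1 _ _ a11 (C1 z) (bsin z) (dsin z).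
have bcoord i : bmf (fun x : Rn => tnth x i * ind x).
  split; first by apply: measurable_funM => //; exact: measurable_tnth.
  exists 1 => x; rewrite normrM; have [x1|x1] := leP (vnorm x) 1; last by rewrite ind0// normr0 mulr0.
  by rewrite ind1// normr1 mulr1 (le_trans (coord_le_vnorm _ _)).
have dcoord i : forall x : Rn, `|tnth x i * ind x| <= (1 + 1) * Num.min 1 (vnorm x ^+ 1).
  apply: dominate => // x; rewrite normrM; last first.
    by move=> x1; rewrite ind1// normr1 mulr1 mul1r expr1 coord_le_vnorm.
  have [x1|x1] := leP (vnorm x) 1; last by rewrite ind0// normr0 mulr0.
  by rewrite ind1// normr1 mulr1 (le_trans (coord_le_vnorm _ _)).
have C11 : 0 <= 1 + 1 :> R by rewrite addr_ge0.
have icoord i := @levy_measure_integrable R n sigma alpha p T QV al0 T0 sig0 1 _ _ a11 C11 (bcoord i) (dcoord i).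
(* The truncated first moment, finite since [alpha < 1]; it restores the linear term subtracted in
   [lk_im]. *)
exists [tuple \int[Mm]_x (tnth x i * ind x) | i < n] => z.
split; first exact: (@jump_mean_integrable R n sigma alpha p T QV al0 T0 sig0 1 _ _ a11 (C1 z) (bsin z) (dsin z)).
rewrite -(@levy_measure_integral R n sigma alpha p T QV al0 T0 sig0 1 _ _ a11 (C1 z) (bsin z) (dsin z)).
congr (_ * _); rewrite /lk_im lkE.
have zi i : (Mm).-integrable setT (EFin \o (fun x : Rn => tnth z i * (tnth x i * ind x))).
  by apply: eq_integrable (integrableZl measurableT (tnth z i) (icoord i)).
have [isum sumE] := @Rintegral_sumr _ _ _ Mm _ (index_enum 'I_n)
  (fun i (x : Rn) => tnth z i * (tnth x i * ind x)) zi.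
have vE x : vdot z x * ind x = \sum_(i < n) tnth z i * (tnth x i * ind x).
  by rewrite /vdot mulr_suml; apply: eq_bigr => i _; rewrite mulrA.
under [X in _ = _ + X]eq_Rintegral do rewrite vE.
rewrite RintegralB// sumE.
rewrite [X in X + _](_ : _ = \sum_(i < n) \int[Mm]_x (tnth z i * (tnth x i * ind x))).
  by rewrite addrC subrK.
apply: eq_bigr => i _; rewrite tnth_mktuple RintegralZl// mulrC//.
Qed.

End levy_exponent.

Lemma cvg_sumr (R : realType) (T I : Type) (F : set_system T) (FF : Filter F) (s : seq I)
    (f : I -> T -> R) (l : I -> R) : (forall i, f i x @[x --> F] --> l i) ->
  (fun x => \sum_(i <- s) f i x) @ F --> \sum_(i <- s) l i.
Proof.
move=> fl; elim: s => [|i s ih].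
  by rewrite big_nil; under eq_fun do rewrite big_nil; exact: cvg_cst.
by rewrite big_cons; under eq_fun do rewrite big_cons; exact: cvgD (fl i) ih.
Qed.

(** At most one summand is present, so functions vanishing at 0 act additively. This splits [g - 1]
    over the increments, the analytic source of their independence. *)
Lemma trig_disjoint (R : realType) (N : nat) (b : 'I_N -> bool) (y : 'I_N -> R) :
  (forall k l, b k -> b l -> k = l) ->
  cos (\sum_(k < N) (b k)%:R * y k) - 1 = \sum_(k < N) (b k)%:R * (cos (y k) - 1) /\
  sin (\sum_(k < N) (b k)%:R * y k) = \sum_(k < N) (b k)%:R * sin (y k).
Proof.
move=> db; case: (pickP b) => [k bk|nb].
  have E (f : 'I_N -> R) : \sum_(k < N) (b k)%:R * f k = f k.
    rewrite (bigD1 k)//= bk mul1r big1 ?addr0// => l lk.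
    by case: (boolP (b l)) => [bl|_]; [rewrite (db _ _ bl bk) eqxx in lk|rewrite mul0r].
  by rewrite !E.
have E (f : 'I_N -> R) : \sum_(k < N) (b k)%:R * f k = 0.
  by rewrite big1// => l _; rewrite nb mul0r.
by rewrite !E cos0 sin0 subrr.
Qed.

(** * Joint characteristic function of the increments *)

Section joint_chf.
Context {R : realType} {n : nat} d (Om : measurableType d) (P : probability Om R).
Local Notation mu := (@lebesgue_measure R).
Local Notation mR := (measurableTypeR R).
Local Notation Rn := (n.-tuple R).
Variables (sigma : {finite_measure set Rn -> \bar R}) (Qk : R.-pker Rn ~> R).
Variables (E E' Tt U : nat -> {RV P >-> R}) (V : nat -> {RV P >-> n.-tuple R}).
Variables (alpha p T : R) (hT : 0 < T) (QV : probability Rn R).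
Local Notation sig := (fine (sigma setT)).
Hypothesis lE : forall j (A : set R), measurable A ->
  distribution P (E j) A = exponential_prob 1 A.
Hypothesis lE' : forall j (A : set R), measurable A ->
  distribution P (E' j) A = exponential_prob 1 A.
Hypothesis lT : forall j (A : set R), measurable A ->
  distribution P (Tt j) A = uniform_prob hT A.
Hypothesis lU : forall j (A : set R), measurable A ->
  distribution P (U j) A = uniform_prob ltr01 A.
Hypothesis lV : forall j (A : set Rn), measurable A ->
  distribution P (V j) A = QV A.
Hypothesis indep : mutually_independent P (ts_events E E' Tt U V).
Hypotheses (a02 : 0 < alpha < 2) (p0 : 0 < p) (sig0 : 0 < sig).
Local Notation jmap := (jump_map sigma alpha p T).
Local Notation marks := (jump_mark_law QV).
Local Notation marksp := (mR * (mR * (mR * Rn)))%type.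
Local Notation kappa := (ts_mark_law hT QV).
Local Notation M := (levy_M sigma Qk alpha p).
Local Notation L := (ts_limit E E' Tt U V alpha p T sig).
Local Notation partial := (ts_partial alpha p T sig (fun j => E j) (fun j => E' j)
  (fun j => Tt j) (fun j => U j) (fun j => V j)).
Hypothesis ucs : {ae P, forall w, uniform_cauchy (fun k t => partial k t w)}.
Variable b : Rn.
Hypothesis cosM : forall z,
  mu.-integrable setT (fun x : mR => (\int[marks]_y (cos (vdot z (jmap (x, y))) - 1))%:E) /\
  \int[mu]_x \int[marks]_y (cos (vdot z (jmap (x, y))) - 1) = T * lk_re M z.
Hypothesis sinM : forall z,
  mu.-integrable setT (fun x : mR => (\int[marks]_y sin (vdot z (jmap (x, y))))%:E) /\
  \int[mu]_x \int[marks]_y sin (vdot z (jmap (x, y))) = T * lk_im M b z.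

Let al0 : 0 < alpha. Proof. by case/andP: a02. Qed.

Let vdotz0 (v : Rn) : vdot v vzero = 0.
Proof. by rewrite /vdot big1// => i _; rewrite tnth_vzero mulr0. Qed.

Let nRpos (x : mR) : x <= 0 -> ~ (Rpos : set mR) x.
Proof. by move=> x0; rewrite /Rpos/= in_itv/= andbT; apply/negP; rewrite -leNgt. Qed.

Let jmap_le0 (x : mR) y : x <= 0 -> jmap (x, y) = vzero.
Proof.
move=> x0; apply: vnorm_eq0; apply/eqP; rewrite eq_le vnorm_ge0 andbT.
apply: (le_trans (@vnorm_jump_le R n alpha p T sig (Num.max x 0) y.2.1 y.1 y.2.2)).
by rewrite (max_idPr x0) mulr0 mul0r powR0// oppr_eq0 invr_eq0 gt_eqF.
Qed.

Let mark_split (A : set mR) (f : mR * (mR * Rn) -> R) : measurable A -> bmf f ->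
  \int[kappa]_m (\1_A m.1 * f m.2) = fine (uniform_prob hT A) * \int[marks]_y f y.
Proof.
move=> mA bf.
have b1 : bmf (fun m : mR * (mR * (mR * Rn)) => \1_A m.1 * f m.2 : R).
  apply: bmfM; first exact: (bmf_comp measurable_fst (bmf_indic _ mA)).
  exact: (bmf_comp measurable_snd bf).
rewrite [LHS](@RE_prod _ _ _ _ _ (uniform_prob hT) marks _ b1)/=.
under eq_Rintegral do rewrite REZ// mulrC.
by rewrite REZ ?RE_indic 1?mulrC//; exact: bmf_indic.
Qed.

Let unif_itv (s t : R) : 0 <= s -> s <= t -> t <= T ->
  fine (uniform_prob hT (`]s, t]%classic : set mR)) = (t - s) / T.
Proof.
move=> s0 st tT.
have mI : measurable (`]s, t]%classic : set mR) by exact: measurable_itv.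
rewrite -RE_indic// /Rintegral integral_uniform//; last first.
  by apply/measurable_EFinP; exact: measurable_indic.
rewrite integral_indic// (setIidl _); last first.
  move=> x /=; rewrite !in_itv/= => /andP[sx xt].
  by rewrite (le_trans xt)// andbT ltW// (le_lt_trans s0).
rewrite [X in (_ * X)%E]lebesgue_measure_itv/= lte_fin subr0.
have [st'|ts] := ltP s t; first by rewrite -EFinB -EFinM/= mulrC.
have -> : t = s by apply/eqP; rewrite eq_le ts.
by rewrite mule0/= subrr mul0r.
Qed.

Section partition.
Variables (N : nat) (t : nat -> R) (z : nat -> Rn).
Hypotheses (t0 : 0 <= t 0) (tm : forall k, (k < N)%N -> t k <= t k.+1) (tT : t N <= T).

Let tmono j k : (j <= k)%N -> (k <= N)%N -> t j <= t k.
Proof.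
elim: k => [|k ih] jk kN; first by move: jk; rewrite leqn0 => /eqP->.
move: jk; rewrite leq_eqVlt => /predU1P[->//|jk].
by apply: (le_trans (ih jk (ltnW kN))); exact: tm.
Qed.

Let Ik (k : nat) : set mR := `]t k, t k.+1]%classic.

Let mIk k : measurable (Ik k). Proof. exact: measurable_itv. Qed.

Let Ik_disjoint (s : mR) (k l : 'I_N) : s \in Ik k -> s \in Ik l -> k = l.
Proof.
rewrite !inE /Ik/= !in_itv/= => /andP[k1 k2] /andP[l1 l2]; apply/val_inj/eqP => /=.
rewrite eqn_leq; apply/andP; split; rewrite leqNgt; apply/negP => h.
  by have := le_lt_trans (le_trans l2 (tmono h (ltnW (ltn_ord k)))) k1; rewrite ltxx.
by have := le_lt_trans (le_trans k2 (tmono h (ltnW (ltn_ord l)))) l1; rewrite ltxx.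
Qed.

(** Contribution of one marked jump to the joint exponent: its time selects the increment, and
    thereby the frequency [z k]. *)
Definition increment_phase (x : R) (m : marksp) : R :=
  \sum_(k < N) \1_(Ik k) m.1 * vdot (z k) (jump alpha p T sig x m.2.2.1 m.2.1 m.2.2.2).
Local Notation theta := increment_phase.

Let mtheta : measurable_fun setT (fun y : mR * marksp => theta y.1 y.2).
Proof.
apply: (@measurable_sum _ _ R setT _ (index_enum 'I_N) (fun k (y : mR * marksp) =>
  \1_(Ik k) y.2.1 * vdot (z k) (jump alpha p T sig y.1 y.2.2.2.1 y.2.2.1 y.2.2.2.2))) => k.
have m2 : measurable_fun setT (fun y : mR * marksp => y.2.2).
  exact: (measurableT_comp measurable_snd measurable_snd).
have m3 : measurable_fun setT (fun y : mR * marksp => y.2.2.2).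
  exact: (measurableT_comp measurable_snd m2).
apply: measurable_funM.
  apply: (measurableT_comp (measurable_indic (mIk k))).
  exact: (measurableT_comp measurable_fst measurable_snd).
apply: (measurableT_comp (measurable_vdot (z k))); apply: measurable_jump.
- exact: measurable_fst.
- exact: (measurableT_comp measurable_fst m3).
- exact: (measurableT_comp measurable_fst m2).
- exact: (measurableT_comp measurable_snd m3).
Qed.

Let weight (k : nat) : R := (t k.+1 - t k) / T.

Let weightE (k : 'I_N) : fine (uniform_prob hT (Ik k)) = weight k.
Proof.
apply: unif_itv; first exact: (le_trans t0 (tmono (leq0n k) (ltnW (ltn_ord k)))).
  exact: tm.
by apply: le_trans tT; exact: tmono.
Qed.

Let phase_jmap (x : R) (m : marksp) : 0 < x ->
  theta x m = \sum_(k < N) (m.1 \in Ik k)%:R * vdot (z k) (jmap (x, m.2)).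
Proof.
move=> x0; apply: eq_bigr => k _; rewrite indicE; congr (_ * vdot _ _).
by rewrite /jump_map/= (max_idPl (ltW x0)).
Qed.

Let bjc k x : bmf (fun y => cos (vdot (z k) (jmap (x, y))) - 1).
Proof.
apply: bmfB; last exact: bmf_cst.
apply: bmf_cos; apply: (measurableT_comp (measurable_vdot _)).
by apply: (measurableT_comp (measurable_jump_map _ _ _ _)); exact: pair1_measurable.
Qed.

Let bjs k x : bmf (fun y => sin (vdot (z k) (jmap (x, y)))).
Proof.
apply: bmf_sin; apply: (measurableT_comp (measurable_vdot _)).
by apply: (measurableT_comp (measurable_jump_map _ _ _ _)); exact: pair1_measurable.
Qed.

Let bsplit (f : mR * (mR * Rn) -> R) k : bmf f ->
  bmf (fun m : marksp => \1_(Ik k) m.1 * f m.2).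
Proof.
move=> bf; apply: bmfM; first exact: (bmf_comp measurable_fst (bmf_indic _ (mIk k))).
exact: (bmf_comp measurable_snd bf).
Qed.

Let mark_cosE : renewal_re (mark_cos kappa theta) =
  fun x => \sum_(k < N) weight k * \int[marks]_y (cos (vdot (z k) (jmap (x, y))) - 1).
Proof.
apply/funext => x; rewrite /renewal_re indicE; have [x0|x0] := ltP 0 x; last first.
  rewrite memNset ?mulr0; last exact: nRpos.
  rewrite big1// => k _; under eq_Rintegral do rewrite jmap_le0// vdotz0 cos0 subrr.
  by rewrite RE_cst mulr0.
rewrite mem_set ?mulr1; last by rewrite /Rpos/= in_itv/= andbT.
have bc : bmf (fun m => cos (theta x m)).
  by apply: bmf_cos; exact: (measurableT_comp mtheta (@pair1_measurable _ _ mR marksp x)).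
rewrite /mark_cos -[X in _ - X](RE_cst kappa 1) -REB//; last exact: bmf_cst.
under eq_Rintegral => m _.
  rewrite (phase_jmap _ x0).
  have [-> _] := @trig_disjoint R N (fun k => m.1 \in Ik k)
    (fun k => vdot (z k) (jmap (x, m.2))) (Ik_disjoint (s := m.1)).
  over.
rewrite (@RE_sum _ _ _ kappa _ (index_enum 'I_N)
  (fun k m => (m.1 \in Ik k)%:R * (cos (vdot (z k) (jmap (x, m.2))) - 1))).
  by apply: eq_bigr => k _; rewrite -weightE -mark_split.
by move=> k; exact: (bsplit k (bjc k x)).
Qed.

Let mark_sinE : renewal_im (mark_sin kappa theta) =
  fun x => \sum_(k < N) weight k * \int[marks]_y sin (vdot (z k) (jmap (x, y))).
Proof.
apply/funext => x; rewrite /renewal_im indicE; have [x0|x0] := ltP 0 x; last first.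
  rewrite memNset ?mulr0; last exact: nRpos.
  rewrite big1// => k _; under eq_Rintegral do rewrite jmap_le0// vdotz0 sin0.
  by rewrite RE_cst mulr0.
rewrite mem_set ?mulr1; last by rewrite /Rpos/= in_itv/= andbT.
rewrite /mark_sin; under eq_Rintegral => m _.
  rewrite (phase_jmap _ x0).
  have [_ ->] := @trig_disjoint R N (fun k => m.1 \in Ik k)
    (fun k => vdot (z k) (jmap (x, m.2))) (Ik_disjoint (s := m.1)).
  over.
rewrite (@RE_sum _ _ _ kappa _ (index_enum 'I_N)
  (fun k m => (m.1 \in Ik k)%:R * sin (vdot (z k) (jmap (x, m.2))))).
  by apply: eq_bigr => k _; rewrite -weightE -mark_split.
by move=> k; exact: (bsplit k (bjs k x)).
Qed.

(** The [T] produced by the jump integrals cancels the [1 / T] of the uniform weights, leaving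
    interval lengths. *)
Let tail_sum (f : nat -> mR -> R) (c : nat -> R) (g : mR -> R) :
  g = (fun x => \sum_(k < N) weight k * f k x) ->
  (forall x, x <= 0 -> g x = 0) ->
  (forall k, mu.-integrable setT (EFin \o f k)) -> (forall k, \int[mu]_x f k x = T * c k) ->
  mu.-integrable setT (EFin \o g) /\ tail_int g 0 = \sum_(k < N) (t k.+1 - t k) * c k.
Proof.
move=> gE g0 intf fE.
have wi (k : 'I_N) : mu.-integrable setT (EFin \o (fun x => weight k * f k x)).
  by apply: eq_integrable (integrableZl measurableT (weight k) (intf k)).
have [i1 i2] := @Rintegral_sumr _ _ _ mu _ (index_enum 'I_N) (fun k x => weight k * f k x) wi.
split; first by rewrite gE.
rewrite /tail_int.
have -> : (fun x : mR => g x * \1_(`]0, +oo[%classic : set mR) x) = g.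
  apply/funext => x; rewrite indicE; have [x0|x0] := ltP 0 x; last by rewrite g0// mul0r.
  by rewrite mem_set ?mulr1//= in_itv/= andbT.
rewrite gE i2; apply: eq_bigr => k _; rewrite RintegralZl// fE /weight.
by field; rewrite gt_eqF.
Qed.

Let cosT := tail_sum (f := fun k x => \int[marks]_y (cos (vdot (z k) (jmap (x, y))) - 1))
  (c := fun k => lk_re M (z k)) mark_cosE.
Let sinT := tail_sum (f := fun k x => \int[marks]_y sin (vdot (z k) (jmap (x, y))))
  (c := fun k => lk_im M b (z k)) mark_sinE.

Let renewal0 (f : R -> R) (x : mR) : x <= 0 -> f x * \1_(Rpos : set mR) x = 0.
Proof.
by move=> x0; rewrite indicE memNset ?mulr0//; exact: nRpos.
Qed.

Let ctheta (x : R) m : 0 < x -> {for x, continuous (theta ^~ m)}.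
Proof.
move=> x0; apply: (@cvg_sumr _ _ _ (nbhs x) _ (index_enum 'I_N)
  (fun k y => \1_(Ik k) m.1 * vdot (z k) (jump alpha p T sig y m.2.2.1 m.2.1 m.2.2.2)) _) => k.
apply: cvgM; first exact: cvg_cst.
apply: (@cvg_sumr _ _ _ (nbhs x) _ (index_enum 'I_n)
  (fun i y => tnth (z k) i * tnth (jump alpha p T sig y m.2.2.1 m.2.1 m.2.2.2) i) _) => i.
by apply: cvgM; [exact: cvg_cst|exact: continuous_jump].
Qed.

Lemma joint_chf :
  let Z w := \sum_(k < N) vdot (z k) (vsub (L (t k.+1) w) (L (t k) w)) in
  let A := \sum_(k < N) (t k.+1 - t k) * lk_re M (z k) in
  let B := \sum_(k < N) (t k.+1 - t k) * lk_im M b (z k) in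
  \int[P]_w cos (Z w) = expR A * cos B /\ \int[P]_w sin (Z w) = expR A * sin B.
Proof.
move=> Z A B.
have [int1 A1] : mu.-integrable setT (EFin \o renewal_re (mark_cos kappa theta)) /\
    tail_int (renewal_re (mark_cos kappa theta)) 0 = A.
  apply: cosT => [x x0|k|k]; first exact: (renewal0 (fun x => mark_cos kappa theta x - 1)).
    by have [] := cosM (z k).
  by have [] := cosM (z k).
have [int2 B1] : mu.-integrable setT (EFin \o renewal_im (mark_sin kappa theta)) /\
    tail_int (renewal_im (mark_sin kappa theta)) 0 = B.
  apply: sinT => [x x0|k|k]; first exact: renewal0.
    by have [] := sinM (z k).
  by have [] := sinM (z k).
rewrite -A1 -B1.
pose F := ts_events E E' Tt U V.
(* [JE m] collects all variables of index below [m]; [JM m] adds the gap of index [m], which is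
   known before the mark of that index. *)
pose JE (m : nat) : set ('I_5 * nat) := [set i | (i.2 < m)%N].
pose JM m := JE m `|` [set @ix 1 isT m].
apply: (@marked_renewal_chf R d Om P _ mark_space kappa (fun j => E' j) (ts_mark E Tt U V)
  (fun m => pisys F (JM m)) (fun m => pisys F (JE m))).
- by move=> m; apply: pisys_measurable; exact: ts_events_measurable.
- by move=> m; apply: pisys_measurable; exact: ts_events_measurable.
- by move=> m; exact: measurable_funP.
- by move=> m; exact: (@measurable_ts_mark R n d Om P E E' Tt U V).
- move=> m j jm; apply: (@msub_E' R n d Om P E E' Tt U V).
  by move: jm; rewrite leq_eqVlt => /predU1P[->|jm]; [right|left].
- by move=> m j jm; apply: (@msub_mark R n d Om P E E' Tt U V) => i [[[]|]|] ->; left.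
- by move=> m j jm; apply: (@msub_E' R n d Om P E E' Tt U V).
- by move=> m j jm; apply: (@msub_mark R n d Om P E E' Tt U V) => i [[[]|]|] ->.
- move=> m; apply: (ts_mark_indep lE lT lU lV indep).
  apply/seteqP; split => // i [[im|->]].
    by case=> [[[]|]|] ie; move: im; rewrite ie /JE/= ltnn.
  by case=> [[[]|]|] /(congr1 (fun i => nat_of_ord i.1)).
- by move=> m; apply: (E'_indep lE' indep); rewrite /JE/= ltnn.
- exact: mtheta.
- exact: (arrival_ae_ge0 lE').
- exact: ctheta.
- exact: int1.
- exact: int2.
- exact: (arrival_cvgy lE' indep).
- apply: (@measurable_sum _ _ R setT _ (index_enum 'I_N)
    (fun k w => vdot (z k) (vsub (L (t k.+1) w) (L (t k) w)))) => k.
  apply: (measurableT_comp (measurable_vdot (z k))).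
  exact: measurable_increment.
apply: filterS ucs => w uc.
(* Interchanging sums turns the phases of the first [m] jumps into increments of the partial sum: as
   [t k >= 0], two indicators of intervals []0, t]] differ by that of []t k, t k.+1]]. *)
have E0 m : mark_sum (fun j => E' j) (ts_mark E Tt U V) theta m w =
    \sum_(k < N) \sum_(i < n) tnth (z k) i *
      (tnth (partial m (t k.+1) w) i - tnth (partial m (t k) w) i).
  rewrite /mark_sum /theta exchange_big/=; apply: eq_bigr => k _.
  rewrite /vdot; under eq_bigr do rewrite mulr_sumr.
  rewrite exchange_big/=; apply: eq_bigr => i _.
  rewrite !tnth_vsum -sumrB mulr_sumr; apply: eq_bigr => j _.
  rewrite mulrCA; congr (_ * _); rewrite !tnth_ts_term indicE.
  have tk0 : 0 <= t k by exact: (le_trans t0 (tmono (leq0n k) (ltnW (ltn_ord k)))).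
  have tk1 : t k <= t k.+1 by exact: tm.
  have -> : ((Tt j w : mR) \in Ik k) = (t k < Tt j w <= t k.+1).
    by apply/idP/idP; rewrite inE/= /Ik/= in_itv.
  have [h1|h1] := ltP (t k) (Tt j w).
    rewrite (le_lt_trans tk0 h1)/= subr0.
    by case: ifP => _; rewrite ?mul1r ?mul0r.
  rewrite mul0r (le_trans h1 tk1) andbT.
  by case: ifP => _; rewrite subrr.
under eq_fun do rewrite E0.
apply: (@cvg_sumr _ _ _ \oo _ (index_enum 'I_N)
  (fun k m => \sum_(i < n) tnth (z k) i *
      (tnth (partial m (t k.+1) w) i - tnth (partial m (t k) w) i)) _) => k.
apply: (@cvg_sumr _ _ _ \oo _ (index_enum 'I_n)
  (fun i m => tnth (z k) i *
      (tnth (partial m (t k.+1) w) i - tnth (partial m (t k) w) i)) _) => i.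
apply: cvgM; first exact: cvg_cst.
by rewrite tnth_vsub; apply: cvgB; exact: (@limit_path_cvg R n (fun k t => partial k t w) _ i uc).
Qed.

End partition.

End joint_chf.

Lemma law_of_chf {R : realType} d (Om : measurableType d) (P : probability Om R) (n : nat)
    (X1 X2 : Om -> n.-tuple R) (mX1 : measurable_fun setT X1) (mX2 : measurable_fun setT X2) :
  (forall z, \int[P]_w cos (vdot z (X1 w)) = \int[P]_w cos (vdot z (X2 w)) /\
             \int[P]_w sin (vdot z (X1 w)) = \int[P]_w sin (vdot z (X2 w))) ->
  forall B, measurable B -> P (X1 @^-1` B) = P (X2 @^-1` B).
Proof.
move=> chfE B mB.
have F z : \int[P]_w (1 * cos (0 + vdot z (X1 w))) = \int[P]_w (1 * cos (0 + vdot z (X2 w))) /\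
    \int[P]_w (1 * sin (0 + vdot z (X1 w))) = \int[P]_w (1 * sin (0 + vdot z (X2 w))).
  have add0 (X : Om -> n.-tuple R) (f : R -> R) :
      \int[P]_w (1 * f (0 + vdot z (X w))) = \int[P]_w f (vdot z (X w)).
    by apply: eq_Rintegral => w _; rewrite mul1r add0r.
  by rewrite !add0; exact: chfE.
have m0 : measurable_fun setT (fun _ : Om => 0 : R) by exact: measurable_cst.
have [u _] := fourier_unique (bmf_cst _ 1) (bmf_cst _ 1) m0 m0 mX1 mX2 F mB.
have PE (X : Om -> n.-tuple R) : measurable_fun setT X ->
    P (X @^-1` B) = (\int[P]_w (1 * \1_B (X w) * cos 0))%:E.
  move=> mX; have mS : measurable (X @^-1` B) by rewrite -[X in measurable X]setTI; exact: mX.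
  apply: (etrans (esym (fineK (fin_num_measure P _ mS)))); congr EFin.
  apply: (etrans (esym (RE_indic P mS))).
  by apply: eq_Rintegral => w _; rewrite mul1r cos0 mulr1.
by rewrite (PE X1 mX1) (PE X2 mX2); congr EFin; exact: u.
Qed.

(** * From characteristic functions to independence *)

Section independence_from_chf.
Context {R : realType} d (Om : measurableType d) (P : probability Om R) (n N : nat).
Variables (X : nat -> Om -> n.-tuple R) (re im : nat -> n.-tuple R -> R).
Hypothesis mX : forall k, measurable_fun setT (X k).
Hypothesis joint : forall z : nat -> n.-tuple R,
  let Z w := \sum_(0 <= k < N) vdot (z k) (X k w) in
  let a := \sum_(0 <= k < N) re k (z k) in
  let c := \sum_(0 <= k < N) im k (z k) in
  \int[P]_w cos (Z w) = expR a * cos c /\ \int[P]_w sin (Z w) = expR a * sin c.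
Hypothesis single : forall k z, (k < N)%N ->
  \int[P]_w cos (vdot z (X k w)) = expR (re k z) * cos (im k z) /\
  \int[P]_w sin (vdot z (X k w)) = expR (re k z) * sin (im k z).
Variable B : nat -> set (n.-tuple R).
Hypothesis mB : forall k, measurable (B k).

Let w1 m w : R := \prod_(0 <= k < m) \1_(B k) (X k w).
Let Pw m : R := \prod_(0 <= k < m) fine (P (X k @^-1` B k)).
Let rest z m w : R := \sum_(m <= k < N) vdot (z k) (X k w).

Let mXB k : measurable (X k @^-1` B k).
Proof. by rewrite -[X in measurable X]setTI; exact: mX. Qed.

Let bind k : bmf (fun w => \1_(B k) (X k w) : R).
Proof. exact: (bmf_indic _ (mXB k)). Qed.

Let bw1 m : bmf (w1 m).
Proof. by apply: bmf_prod => k; exact: bind. Qed.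

Let mvX k z : measurable_fun setT (fun w => vdot z (X k w)).
Proof. exact: (measurableT_comp (measurable_vdot z) (mX k)). Qed.

Let mrest z m : measurable_fun setT (rest z m).
Proof.
exact: (@measurable_sum _ _ R setT _ (index_iota m N) (fun k w => vdot (z k) (X k w))).
Qed.

(* Fourier uniqueness trades the exponentials for indicators one index at a time. *)
Let partial_chf m : (m <= N)%N -> forall z : nat -> n.-tuple R,
  let a := \sum_(m <= k < N) re k (z k) in
  let c := \sum_(m <= k < N) im k (z k) in
  \int[P]_w (w1 m w * cos (rest z m w)) = Pw m * (expR a * cos c) /\
  \int[P]_w (w1 m w * sin (rest z m w)) = Pw m * (expR a * sin c).
Proof.
elim: m => [_ z /=|m ih mN z a c].
  have [j1 j2] := joint z.
  have E w : w1 0 w = 1 by rewrite /w1 big_geq.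
  rewrite /Pw big_geq// !mul1r -j1 -j2.
  by split; apply: eq_Rintegral => w _; rewrite E mul1r.
pose z' zeta k := if k == m then zeta else z k.
have zE zeta (g : nat -> n.-tuple R -> R) :
    \sum_(m <= k < N) g k (z' zeta k) = g m zeta + \sum_(m.+1 <= k < N) g k (z k).
  rewrite big_ltn// /z' eqxx; congr (_ + _); apply: eq_big_nat => k /andP[mk _].
  by rewrite (gtn_eqF mk).
(* Fourier uniqueness compares [X m] under the true weight and phase with [X m] under the constant
   weight [K] and constant phase [c]; equality at all frequencies lets the indicator of [B m] enter
   both sides. *)
pose K := Pw m * expR a.
have F zeta :
    \int[P]_w (w1 m w * cos (rest z m.+1 w + vdot zeta (X m w))) =
      \int[P]_w (K * cos (c + vdot zeta (X m w))) /\
    \int[P]_w (w1 m w * sin (rest z m.+1 w + vdot zeta (X m w))) =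
      \int[P]_w (K * sin (c + vdot zeta (X m w))).
  have [] := ih (ltnW mN) (z' zeta); rewrite !zE -/a -/c.
  have rE w : rest (z' zeta) m w = rest z m.+1 w + vdot zeta (X m w).
    by rewrite /rest (zE zeta (fun k v => vdot v (X k w))) addrC.
  have bc := bmf_cos (mvX m zeta); have bs := bmf_sin (mvX m zeta).
  have bcs (u v : R) : bmf (fun w => u * cos (vdot zeta (X m w)) + v * sin (vdot zeta (X m w))).
    by apply: bmfD; apply: bmfM => //; exact: bmf_cst.
  have lin (u v : R) :
      \int[P]_w (u * cos (vdot zeta (X m w)) + v * sin (vdot zeta (X m w))) =
      expR (re m zeta) * (u * cos (im m zeta) + v * sin (im m zeta)).
    have [s1 s2] := single zeta mN.
    rewrite RED; try (apply: bmfM => //; exact: bmf_cst).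
    by rewrite !REZ// s1 s2; ring.
  move=> i1 i2; split.
    transitivity (\int[P]_w (w1 m w * cos (rest (z' zeta) m w))).
      by apply: eq_Rintegral => w _; rewrite rE.
    rewrite i1 expRD cosD.
    have E w : K * cos (c + vdot zeta (X m w)) =
        (K * cos c) * cos (vdot zeta (X m w)) + (- (K * sin c)) * sin (vdot zeta (X m w)).
      by rewrite cosD; ring.
    by under eq_Rintegral do rewrite E; rewrite lin /K; ring.
  transitivity (\int[P]_w (w1 m w * sin (rest (z' zeta) m w))).
    by apply: eq_Rintegral => w _; rewrite rE.
  rewrite i2 expRD sinD.
  have E w : K * sin (c + vdot zeta (X m w)) =
      (K * sin c) * cos (vdot zeta (X m w)) + (K * cos c) * sin (vdot zeta (X m w)).
    by rewrite sinD; ring.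
  by under eq_Rintegral do rewrite E; rewrite lin /K; ring.
have [u1 u2] := fourier_unique (bw1 m) (bmf_cst _ K) (mrest z m.+1) (measurable_cst c)
  (mX m) (mX m) F (mB m).
have wS w : w1 m.+1 w = w1 m w * \1_(B m) (X m w) by rewrite /w1 big_nat_recr.
have PS : Pw m.+1 = Pw m * fine (P (X m @^-1` B m)) by rewrite /Pw big_nat_recr.
have fin (e : R) : \int[P]_w (K * \1_(B m) (X m w) * e) = K * e * fine (P (X m @^-1` B m)).
  have E w : K * \1_(B m) (X m w) * e = K * e * \1_(X m @^-1` B m) w by rewrite mulrAC.
  by under eq_Rintegral do rewrite E; rewrite REZ ?RE_indic//; exact: bmf_indic.
split.
  under eq_Rintegral do rewrite wS.
  by apply: (etrans u1); apply: (etrans (fin (cos c))); rewrite PS /K; ring.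
under eq_Rintegral do rewrite wS.
by apply: (etrans u2); apply: (etrans (fin (sin c))); rewrite PS /K; ring.
Qed.

Lemma indep_of_chf :
  \int[P]_w \prod_(0 <= k < N) (\1_(B k) (X k w) : R) =
  \prod_(0 <= k < N) fine (P (X k @^-1` B k)).
Proof.
have [h _] := partial_chf (leqnn N) (fun=> vzero).
have S0 (g : nat -> R) : \sum_(N <= k < N) g k = 0 by rewrite big_geq.
rewrite -[RHS]/(Pw N); move: h; rewrite /= !S0 expR0 cos0 !mulr1 => <-; apply: eq_Rintegral => w _.
by rewrite /rest S0 cos0 mulr1.
Qed.

End independence_from_chf.

Section mutual_independence.
Context {R : realType} d (Om : measurableType d) (P : probability Om R) (n N : nat).
Variable X : nat -> Om -> n.-tuple R.
Hypothesis mX : forall k, measurable_fun setT (X k).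
Hypothesis prodX : forall B : nat -> set (n.-tuple R), (forall k, measurable (B k)) ->
  \int[P]_w \prod_(0 <= k < N) (\1_(B k) (X k w) : R) =
  \prod_(0 <= k < N) fine (P (X k @^-1` B k)).

Lemma mutually_independent_rv : mutually_independent P (fun k : 'I_N => rv_events (X k)).
Proof.
move=> J A AJ.
(* Indices outside [J] receive the whole space, which contributes factors 1 on both sides. *)
have /choice[f hf] : forall i : 'I_N, exists B : set (n.-tuple R),
    measurable B /\ (if i \in J then X i @^-1` B = A i else B = setT).
  move=> i; case: (boolP (i \in J)) => iJ; last by exists setT.
  by have [B mB BA] := AJ i iJ; exists B.
pose B k := oapp f setT (insub k : option 'I_N).
have mB k : measurable (B k) by rewrite /B; case: insub => //= i; have [] := hf i.
have BE (i : 'I_N) : B i = f i by rewrite /B valK.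
have := prodX mB.
rewrite [X in _ = X -> _]big_mkord; under eq_Rintegral do rewrite big_mkord.
have mA : measurable (\bigcap_(i in [set i | i \in J]) A i).
  apply: fin_bigcap_measurable; first exact: finite_finset.
  move=> i /= iJ; have [mfi] := hf i; rewrite iJ => <-.
  by rewrite -[X in measurable X]setTI; exact: mX.
have E w : \prod_(i < N) (\1_(B i) (X i w) : R) = \1_(\bigcap_(i in [set i | i \in J]) A i) w.
  rewrite indicE; case: (boolP (w \in _)) => wA.
    rewrite big1// => i _; rewrite BE indicE mem_set//; have [_] := hf i.
    case: ifPn => [iJ fA|_ ->//]; move: wA; rewrite inE => /(_ i iJ).
    by rewrite -fA.
  have /existsNP[i /not_implyP[iJ nA]] : ~ forall i, i \in J -> A i w.
    by move=> h; move/negP: wA; apply; rewrite inE.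
  rewrite (bigD1 i)//= BE indicE memNset ?mul0r// => fi; apply: nA.
  by have [_] := hf i; rewrite iJ => <-.
under eq_Rintegral do rewrite E; rewrite RE_indic// => PE.
rewrite -(fineK (fin_num_measure P _ mA)) PE.
rewrite (bigID (fun i => i \in J))/= [X in _ * X]big1 ?mulr1; last first.
  move=> i iJ; rewrite BE; have [_] := hf i; rewrite (negbTE iJ) => ->.
  by rewrite preimage_setT probability_setT.
have -> : (\prod_(i <- J) P (A i) = (\prod_(i <- J) fine (P (A i)))%:E)%E.
  rewrite (big_morph EFin EFinM (erefl 1%:E)) !big_seq; apply: eq_bigr => i iJ.
  have [mfi] := hf i; rewrite iJ => fA; rewrite fineK// fin_num_measure// -fA.
  by rewrite -[X in measurable X]setTI; exact: mX.
congr EFin; rewrite [RHS]big_uniq ?fset_uniq//; apply: eq_bigr => i iJ.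
by rewrite BE; have [_] := hf i; rewrite iJ => ->.
Qed.

End mutual_independence.

Theorem mainTheorem1 (R : realType) (d : nat) (p alpha T : R)
  (sigma : {finite_measure set (d.-tuple R) -> \bar R})
  (Qk : R.-pker (d.-tuple R) ~> R)
  (dO : measure_display) (Omega : measurableType dO) (P : probability Omega R)
  (E E' Tt U : nat -> {RV P >-> R}) (V : nat -> {RV P >-> d.-tuple R})
  (hT : 0 < T) :
  (1 <= d)%N -> 0 < p -> 0 < alpha < 2 ->
  (* sigma is a finite nonzero Borel measure on the unit sphere *)
  sigma (~` sphere) = 0%E -> sigma setT != 0%E ->
  (* Q(.|u) is a probability measure on (0,oo) for u in the sphere *)
  (forall u, sphere u -> Qk u Rpos = 1%E) ->
  (* distributions *)
  (forall j (A : set R), measurable A ->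
     distribution P (E j) A = exponential_prob 1 A) ->
  (forall j (A : set R), measurable A ->
     distribution P (E' j) A = exponential_prob 1 A) ->
  (forall j (A : set R), measurable A ->
     distribution P (Tt j) A = uniform_prob hT A) ->
  (forall j (A : set R), measurable A ->
     distribution P (U j) A = uniform_prob ltr01 A) ->
  (forall j (A : set (d.-tuple R)), measurable A ->
     distribution P (V j) A = (measQ sigma Qk A * ((fine (sigma setT))^-1)%:E)%E) ->
  (* all the variables E_j, E'_j, T_j, U_j, V_j (j >= 1) are mutually independent *)
  mutually_independent P (fun kj : 'I_5 * nat =>
     match nat_of_ord kj.1 with
     | 0 => rv_events (E kj.2)
     | 1 => rv_events (E' kj.2)
     | 2 => rv_events (Tt kj.2)
     | 3 => rv_events (U kj.2)
     | _ => rv_events (V kj.2)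
     end) ->
  (* alpha < 1, or alpha in [1,2) and Q symmetric *)
  (alpha < 1 \/
   (1 <= alpha /\ forall A : set (d.-tuple R), measurable A ->
      measQ sigma Qk [set x | A (vopp x)] = measQ sigma Qk A)) ->
  exists L : R -> Omega -> d.-tuple R,
    (* a.s. uniform convergence on [0,T] of the series *)
    {ae P, forall w, forall eps : R, 0 < eps -> exists N : nat, forall n : nat,
       (N <= n)%N -> forall t : R, 0 <= t <= T ->
       vnorm (vsub (ts_partial alpha p T (fine (sigma setT))
                     (fun j => E j) (fun j => E' j) (fun j => Tt j) (fun j => U j)
                     (fun j => V j) n t w) (L t w)) < eps} /\
    levy_process P T L /\
    (* law of L: infinitely divisible, no Gaussian part, Levy measure M *)
    is_levy_measure (levy_M sigma Qk alpha p) /\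
    exists b : d.-tuple R, forall t : R, 0 <= t <= T -> forall z : d.-tuple R,
      chf_re P (L t) z =
        (expR (t * lk_re (levy_M sigma Qk alpha p) z) *
         cos (t * lk_im (levy_M sigma Qk alpha p) b z))%:E /\
      chf_im P (L t) z =
        (expR (t * lk_re (levy_M sigma Qk alpha p) z) *
         sin (t * lk_im (levy_M sigma Qk alpha p) b z))%:E.
Proof.
move=> d1 p0 a02 _ signz Qk_pos hE hE' hTt hU hV hindep hcase.
have sig0 : 0 < fine (sigma setT).
  rewrite fine_gt0// lt_neqAle eq_sym signz measure_ge0/=.
  by rewrite ltey_eq fin_num_measure.
(* The law of [V 0] serves as common law of the [V j]: it is a probability by construction, whereas
   the formula through [measQ] is a set function. *)
pose QV : probability (d.-tuple R) R := distribution P (V 0%N).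
have lV j (A : set (d.-tuple R)) : measurable A -> distribution P (V j) A = QV A.
  by move=> mA; exact: etrans (hV j A mA) (esym (hV 0%N A mA)).
have QVE (A : set (d.-tuple R)) : measurable A ->
    QV A = (measQ sigma Qk A * ((fine (sigma setT))^-1)%:E)%E by move=> mA; exact: hV.
have hcase' : alpha < 1 \/
    (forall A : set (d.-tuple R), measurable A -> QV (vopp @^-1` A) = QV A).
  case: hcase => [|[_ sym]]; [by left|right=> A mA].
  have mN : measurable (vopp @^-1` A : set (d.-tuple R)).
    by rewrite -[X in measurable X]setTI; exact: measurable_vopp.
  by rewrite !QVE//; congr (_ * _)%E; exact: sym.
have indep : mutually_independent P (ts_events E E' Tt U V) by exact: hindep.
have ucs := series_uniform_cauchy hE' lV indep p a02 hT sig0 hcase'.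
have [b sinM] := mean_sin a02 p0 hT sig0 Qk_pos QVE hcase'.
have cosM z := mean_cos a02 p0 hT sig0 Qk_pos QVE z.
set L := ts_limit E E' Tt U V alpha p T (fine (sigma setT)).
have joint := joint_chf hE hE' hTt hU lV indep a02 sig0 ucs cosM sinM.
have mI s t : measurable_fun setT (fun w => vsub (L s w) (L t w)) by exact: measurable_increment.
have single s t z : 0 <= s -> s <= t -> t <= T ->
    \int[P]_w cos (vdot z (vsub (L t w) (L s w))) =
      expR ((t - s) * lk_re (levy_M sigma Qk alpha p) z) *
      cos ((t - s) * lk_im (levy_M sigma Qk alpha p) b z) /\
    \int[P]_w sin (vdot z (vsub (L t w) (L s w))) =
      expR ((t - s) * lk_re (levy_M sigma Qk alpha p) z) *
      sin ((t - s) * lk_im (levy_M sigma Qk alpha p) b z).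
  move=> s0 st tT.
  (* A partition with a single interval turns the joint formula into that of one increment. *)
  pose t' k := if k is 0%N then s else t.
  have tm k : (k < 1)%N -> t' k <= t' k.+1 by case: k.
  have [] := joint 1%N t' (fun=> z) s0 tm tT.
  rewrite !big_ord1 /= => <- <-.
  by split; apply: eq_Rintegral => w _; rewrite big_ord1.
have L0 w : L 0 w = vzero by exact: ts_limit0.
exists L; split.
  apply: filterS ucs => w uc eps eps0.
  by have [N hN] := limit_path_unif uc eps0; exists N => k Nk t _; exact: hN.
split; last split; last 1 first.
- exists b => t /andP[t0 tT] z.
  (* [L] starts at the origin, so [L t] is its own increment from time 0. *)
  have [c s] := single 0 t z (lexx 0) t0 tT; rewrite subr0 in c s.
  have E0 w : vsub (L t w) (L 0 w) = L t w.
    by apply: eq_from_tnth => i; rewrite tnth_vsub L0 tnth_vzero subr0.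
  have mz : measurable_fun setT (fun w => vdot z (L t w)).
    by apply: (measurableT_comp (measurable_vdot z)); exact: measurable_ts_limit.
  rewrite /chf_re /chf_im RE_EFin; last exact: bmf_cos.
  rewrite RE_EFin; last exact: bmf_sin.
  rewrite -c -s; split; congr EFin; apply: eq_Rintegral => w _; rewrite E0//.
- split; first by move=> t _; exact: measurable_ts_limit.
  split; first by apply: aeW => w; exact: L0.
  split.
    move=> N t t0 tlt tT.
    pose X k w := vsub (L (t k.+1) w) (L (t k) w).
    apply: (@mutually_independent_rv R _ _ P d N X) => [k|B mB]; first exact: mI.
    have tm k : (k < N)%N -> t k <= t k.+1 by move=> kN; exact: ltW (tlt k kN).
    have tmono k : (k <= N)%N -> 0 <= t k /\ forall j, (k + j = N)%N -> t k <= t N.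
      move=> kN; split.
        elim: k kN => // k ih kN; exact: le_trans (ih (ltnW kN)) (tm k kN).
      move=> j; elim: j k kN => [|j ih] k kN; first by rewrite addn0 => ->.
      rewrite addnS -addSn => kj.
      have kN' : (k < N)%N by rewrite -kj leq_addr.
      exact: le_trans (tm k kN') (ih _ kN' kj).
    apply: (@indep_of_chf R _ _ P d N X
      (fun k z => (t k.+1 - t k) * lk_re (levy_M sigma Qk alpha p) z)
      (fun k z => (t k.+1 - t k) * lk_im (levy_M sigma Qk alpha p) b z)) => //.
    + by move=> k; exact: mI.
    + move=> z /=; have [] := joint N t z t0 tm tT; rewrite !big_mkord => <- <-.
      by split; apply: eq_Rintegral => w _; rewrite big_mkord.
    + move=> k z kN; apply: single; first by have [] := tmono k (ltnW kN).
        exact: tm.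
      by apply: le_trans tT; have [_] := tmono k.+1 kN; apply; exact: (subnKC kN).
  split.
    move=> s s' h s0 s0' h0 sT sT' B mB.
    (* Stationarity: the characteristic function of an increment depends only on its length. *)
    apply: (law_of_chf (mI (s + h) s) (mI (s' + h) s') _ mB) => z.
    have [c1 e1] := single s (s + h) z s0 (ler_wpDr h0 (lexx s)) sT.
    have [c2 e2] := single s' (s' + h) z s0' (ler_wpDr h0 (lexx s')) sT'.
    rewrite addrAC subrr add0r in c1 e1; rewrite addrAC subrr add0r in c2 e2.
    by split; [exact: (etrans c1 (esym c2))|exact: (etrans e1 (esym e2))].
  split.
    move=> t _ eps eta e0 eta0.
    have [dl dl0 hdl] := ts_limit_stoch_cont hTt ucs t e0 eta0.
    by exists dl => // s _; exact: hdl.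
  apply: filterS ucs => w uc; split => t _.
    move=> eps e0; have [dl dl0 hdl] := ts_limit_right uc t e0.
    by exists dl => // s hs _; exact: hdl.
  have [l hl] := ts_limit_left uc t; exists l => eps e0.
  by have [dl dl0 hdl] := hl eps e0; exists dl => // s hs _; exact: hdl.
- by apply: (levy_M_is_levy_measure _ p0 hT sig0 Qk_pos QVE); case/andP: a02.
Qed.
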